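(* Let $(X_t)_{t\in J}$ be a centered continuous additive process, represented as $X_t=B_{V(t)}$. Suppose that $V$ is locally bi-Lipschitz at every point of $J$ except for finitely many points. Then, almost surely, $\dim_H\mathcal{G}(X,J)=3/2$ and $\dim_F\mathcal{G}(X,J)\ge 2/3$.
   Context: $J=[0,S]$ with $0<S\le\infty$ (meaning $[0,\infty)$ if $S=\infty$). A real-valued process $(X_t)_{t\in J}$ is an additive process if it has independent increments, $X_0=0$ almost surely, and it is continuous in probability. It is a continuous additive process if moreover its sample paths are almost surely continuous, and it is centered if $\mathbb{E}[X_t]=0$ for all $t$. A centered continuous additive process can be represented as $X_t=B_{V(t)}$, where $B$ is a standard Brownian motion with $B_0=0$ and $V(t)=\mathbb{E}[X_t^2]$ is a continuous nondecreasing function on $J$ with $V(0)=0$. $V$ is locally (uniformly) bi-Lipschitz at $t\in J$ if there are $\delta>0$ and $c,C>0$ such that $c|u-v|\le|V(u)-V(v)|\le C|u-v|$ for all $u,v\in J\cap I(t,\delta)$, where $I(t,\delta)$ is the open interval of length $\delta$ centered at $t$. The graph is $\mathcal{G}(X,E)=\{(t,X_t):t\in E\}\subset\mathbb{R}^2$, and $\dim_H$ is Hausdorff dimension. Fourier dimension: for a Borel set $E\subset\mathbb{R}^2$, $\dim_F E$ is the supremum of all $\alpha\ge0$ for which there is a nonzero finite Borel measure $\mu$ supported on $E$ and a constant $C$ with $|\widehat\mu(\xi)|\le C|\xi|^{-\alpha/2}$ for all $\xi\ne0$, where $\widehat\mu(\xi)=\int e^{-2\pi i\xi\cdot x}\,d\mu(x)$.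 *)

(* Defs.v *)
From HB Require Import structures.
From mathcomp Require Import all_boot all_order all_algebra.
From mathcomp Require Import complex.
From mathcomp Require Import all_classical all_reals all_analysis.

Set Implicit Arguments.
Unset Strict Implicit.
Unset Printing Implicit Defensive.

Import Order.TTheory GRing.Theory Num.Theory.
Import numFieldNormedType.Exports.

Local Open Scope classical_set_scope.
Local Open Scope ring_scope.

(* [0, S], read as [0, +oo[ when S = +oo. *)
Definition time_interval (R : realType) (S : \bar R) : set R :=
  [set t | 0 <= t /\ (t%:E <= S)%E].

Section processes.
Context d (T : measurableType d) (R : realType) (P : probability T R).

Definition mutually_independent (n : nat) (Y : 'I_n -> T -> R) : Prop :=
  forall B : 'I_n -> set R, (forall i, measurable (B i)) ->
    P [set w | forall i, B i (Y i w)]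
    = (\prod_(i < n) P (Y i @^-1` B i))%E.

(* A process is indexed by all of R, but only its values at times in the
   time set D are ever constrained. *)
Definition independent_increments (D : set R) (X : R -> {RV P >-> R}) : Prop :=
  forall (n : nat) (t : nat -> R),
    (forall i, (i <= n)%N -> D (t i)) ->
    (forall i, (i < n)%N -> t i < t i.+1) ->
    mutually_independent (fun (i : 'I_n) w => X (t i.+1) w - X (t i) w).

Definition continuous_in_probability (D : set R) (X : R -> {RV P >-> R}) :
    Prop :=
  forall t, D t -> forall e : R, 0 < e ->
    P [set w | e < `|X s w - X t w|] @[s --> within D (nbhs t)] --> 0%E.

Definition additive_process (J : set R) (X : R -> {RV P >-> R}) : Prop :=
  [/\ independent_increments J X,
      {ae P, forall w, X 0 w = 0} &
      continuous_in_probability J X].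

Definition ae_continuous_paths (D : set R) (X : R -> {RV P >-> R}) : Prop :=
  {ae P, forall w, {within D, continuous (fun t => X t w)}}.

Definition continuous_additive_process (J : set R) (X : R -> {RV P >-> R}) :
    Prop :=
  additive_process J X /\ ae_continuous_paths J X.

(* No separate integrability assumption is needed: the integral of a
   non-integrable function is infinite, since +oo - +oo = -oo in \bar R. *)
Definition centered (J : set R) (X : R -> {RV P >-> R}) : Prop :=
  forall t, J t -> ('E_P[X t] = 0)%E.

(* Standard Brownian motion over the times in D (with 0 in D).  The second
   argument of normal_prob is the standard deviation. *)
Definition standard_brownian_motion (D : set R) (B : R -> {RV P >-> R}) :
    Prop :=
  [/\ {ae P, forall w, B 0 w = 0},
      independent_increments D B,
      forall s t, D s -> D t -> s < t ->
        forall A : set R, measurable A ->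
          P [set w | A (B t w - B s w)] = normal_prob 0 (Num.sqrt (t - s)) A &
      ae_continuous_paths D B].

(* X_t = B_(V t).  Brownian motion is only required at the times in V(J), so
   that the representation exists on the probability space of X itself;
   Brownian motion at all times in [0, +oo[ could need a larger space when V
   is bounded. *)
Definition brownian_representation (J : set R) (X B : R -> {RV P >-> R})
    (V : R -> R) : Prop :=
  [/\ forall t, J t -> ('E_P[fun w => (X t w ^+ 2)%R] = (V t)%:E)%E,
      [/\ V 0 = 0,
          {in J &, {homo V : s t / s <= t}} &
          {within J, continuous V}],
      standard_brownian_motion (V @` J) B &
      {ae P, forall w, forall t, J t -> X t w = B (V t) w}].

End processes.

Section regularity.
Context (R : realType).

(* J `&` I(t, delta), where I(t, delta) has length (not radius) delta. *)
Definition locally_bilipschitz (J : set R) (V : R -> R) (t : R) : Prop :=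
  exists delta c C : R, [/\ 0 < delta, 0 < c, 0 < C &
    forall u v : R, J u -> J v ->
      `|u - t| < delta / 2 -> `|v - t| < delta / 2 ->
      c * `|u - v| <= `|V u - V v| /\ `|V u - V v| <= C * `|u - v| ].

Definition graph (f : R -> R) (E : set R) : set (R * R) :=
  [set (t, f t) | t in E].

End regularity.

(* The norm of the library on R * R is the max norm; the Euclidean structure
   is the one used below. *)
Section euclidean_plane.
Context (R : realType).

Definition dot2 (x y : R * R) : R := x.1 * y.1 + x.2 * y.2.

Definition norm2 (x : R * R) : R := Num.sqrt (dot2 x x).

Definition diam2 (U : set (R * R)) : \bar R :=
  ereal_sup [set r | r = 0%E \/
    exists x y, [/\ U x, U y & r = (norm2 (x - y))%:E]].

(* diam(U)^s, the empty set contributing 0 even when s = 0. *)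
Definition diam2_pow (s : R) (U : set (R * R)) : \bar R :=
  if U == set0 then 0%E else poweR (diam2 U) s.

Definition hausdorff_premeasure (s delta : R) (E : set (R * R)) : \bar R :=
  ereal_inf [set (\sum_(0 <= i <oo) diam2_pow s (U i))%E |
    U in [set U : nat -> set (R * R) |
      E `<=` \bigcup_i U i /\ forall i, (diam2 (U i) <= delta%:E)%E]].

Definition hausdorff_measure (s : R) (E : set (R * R)) : \bar R :=
  ereal_sup [set hausdorff_premeasure s delta E |
    delta in [set delta : R | 0 < delta]].

Definition hausdorff_dim (E : set (R * R)) : \bar R :=
  ereal_inf [set s%:E | s in [set s : R |
    0 <= s /\ hausdorff_measure s E = 0%E]].

(* exp(- i theta) = cos theta - i sin theta, integrated componentwise. *)
Definition fourier_transform (mu : {measure set (R * R) -> \bar R})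
    (xi : R * R) : R[i] :=
  Complex (\int[mu]_x cos (2 * pi * dot2 xi x))
          (- \int[mu]_x sin (2 * pi * dot2 xi x)).

(* The product sigma-algebra on R * R is the Borel sigma-algebra of the
   plane. *)
Definition fourier_dim (E : set (R * R)) : \bar R :=
  ereal_sup [set alpha%:E | alpha in [set alpha : R | 0 <= alpha /\
    exists mu : {finite_measure set (R * R)%type -> \bar R},
      [/\ mu [set: (R * R)%type] != 0%E,
          mu.-negligible (~` E) &
          exists C : R, forall xi : R * R, xi != 0 ->
            ComplexField.Normc.normc (fourier_transform mu xi)
            <= C * norm2 xi `^ (- (alpha / 2))]]].

End euclidean_plane.

(* Main.v *)
Require Import Defs.
From HB Require Import structures.
From mathcomp Require Import all_boot all_order all_algebra.
From mathcomp Require Import complex.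
From mathcomp Require Import all_classical all_reals all_analysis.
From mathcomp Require Import measurable_realfun.
From mathcomp Require Import ring lra zify.
Import Order.TTheory GRing.Theory Num.Theory.
Import numFieldNormedType.Exports.
Local Open Scope classical_set_scope.
Local Open Scope ring_scope.
Set Implicit Arguments.
Unset Strict Implicit.
Unset Printing Implicit Defensive.

(** Choose an interval [a, b] of positive times on which V is bi-Lipschitz with
    constants c and C.  On it the increments of X are independent centred
    Gaussians whose variances are comparable with their time lengths
    ([regular_on]); this and the continuity of the paths give the two lower
    bounds.

    Fourier dimension.  Let nu be the image of the uniform law of [a, b] under
    t |-> (t, X_t).  For a frequency xi of size about 8^k cut [a, b] into 4^k
    blocks.  Given the past, the mean of the oscillating integral over one
    block is O(8^-k): the characteristic functions of the increments multiply
    to decreasing weights, and either the phase xi1 * t averages out (Abel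
    summation against the Dirichlet kernel) or the weights decay geometrically
    at rate xi2^2.  The remainder is a martingale with 4^k differences of size
    4^-k, so its fluctuations have size 2^-k, and 2^k times the whole integral
    has a bounded exponential moment ([expectation_exp_osc_riemann]).  A union
    bound over a grid of e^O(k) frequencies costs only a factor k
    ([ae_osc_decay]); hence |nu^(xi)| is at most L k 2^-k, which is
    |xi|^(-1/3) up to a logarithm, and dim_F is at least every alpha < 2/3
    ([fourier_dim_graph_ge]).

    Lower bound for dim_H.  Two points of the graph are within r of each other
    for a set of pairs of times of expected measure O(r^(3/2)), because a
    Gaussian of deviation sqrt(c h) is below r with probability at most
    r / sqrt(c h) ([expectation_close_count]).  Along the radii 4^-(p n),
    Markov's inequality gives a set A of times of positive measure around
    which the occupation measure of balls is O(r^s) for s = 3/2 - 1/p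
    ([positive_occupation_set]), and the mass distribution principle applies
    ([mass_distribution]).

    Upper bound for dim_H, for every V.  In the time scale t + V(t), suitably
    normalised, both the time and the variance of X are Lipschitz
    ([time_change]).  The fourth moments of the increments over a D-adic grid
    with D = 4^p then control the oscillation of X in each cell by chaining
    ([sum_oscillation]), and D^m columns of squares of side D^-m number at most
    D^(m (3/2 + o(1))) as p grows, so that the measure of dimension 3/2 + 1/p
    vanishes ([curve_hausdorff_measure0]). *)

(** * Trigonometric and exponential inequalities *)

Section elementary.
Context {R : realType}.
Implicit Types x y : R.

Lemma cos_lip x y : `|cos x - cos y| <= `|x - y|.
Proof.
wlog xy : x y / y <= x.
  move=> h; have [|/ltW] := leP y x; first exact: h.
  by move=> /h; rewrite distrC (distrC y).
have [->|yx] := eqVneq x y; first by rewrite !subrr.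
have ltyx : y < x by rewrite lt_neqAle eq_sym yx.
have [z _ ->] := @MVT R cos (fun z => - sin z) y x ltyx
  (fun z _ => is_derive_cos z) (continuous_subspaceT (@continuous_cos R)).
by rewrite normrM ler_piMl// normrN sin_max.
Qed.

Lemma sin_le_norm x : `|sin x| <= `|x|.
Proof.
have := cos_lip (x - pi / 2) (- (pi / 2)).
rewrite cosBpihalf cosN cos_pihalf subr0.
by rewrite (_ : x - pi / 2 - - (pi / 2) = x)//; ring.
Qed.

Lemma one_sub_cosE x : 1 - cos x = 2 * sin (x / 2) ^+ 2.
Proof.
have -> : cos x = cos ((x / 2) *+ 2) by congr cos; field.
by rewrite cos_mulr2n cos2sin2; ring.
Qed.

Lemma cos_ge_quadratic x : 1 - x ^+ 2 / 2 <= cos x.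
Proof.
rewrite lerBlDr -lerBlDl one_sub_cosE.
have : sin (x / 2) ^+ 2 <= (x / 2) ^+ 2.
  by rewrite -[leLHS]real_normK ?num_real// -[leRHS]real_normK ?num_real//
    lerXn2r ?nnegrE// sin_le_norm.
by set s := sin _ ^+ 2; move=> h; nra.
Qed.

Lemma sin_ge_half x : 0 <= x <= 1 -> x / 2 <= sin x.
Proof.
move=> /andP[x0 x1]; have [->|xn0] := eqVneq x 0; first by rewrite sin0 mul0r.
have xgt0 : 0 < x by rewrite lt_neqAle eq_sym xn0.
have [z zx] := @MVT R sin cos 0 x xgt0
  (fun z _ => is_derive_sin z) (continuous_subspaceT (@continuous_sin R)).
rewrite sin0 !subr0 => ->.
have := cos_ge_quadratic z; move: zx; rewrite in_itv/= => /andP[z0 zx] h.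
by rewrite mulrC ler_pM2r//; nra.
Qed.

Lemma sin_norm_ge_half x : `|x| <= 1 -> `|x| / 2 <= `|sin x|.
Proof.
move=> x1; have [x0|x0] := leP 0 x.
  by apply: le_trans (ler_norm _); rewrite ger0_norm// sin_ge_half// x0 -(ger0_norm x0).
rewrite -normrN -[`|sin x|]normrN -sinN; apply: le_trans (ler_norm _).
have nx0 : 0 <= - x by lra.
by rewrite ger0_norm// sin_ge_half// nx0 -(ger0_norm nx0) normrN.
Qed.

Lemma one_sub_cos_ge x : `|x| <= 2 -> x ^+ 2 / 8 <= 1 - cos x.
Proof.
move=> x2; rewrite one_sub_cosE.
have e2 : `|x / 2| = `|x| / 2 by rewrite normrM (@ger0_norm _ 2^-1).
have h : `|x / 2| <= 1 by rewrite e2; lra.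
have := sin_norm_ge_half h; rewrite e2 => h2.
rewrite -(real_normK (num_real (sin _))) -(real_normK (num_real x)).
have := normr_ge0 x; set a := `|x| in h h2 *; set b := `|sin _| in h2 *.
by move=> a0; nra.
Qed.

(** After integration the linear term disappears for a centred variable; what is
    left is Hoeffding's bound with a crude constant. *)
Lemma expR_le_id_add x : expR x <= x + expR (2 * x ^+ 2).
Proof.
have e0 := expR_gt0 x.
have h2 := expR_ge1Dx (2 * x ^+ 2).
have [x0|x0] := leP x 0.
  have : (1 - x) * expR x <= 1.
    rewrite -[leRHS](mulVf (lt0r_neq0 e0)) ler_pM2r// -expRN.
    by apply: le_trans (expR_ge1Dx _); lra.
  move=> h; apply: (@le_trans _ _ (1 + x + 2 * x ^+ 2)); last by lra.
  rewrite -(@ler_pM2l _ (1 - x)); last by lra.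
  apply: le_trans h _; rewrite -subr_ge0.
  have -> : (1 - x) * (1 + x + 2 * x ^+ 2) - 1 = x ^+ 2 * (1 - 2 * x) by ring.
  by rewrite mulr_ge0 ?sqr_ge0//; lra.
have [x1|x1] := leP x (1 / 2); last first.
  have : expR x <= expR (2 * x ^+ 2) by rewrite ler_expR; nra.
  by lra.
have : (1 - x / 2) ^+ 2 * expR x <= 1.
  have -> : expR x = expR (x / 2) ^+ 2 by rewrite -expRM_natl; congr expR; field.
  rewrite -exprMn -[leRHS](expr1n _ 2) lerXn2r// ?nnegrE//.
    by rewrite mulr_ge0 ?expR_ge0//; lra.
  rewrite -[leRHS](mulVf (lt0r_neq0 (expR_gt0 (x / 2)))) ler_pM2r ?expR_gt0// -expRN.
  exact: expR_ge1Dx.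
move=> h; apply: (@le_trans _ _ (1 + x + 2 * x ^+ 2)); last by lra.
have q : 1 <= (1 - x / 2) ^+ 2 * (1 + x + 2 * x ^+ 2) by nra.
rewrite -(@ler_pM2l _ ((1 - x / 2) ^+ 2)); first exact: le_trans q.
by rewrite exprn_gt0//; lra.
Qed.

End elementary.

(** * Expectations and Gaussian variables *)

Section expectation.
Context d (T : measurableType d) (R : realType) (P : probability T R).

Lemma bounded_integrable (f : T -> R) (M : R) :
  measurable_fun setT f -> (forall w, `|f w| <= M) ->
  P.-integrable setT (EFin \o f).
Proof.
move=> mf fM; apply: measurable_bounded_integrable => //.
  by rewrite -ge0_fin_numE// fin_num_measure.
exists M; split; first exact: num_real.
by move=> x Mx w _ /=; rewrite (le_trans (fM w))// ltW.
Qed.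

Lemma expectation_cst (r : R) : \int[P]_w r = r.
Proof. by rewrite Rintegral_cst//= [X in fine X]probability_setT mulr1. Qed.

Lemma integral_cst_prob (r : R) : (\int[P]_w r%:E = r%:E)%E.
Proof. by rewrite integral_cst//= [X in (_ * X)%E]probability_setT mule1. Qed.

Lemma integral_fin_Rintegral (f : T -> R) : P.-integrable setT (EFin \o f) ->
  (\int[P]_w (f w)%:E = (\int[P]_w f w)%:E)%E.
Proof. by move=> intf; rewrite /Rintegral fineK// integrable_fin_num. Qed.

End expectation.

Section gaussian.
Context (R : realType).
Local Notation mu := (@lebesgue_measure R).

Lemma ge0_integral_normal_prob (s : R) (f : R -> \bar R) :
  (forall x, 0 <= f x)%E -> measurable_fun setT f ->
  (\int[normal_prob 0 s]_x f x = \int[mu]_x (f x * (normal_pdf 0 s x)%:E))%E.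
Proof.
move=> f0 mf; rewrite -(Radon_Nikodym_SigmaFinite.change_of_variables
  (normal_prob_dominates 0 s))//.
have dom := normal_prob_dominates (0 : R) s.
apply: ae_eq_integral => //.
- apply: emeasurable_funM => //.
  exact: measurable_int (Radon_Nikodym_SigmaFinite.f_integrable dom).
- apply: emeasurable_funM => //; apply/measurable_EFinP.
  exact: measurable_normal_pdf.
- apply: ae_eqe_mul2l; apply: integral_ae_eq => //.
  + exact: Radon_Nikodym_SigmaFinite.f_integrable.
  + by apply/measurable_EFinP; exact: measurable_normal_pdf.
  + by move=> E _ mE; rewrite -Radon_Nikodym_SigmaFinite.f_integral.
Qed.

Lemma normal_prob_opp (s : R) (A : set R) : s != 0 -> measurable A ->
  normal_prob 0 s (-%R @^-1` A) = normal_prob 0 s A.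
Proof.
move=> s0 mA; rewrite /normal_prob.
pose opp : R -> measurableTypeR R := -%R.
have mopp : measurable_fun setT opp by exact: oppr_measurable.
transitivity (\int[pushforward mu opp]_(x in A) (normal_pdf 0 s x)%:E)%E; last first.
  by apply: eq_measure_integral => B mB _; exact: lebesgue_measureN.
rewrite ge0_integral_pushforward//=.
- apply: eq_integral => x _; congr (_%:E).
  by rewrite (normal_pdfE _ s0) /normal_fun !subr0 /opp sqrrN.
- apply/measurable_EFinP; apply: measurable_funTS; exact: measurable_normal_pdf.
- by move=> y _; rewrite lee_fin normal_pdf_ge0.
Qed.

Definition gaussian_law d (T : measurableType d) (P : probability T R)
    (s : R) (D : T -> R) : Prop :=
  forall A, measurable A -> P (D @^-1` A) = normal_prob 0 s A.

Lemma sqr_expRN_le (v : R) : 0 <= v -> v ^+ 2 * expR (- v) <= 4.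
Proof.
move=> v0.
rewrite expRN ler_pdivrMr ?expR_gt0//.
have -> : expR v = expR (v / 2) ^+ 2 by rewrite -expRM_natl; congr expR; field.
have -> : v ^+ 2 = 4 * (v / 2) ^+ 2 by field.
rewrite ler_pM2l// lerXn2r ?nnegrE ?expR_ge0 ?divr_ge0//.
by apply: le_trans (expR_ge1Dx _); lra.
Qed.

Section law.
Context d (T : measurableType d) (P : probability T R) (s : R) (D : T -> R).
Hypotheses (s0 : 0 < s) (mD : measurable_fun setT D) (law : gaussian_law P s D).

Let DT : T -> measurableTypeR R := D.

Lemma ge0_integral_gaussian (f : R -> \bar R) :
  (forall x, 0 <= f x)%E -> measurable_fun setT f ->
  (\int[P]_w f (D w) = \int[mu]_x (f x * (normal_pdf 0 s x)%:E))%E.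
Proof.
move=> f0 mf; rewrite -ge0_integral_normal_prob//.
transitivity (\int[pushforward P DT]_x f x)%E.
  by rewrite ge0_integral_pushforward.
by apply: eq_measure_integral => A mA _; exact: law.
Qed.

Lemma normal_peak_le : normal_peak s <= (2 * s)^-1.
Proof.
have pi2 := pi_ge2 R; have ss : 0 < s ^+ 2 by rewrite exprn_gt0.
have h : (2 * s) ^+ 2 <= s ^+ 2 * pi *+ 2 by rewrite -mulr_natl; nra.
have h2 : 2 * s <= Num.sqrt (s ^+ 2 * pi *+ 2).
  have := ler_wsqrtr h; rewrite sqrtr_sqr ger0_norm// mulr_ge0// ltW//.
have s2 : 0 < 2 * s by rewrite mulr_gt0.
by rewrite /normal_peak lef_pV2// posrE (lt_le_trans s2).
Qed.

Lemma gaussian_small_ball (r : R) : 0 <= r ->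
  (P [set w | `|D w| < r]%R <= (r / s)%:E)%E.
Proof.
move=> r0.
have -> : [set w | `|D w| < r] = D @^-1` `]-r, r[%classic.
  by apply/seteqP; split => w /=; rewrite in_itv/= ltr_norml.
rewrite law//= /normal_prob.
apply: (@le_trans _ _ (\int[mu]_(x in `](- r)%R, r[) (normal_peak s)%:E)%E).
  apply: ge0_le_integral => //=.
  - by move=> x _; rewrite lee_fin normal_pdf_ge0.
  - apply/measurable_EFinP; apply: measurable_funTS; exact: measurable_normal_pdf.
  - by move=> x _; rewrite lee_fin normal_pdf_ub// gt_eqF.
rewrite integral_cst//= lebesgue_measure_itv/= lte_fin.
case: ifPn => rr; last by rewrite mule0 lee_fin divr_ge0// ltW.
rewrite -EFinB -EFinM lee_fin opprK.
apply: (@le_trans _ _ ((2 * s)^-1 * (r + r))); first by rewrite ler_wpM2r ?normal_peak_le//; lra.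
rewrite le_eqVlt; apply/orP; left; apply/eqP; field; by rewrite gt_eqF.
Qed.

(** Doubling the deviation turns the weight x^4 into a constant, so the fourth
    moment needs no integration by parts: a multiple of a probability density
    dominates the integrand. *)
Lemma quartic_normal_pdf (x : R) :
  x ^+ 4 * normal_pdf 0 s x <= 128 * s ^+ 4 * normal_pdf 0 (2 * s) x.
Proof.
have s20 : 2 * s != 0 by rewrite gt_eqF// mulr_gt0.
rewrite (normal_pdfE _ (lt0r_neq0 s0)) (normal_pdfE _ s20) /normal_fun !subr0.
have pk : normal_peak s = 2 * normal_peak (2 * s).
  rewrite /normal_peak.
  have -> : (2 * s) ^+ 2 * pi *+ 2 = 2 ^+ 2 * (s ^+ 2 * pi *+ 2) by ring.
  by rewrite sqrtrM ?sqr_ge0// sqrtr_sqr ger0_norm// invfM mulrA divff// mul1r.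
rewrite pk; set k := normal_peak _; have k0 : 0 <= k by exact: normal_peak_ge0.
set u := x ^+ 2 / (4 * s ^+ 2).
have u0 : 0 <= u by rewrite divr_ge0 ?sqr_ge0// mulr_ge0// sqr_ge0.
have -> : - x ^+ 2 / (s ^+ 2 *+ 2) = - u + - u by rewrite /u; field; rewrite gt_eqF.
have -> : - x ^+ 2 / ((2 * s) ^+ 2 *+ 2) = - (u / 2).
  by rewrite /u; field; rewrite gt_eqF.
have -> : x ^+ 4 = 16 * s ^+ 4 * u ^+ 2 by rewrite /u; field; rewrite gt_eqF.
have hu : u ^+ 2 * expR (- u) <= 4 by exact: sqr_expRN_le.
have hv : expR (- u) <= expR (- (u / 2)) by rewrite ler_expR; lra.
rewrite expRD; set a := expR (- u) in hu hv *; set b := expR _ in hv *.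
have a0 : 0 <= a by exact: expR_ge0.
have s4 : 0 <= s ^+ 4 by rewrite exprn_ge0// ltW.
have h1 : (u ^+ 2 * a) * a <= 4 * b.
  have ua : 0 <= u ^+ 2 * a by rewrite mulr_ge0// sqr_ge0.
  exact: ler_pM.
have sk : 0 <= 32 * s ^+ 4 * k by apply: mulr_ge0 => //; apply: mulr_ge0.
have := ler_wpM2l sk h1.
by rewrite (_ : 16 * s ^+ 4 * u ^+ 2 * _ = 32 * s ^+ 4 * k * (u ^+ 2 * a * a));
  [|ring]; move=> h; rewrite (le_trans h)//; lra.
Qed.

Lemma gaussian_fourth_moment :
  (\int[P]_w ((D w) ^+ 4)%:E <= (128 * s ^+ 4)%:E)%E.
Proof.
rewrite (ge0_integral_gaussian (f := fun x => (x ^+ 4)%:E)); last 2 first.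
- by move=> x; rewrite lee_fin exprn_even_ge0.
- by apply/measurable_EFinP; exact: exprn_measurable.
apply: (@le_trans _ _ (\int[mu]_x ((128 * s ^+ 4)%:E *
    (normal_pdf 0 (2 * s) x)%:E))%E).
  apply: ge0_le_integral => //=.
  - by move=> x _; rewrite -EFinM lee_fin mulr_ge0 ?normal_pdf_ge0 ?exprn_even_ge0.
  - apply: emeasurable_funM; apply/measurable_EFinP.
      exact: exprn_measurable.
    exact: measurable_normal_pdf.
  - apply: emeasurable_funM; apply/measurable_EFinP => //.
    exact: measurable_normal_pdf.
  - by move=> x _; rewrite -!EFinM lee_fin quartic_normal_pdf.
rewrite ge0_integralZl_EFin//=.
- by rewrite integral_normal_pdf mule1.
- by move=> x _; rewrite lee_fin normal_pdf_ge0.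
- by apply/measurable_EFinP; exact: measurable_normal_pdf.
- by rewrite mulr_ge0// exprn_even_ge0.
Qed.

Lemma measurable_cos_comp (a : R) : measurable_fun setT (fun w => cos (a * D w)).
Proof.
apply: measurableT_comp; first exact: (@continuous_measurable_fun _ cos (@continuous_cos R)).
exact: measurable_funM.
Qed.

Lemma measurable_sin_comp (a : R) : measurable_fun setT (fun w => sin (a * D w)).
Proof.
apply: measurableT_comp; first exact: (@continuous_measurable_fun _ sin (@continuous_sin R)).
exact: measurable_funM.
Qed.

Lemma gaussian_sin (a : R) : \int[P]_w sin (a * D w) = 0.
Proof.
have intS : P.-integrable setT (EFin \o (fun w => sin (a * D w))).
  apply: (@bounded_integrable _ _ _ _ _ 1) => [|w]; first exact: measurable_sin_comp.
  exact: sin_max.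
have mND : measurable_fun setT (fun w => - D w : measurableTypeR R).
  exact: measurable_funN.
have msin : measurable_fun setT (fun y : measurableTypeR R => (sin (a * y))%:E).
  apply/measurable_EFinP; apply: measurableT_comp.
    exact: (@continuous_measurable_fun _ sin (@continuous_sin R)).
  exact: measurable_funM.
have intSN : P.-integrable setT ((fun y : measurableTypeR R => (sin (a * y))%:E)
    \o (fun w => - D w : measurableTypeR R)).
  apply: (@bounded_integrable _ _ _ _ _ 1) => [|w]; last exact: sin_max.
  by have := measurableT_comp msin mND => /measurable_EFinP.
have : (\int[P]_w (sin (a * D w))%:E = \int[P]_w (sin (a * - D w))%:E)%E.
  rewrite -(integral_pushforward (phi := DT) mD msin intS measurableT).
  rewrite -(integral_pushforward mND msin intSN measurableT).
  apply: eq_measure_integral => A mA _.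
  rewrite [LHS]law// -normal_prob_opp// ?gt_eqF//.
  have mNA : measurable (-%R @^-1` A : set R).
    by rewrite -[X in measurable X]setTI; apply: oppr_measurable.
  by rewrite -law.
under [in RHS]eq_integral do rewrite mulrN sinN EFinN.
rewrite integralN; last by apply: integrable_add_def intS.
rewrite integral_fin_Rintegral// -EFinN => -[] h; lra.
Qed.

(** The upper bound is a quantitative form of E cos(a D) < 1 obtained without the
    characteristic function.  Where s/4 <= |D| <= 5s the integrand 1 - cos is
    at least K = a^2 s^2 / 128; the small-ball estimate and the fourth moment
    show that the complement costs at most half of K. *)
Lemma gaussian_cos (a : R) : `|a| * s <= 1 / 16 ->
  0 <= \int[P]_w cos (a * D w) <= 1 - a ^+ 2 * s ^+ 2 / 256.
Proof.
move=> as1; have mc := measurable_cos_comp a.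
have intC : P.-integrable setT (EFin \o (fun w => cos (a * D w))).
  by apply: (@bounded_integrable _ _ _ _ _ 1) => [//|w]; exact: cos_max.
have intC1 : P.-integrable setT (EFin \o (fun w => 1 - cos (a * D w))).
  apply: (@bounded_integrable _ _ _ _ _ 2) => [|w]; first exact: measurable_funB.
  rewrite ger0_norm; last by rewrite subr_ge0 cos_le1.
  by have := cos_geN1 (a * D w); lra.
have int1 : P.-integrable setT (EFin \o (fun _ : T => 1 : R)).
  by apply: (@bounded_integrable _ _ _ _ _ 1) => [//|w]; rewrite normr1.
have E : (\int[P]_w (1 - cos (a * D w))%:E = (1 - \int[P]_w cos (a * D w))%:E)%E.
  by rewrite integral_fin_Rintegral// RintegralB// expectation_cst.
have mD4 (c : R) : measurable_fun setT (fun w => (c * D w ^+ 4)%:E).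
  by apply/measurable_EFinP; apply: measurable_funM => //; exact: measurable_funX.
have D40 w : 0 <= D w ^+ 4 by exact: exprn_even_ge0.
have c1cos w : 0 <= 1 - cos (a * D w) by rewrite subr_ge0 cos_le1.
have m1cos : measurable_fun setT (fun w => (1 - cos (a * D w))%:E).
  by apply/measurable_EFinP; exact: measurable_funB.
have s2 : 0 < s ^+ 2 by rewrite exprn_gt0.
have as2 : a ^+ 2 * s ^+ 2 <= 1 / 256.
  rewrite -(real_normK (num_real a)) -exprMn (_ : 1 / 256 = (1 / 16) ^+ 2); last by field.
  by rewrite lerXn2r// nnegrE ?mulr_ge0// ltW.
have a2 : 0 <= a ^+ 2 by exact: sqr_ge0.
have fm := gaussian_fourth_moment.
set psi := \int[P]_w cos (a * D w) in E *.
apply/andP; split.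
  pose c1 := a ^+ 2 * s ^+ 2 / 4; pose c2 := a ^+ 2 / (4 * s ^+ 2).
  have c20 : 0 <= c2 by rewrite divr_ge0// mulr_ge0// ltW.
  have c10 : 0 <= c1 by rewrite divr_ge0// mulr_ge0// ltW.
  have : (\int[P]_w (1 - cos (a * D w))%:E <= \int[P]_w (c1%:E + (c2 * D w ^+ 4)%:E))%E.
    apply: ge0_le_integral => //.
    - exact: emeasurable_funD.
    - move=> w _; rewrite -EFinD lee_fin.
      have h := cos_ge_quadratic (a * D w); apply: (@le_trans _ _ ((a * D w) ^+ 2 / 2)); first by lra.
      rewrite /c1 /c2 -subr_ge0.
      rewrite (_ : _ - _ = a ^+ 2 / (4 * s ^+ 2) * (s ^+ 2 - D w ^+ 2) ^+ 2); last by field; rewrite gt_eqF.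
      by rewrite mulr_ge0 ?sqr_ge0.
  rewrite ge0_integralD; [|by []|by move=> w _; rewrite lee_fin|by []
    |by move=> w _; rewrite lee_fin mulr_ge0|by []].
  under [X in (_ <= _ + X)%E]eq_integral do rewrite EFinM.
  rewrite ge0_integralZl_EFin; [|by []|by move=> w _; rewrite lee_fin| |by []]; last first.
    by apply/measurable_EFinP; exact: measurable_funX.
  rewrite integral_cst_prob E => h.
  have {h} : ((1 - psi)%:E <= c1%:E + c2%:E * (128 * s ^+ 4)%:E)%E.
    by apply: (le_trans h); apply: leeD => //; apply: lee_wpmul2l => //; rewrite lee_fin.
  rewrite -EFinM -EFinD lee_fin.
  have -> : c1 + c2 * (128 * s ^+ 4) = a ^+ 2 * s ^+ 2 * (1 / 4 + 32).
    by rewrite /c1 /c2; field; rewrite gt_eqF.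
  by lra.
pose K := a ^+ 2 * s ^+ 2 / 128.
have K0 : 0 <= K by rewrite divr_ge0// mulr_ge0// ltW.
(* The value 512 is at most 5^4, and with it the fourth moment 128 s^4 costs only
   K / 4. *)
have [q [q0 q5 q128]] : exists q : R, [/\ 0 < q, q <= 5 ^+ 4 & 128 / q = 1 / 4].
  by exists 512; split; [rewrite ltr0n|rewrite -natrX ler_nat|field].
pose c2 := K / (q * s ^+ 4).
have s4 : 0 < s ^+ 4 by rewrite exprn_gt0.
have c20 : 0 <= c2 by rewrite divr_ge0// mulr_ge0 ?ltW.
pose A := [set w | `|D w| < s / 4].
have mA : measurable A.
  rewrite (_ : A = D @^-1` `]-(s/4), (s/4)[%classic); first by rewrite -[X in measurable X]setTI; exact: mD.
  by apply/seteqP; split => w; rewrite /A/= in_itv/= ltr_norml.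
have m1A : measurable_fun setT (fun w => (K * \1_A w)%:E).
  by apply/measurable_EFinP; apply: measurable_funM => //; exact: measurable_indic.
have : (\int[P]_w K%:E <= \int[P]_w ((1 - cos (a * D w))%:E + ((c2 * D w ^+ 4)%:E + (K * \1_A w)%:E)))%E.
  apply: ge0_le_integral => //.
  - by apply: emeasurable_funD => //; exact: emeasurable_funD.
  - move=> w _; rewrite -!EFinD lee_fin indicE.
    have h1 := c1cos w; have h2 : 0 <= c2 * D w ^+ 4 by rewrite mulr_ge0.
    case: (boolP (w \in A)) => [_|]; first by rewrite mulr1; lra.
    rewrite notin_setE /A/= => /negP; rewrite -leNgt mulr0 addr0 => Ds.
    have [D5|D5] := leP `|D w| (5 * s).
      have : `|a * D w| <= 2.
        rewrite normrM; apply: (@le_trans _ _ (`|a| * (5 * s))); last by lra.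
        by rewrite ler_wpM2l.
      move=> /one_sub_cos_ge h3.
      suff : K <= (a * D w) ^+ 2 / 8 by lra.
      have : (s / 4) ^+ 2 <= D w ^+ 2.
        rewrite -(real_normK (num_real (D w))) lerXn2r// nnegrE ?divr_ge0// ltW//.
      move=> h4; have := ler_wpM2l a2 h4; rewrite /K exprMn; lra.
    suff : K <= c2 * D w ^+ 4 by lra.
    have qs : 0 < q * s ^+ 4 by rewrite mulr_gt0.
    suff : q * s ^+ 4 <= D w ^+ 4.
      by move=> h; rewrite /c2 -mulrA -[X in X <= _]mulr1; rewrite ler_wpM2l// mulrC ler_pdivlMr// mul1r.
    have -> : D w ^+ 4 = `|D w| ^+ 4.
      by rewrite (_ : 4%N = (2 * 2)%N)// !exprM real_normK// num_real.
    apply: (@le_trans _ _ ((5 * s) ^+ 4)).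
      by rewrite exprMn ler_pM2r.
    by rewrite lerXn2r// ?nnegrE ?mulr_ge0// ltW.
rewrite ge0_integralD; [|by []|by move=> w _; rewrite lee_fin|by []
  |by move=> w _; rewrite adde_ge0// lee_fin mulr_ge0|exact: emeasurable_funD].
rewrite ge0_integralD; [|by []|by move=> w _; rewrite lee_fin mulr_ge0|by []
  |by move=> w _; rewrite lee_fin mulr_ge0|by []].
under [X in (_ <= _ + (X + _))%E]eq_integral do rewrite EFinM.
under [X in (_ <= _ + (_ + X))%E]eq_integral do rewrite EFinM.
rewrite ge0_integralZl_EFin; [|by []|by move=> w _; rewrite lee_fin| |by []]; last first.
  by apply/measurable_EFinP; exact: measurable_funX.
rewrite ge0_integralZl_EFin; [|by []|by move=> w _; rewrite lee_fin| |by []]; last first.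
  by apply/measurable_EFinP; exact: measurable_indic.
rewrite integral_cst_prob E integral_indic// setIT => h.
have PA : (P A <= (1 / 4)%:E)%E.
  have := @gaussian_small_ball (s / 4) (divr_ge0 (ltW s0) (ler0n _ _)).
  by rewrite (_ : s / 4 / s = 1 / 4)//; field; rewrite gt_eqF.
have {h} : (K%:E <= (1 - psi)%:E + (c2%:E * (128 * s ^+ 4)%:E + K%:E * (1 / 4)%:E))%E.
  apply: (le_trans h); apply: leeD => //; apply: leeD; apply: lee_wpmul2l => //; rewrite lee_fin//.
rewrite -!EFinM -!EFinD lee_fin.
have -> : c2 * (128 * s ^+ 4) = K / 4 by rewrite /c2 (_ : _ * _ = K * (128 / q)); [rewrite q128; lra|field; rewrite !gt_eqF].
by rewrite /K; lra.
Qed.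

End law.
End gaussian.

(** * Independence of a sequence from its past *)

Section independence.
Context d (T : measurableType d) (R : realType) (P : probability T R).
Variables (N : nat) (Y : nat -> T -> R).
Hypothesis mY : forall i, measurable_fun setT (Y i).
Hypothesis indep : mutually_independent P (fun i : 'I_N => Y i).

(** A pi-system that generates the sigma-algebra of Y 0, ..., Y k.-1. *)
Definition past_cylinders (k : nat) : set_system T :=
  [set A | exists B : nat -> set R, (forall i, measurable (B i)) /\
     A = [set w | forall i, (i < k)%N -> B i (Y i w)]].

Local Notation past k := (g_sigma_algebraType (past_cylinders k)).

Lemma past_cylinders_measurable k : past_cylinders k `<=` measurable.
Proof.
move=> A [B [mB ->]].
have -> : [set w | forall i, (i < k)%N -> B i (Y i w)] =
    \bigcap_(i < k) (Y i @^-1` B i).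
  by apply/seteqP; split => w h i ik; exact: h.
apply: bigcap_measurableType => i _; rewrite -[X in measurable X]setTI; exact: mY.
Qed.

Lemma past_measurable k (A : set T) :
  measurable (A : set (past k)) -> measurable A.
Proof.
exact: (smallest_sub (@sigma_algebra_measurable _ T) (@past_cylinders_measurable k)).
Qed.

Lemma past_measurable_fun k d' (U : measurableType d') (f : T -> U) :
  measurable_fun [set: past k] f -> measurable_fun [set: T] f.
Proof.
move=> mf _ B mB; rewrite setTI; apply: (@past_measurable k).
by rewrite -[X in measurable X]setTI; exact: mf.
Qed.

Lemma past_measurable_fun_le j k d' (U : measurableType d') (f : T -> U) :
  (j <= k)%N ->
  measurable_fun [set: past j] f -> measurable_fun [set: past k] f.
Proof.
move=> jk mf _ B mB; rewrite setTI.
have : measurable (f @^-1` B : set (past j)) by rewrite -[X in measurable X]setTI; exact: mf.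
apply: (smallest_sub (@sigma_algebra_measurable _ (past k))) => A [C [mC ->]].
apply: sub_sigma_algebra; exists (fun i => if (i < j)%N then C i else setT).
split=> [i|]; first by case: ifPn.
apply/seteqP; split=> w h i ij; first by case: ifPn => // /h.
by have := h i (leq_trans ij jk); rewrite ij.
Qed.

Lemma past_measurable_fun_coord k i : (i < k)%N ->
  measurable_fun [set: past k] (Y i).
Proof.
move=> ik _ B mB; rewrite setTI; apply: sub_sigma_algebra.
exists (fun j => if j == i then B else setT); split=> [j|]; first by case: ifPn.
apply/seteqP; split=> w; first by move=> Bw j _; case: eqP => // ->.
by move=> /(_ i ik); rewrite eqxx.
Qed.

Lemma past_cylinder_indep k (A : set T) (C : set R) : (k < N)%N ->
  past_cylinders k A -> measurable C ->
  P (A `&` Y k @^-1` C) = (P A * P (Y k @^-1` C))%E.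
Proof.
move=> kN [B [mB ->]] mC.
pose B1 i := if (i < k)%N then B i else if i == k then C else setT.
pose B2 i := if (i < k)%N then B i else setT.
have mB1 i : measurable (B1 i) by rewrite /B1; case: ifPn => // _; case: ifPn.
have mB2 i : measurable (B2 i) by rewrite /B2; case: ifPn.
have := indep (fun i : 'I_N => mB1 i); have := indep (fun i : 'I_N => mB2 i).
have -> : [set w | forall i : 'I_N, B2 i (Y i w)] =
    [set w | forall i, (i < k)%N -> B i (Y i w)].
  apply/seteqP; split => w h i.
    by move=> ik; have := h (Ordinal (ltn_trans ik kN)); rewrite /B2/= ik.
  by rewrite /B2; case: ifPn => // ik; exact: h.
have -> : [set w | forall i : 'I_N, B1 i (Y i w)] =
    [set w | forall i, (i < k)%N -> B i (Y i w)] `&` Y k @^-1` C.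
  apply/seteqP; split => w.
    move=> h; split=> [i ik|].
      by have := h (Ordinal (ltn_trans ik kN)); rewrite /B1/= ik.
    by have := h (Ordinal kN); rewrite /B1/= ltnn eqxx.
  move=> [h1 h2] i; rewrite /B1; case: ifPn => [ik|_]; first exact: h1.
  by case: eqP => // ->.
move=> -> ->; rewrite (bigD1 (Ordinal kN))//= (bigD1 (Ordinal kN) (F := fun i : 'I_N => P (Y i @^-1` B2 i)))//=.
rewrite {1}/B1 {1}/B2 ltnn eqxx preimage_setT.
rewrite [X in _ = (X * _ * _)%E]probability_setT mul1e muleC; congr (_ * _)%E.
apply: eq_bigr => i; rewrite -(inj_eq val_inj)/= /B1 /B2 => /negbTE ->.
by [].
Qed.

Lemma past_indep k (A : set T) (C : set R) : (k < N)%N ->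
  measurable (A : set (past k)) -> measurable C ->
  P (A `&` Y k @^-1` C) = (P A * P (Y k @^-1` C))%E.
Proof.
move=> kN mA mC.
have mYC : measurable (Y k @^-1` C) by rewrite -[X in measurable X]setTI; exact: mY.
have PC0 : 0 <= fine (P (Y k @^-1` C)) by rewrite fine_ge0.
pose m1 := mrestr P mYC; pose m2 := mscale (NngNum PC0) P.
have m2E B : m2 B = (P B * P (Y k @^-1` C))%E.
  by rewrite /m2 /mscale/= fineK ?fin_num_measure// muleC.
rewrite -m2E -[LHS]/(m1 A).
apply: (g_sigma_algebra_measure_unique (past_cylinders k) _ (fun=> setT)) => //.
- exact: past_cylinders_measurable.
- by move=> _; exists (fun=> setT); split => //; apply/seteqP; split.
- by apply/seteqP; split => // w _; exists 0%N.
- move=> _ _ [B1 [mB1 ->]] [B2 [mB2 ->]]; exists (fun i => B1 i `&` B2 i); split.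
    by move=> i; exact: measurableI.
  by apply/seteqP; split => w; [move=> [h1 h2] i ik; split; [exact: h1|exact: h2]
    |move=> h; split => i /h[]].
- by move=> B cB; rewrite [RHS]m2E /m1 /mrestr; exact: past_cylinder_indep.
- by move=> _; rewrite /m1 /mrestr -ge0_fin_numE// fin_num_measure//; exact: measurableI.
Qed.

(** The identity map into T with the sigma-algebra of the past turns the
    independence of an event from Y k into a product law, and Fubini's theorem
    factors the integral. *)
Lemma expectation_indep k (f : T -> R) (g : R -> R) (Mf Mg : R) : (k < N)%N ->
  measurable_fun [set: past k] f -> (forall w, `|f w| <= Mf) ->
  measurable_fun setT g -> (forall x, `|g x| <= Mg) ->
  \int[P]_w (f w * g (Y k w)) = (\int[P]_w f w) * (\int[P]_w g (Y k w)).
Proof.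
move=> kN mf fM mg gM.
pose idk : T -> past k := id.
have midk : measurable_fun setT idk by move=> _ B mB; rewrite setTI; exact: past_measurable mB.
pose XY w : past k * R := (idk w, Y k w).
have mXY : measurable_fun setT XY by apply/measurable_fun_pairP; split; [exact: midk|exact: mY].
pose RX : {RV P >-> past k} :=
  MeasurableFun.Pack (MeasurableFun.Class (isMeasurableFun.Build _ _ _ _ idk midk)).
pose RY : {RV P >-> R} :=
  MeasurableFun.Pack (MeasurableFun.Class (isMeasurableFun.Build _ _ _ _ (Y k) (mY k))).
pose RXY : {RV P >-> (past k * R)%type} :=
  MeasurableFun.Pack (MeasurableFun.Class (isMeasurableFun.Build _ _ _ _ XY mXY)).
pose h (z : past k * R) : \bar R := (f z.1 * g z.2)%:E.
have mh : measurable_fun setT h.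
  by apply/measurable_EFinP; apply: measurable_funM; apply: measurableT_comp.
have Mf0 : 0 <= Mf by apply: le_trans (fM point).
have hM z : `|f z.1 * g z.2| <= Mf * Mg by rewrite normrM ler_pM.
have joint A B : measurable A -> measurable B ->
    distribution P RXY (A `*` B) = (distribution P RX A * distribution P RY B)%E.
  by move=> mA mB; rewrite /distribution /pushforward/= -past_indep.
have inth : (distribution P RX \x distribution P RY)%E.-integrable setT h.
  apply: measurable_bounded_integrable => //.
  - have := product_measure1E (distribution P RX) (distribution P RY) measurableT measurableT.
    rewrite setXTT => E.
    suff : ((distribution P RX \x distribution P RY)%E [set: past k * R] < +oo)%E by [].
    by rewrite E -joint// -ge0_fin_numE// fin_num_measure//; exact: measurableX.
  - exact/measurable_EFinP.
  - exists (Mf * Mg); split; first exact: num_real.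
    by move=> x Mx z _ /=; rewrite (le_trans (hM z))// ltW.
have intfg : P.-integrable setT (h \o XY).
  apply: (@bounded_integrable _ _ _ _ _ (Mf * Mg)) => [|w]; last exact: hM (XY w).
  by have := measurableT_comp mh mXY => /measurable_EFinP.
have intg : P.-integrable setT (EFin \o (fun w => g (Y k w))).
  apply: (@bounded_integrable _ _ _ _ _ Mg) => [|w] //.
  by apply: measurableT_comp => //; exact: mY.
have intf : P.-integrable setT (EFin \o f).
  by apply: (@bounded_integrable _ _ _ _ _ Mf) => //; exact: past_measurable_fun mf.
have mgE : measurable_fun setT (EFin \o g) by exact/measurable_EFinP.
have mfE : measurable_fun [set: past k] (EFin \o f) by exact/measurable_EFinP.
have Eg : (\int[distribution P RY]_y (g y)%:E = (\int[P]_w g (Y k w))%:E)%E.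
  by rewrite (integral_pushforward (mY k) mgE intg measurableT) integral_fin_Rintegral.
have Ef : (\int[distribution P RX]_x (f x)%:E = (\int[P]_w f w)%:E)%E.
  by rewrite (integral_pushforward midk mfE intf measurableT) integral_fin_Rintegral.
apply: EFin_inj; rewrite -(integral_fin_Rintegral intfg).
rewrite -(integral_pushforward mXY mh intfg measurableT).
transitivity (\int[(distribution P RX \x distribution P RY)%E]_z h z)%E.
  by apply: eq_measure_integral => A mA _; apply/esym/product_measure_unique.
rewrite -integral12_prod_meas1// /fubini_F.
under eq_integral => x _.
  under eq_integral => y _ do rewrite /h/= EFinM.
  rewrite integralZl//; last first.
    apply/integrableP; split => //.
    have /integrableP[_] := integrable_pushforward (mY k) mgE intg measurableT.
    by [].
  rewrite Eg; over.
rewrite integralZr//; last first.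
  exact: (integrable_pushforward midk mfE intf measurableT).
by rewrite Ef EFinM.
Qed.

End independence.

(** * Exponential moments of a randomly phased sum *)

Section concentration.
Context d (T : measurableType d) (R : realType) (P : probability T R).
Variables (N : nat) (Y : nat -> T -> R).
Hypothesis mY : forall i, measurable_fun setT (Y i).
Hypothesis indep : mutually_independent P (fun i : 'I_N => Y i).
Variable theta : R.
Let psi i := \int[P]_w cos (theta * Y i w).
Hypothesis sinY : forall i, (0 < i < N)%N -> \int[P]_w sin (theta * Y i w) = 0.

Local Notation past k := (g_sigma_algebraType (past_cylinders Y k)).

Definition walk i (w : T) := \sum_(j < i.+1) Y j w.

Lemma walkS i w : walk i.+1 w = walk i w + Y i.+1 w.
Proof. by rewrite /walk big_ord_recr. Qed.

Lemma measurable_walk i k : (i < k)%N -> measurable_fun [set: past k] (walk i).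
Proof.
move=> ik; apply: measurable_sum => j.
apply: past_measurable_fun_coord; exact: leq_trans (ltn_ord j) ik.
Qed.

Lemma measurable_cos_walk a i k : (i < k)%N ->
  measurable_fun [set: past k] (fun w => cos (a + theta * walk i w)).
Proof.
move=> ik; apply: measurableT_comp.
  exact: (@continuous_measurable_fun _ cos (@continuous_cos R)).
apply: measurable_funD => //; apply: measurable_funM => //; exact: measurable_walk.
Qed.

Lemma measurable_sin_walk a i k : (i < k)%N ->
  measurable_fun [set: past k] (fun w => sin (a + theta * walk i w)).
Proof.
move=> ik; apply: measurableT_comp.
  exact: (@continuous_measurable_fun _ sin (@continuous_sin R)).
apply: measurable_funD => //; apply: measurable_funM => //; exact: measurable_walk.
Qed.

(** The new increment enters through cos (u + v) = cos u cos v - sin u sin v; by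
    independence the sine part contributes a factor with mean zero. *)
Lemma expectation_cos_step i (F : T -> R) (K a : R) : (i.+1 < N)%N ->
  measurable_fun [set: past i.+1] F -> (forall w, `|F w| <= K) ->
  \int[P]_w (F w * cos (a + theta * walk i.+1 w)) =
  psi i.+1 * \int[P]_w (F w * cos (a + theta * walk i w)).
Proof.
move=> iN mF FK.
have K0 : 0 <= K by apply: le_trans (FK point).
have mc : measurable_fun [set: past i.+1] (fun w => F w * cos (a + theta * walk i w)).
  by apply: measurable_funM => //; exact: measurable_cos_walk.
have ms : measurable_fun [set: past i.+1] (fun w => F w * sin (a + theta * walk i w)).
  by apply: measurable_funM => //; exact: measurable_sin_walk.
have bc w : `|F w * cos (a + theta * walk i w)| <= K.
  by rewrite normrM -[leRHS]mulr1 ler_pM// cos_max.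
have bs w : `|F w * sin (a + theta * walk i w)| <= K.
  by rewrite normrM -[leRHS]mulr1 ler_pM// sin_max.
have mct : measurable_fun setT (fun y : R => cos (theta * y)).
  apply: measurableT_comp; last exact: measurable_funM.
  exact: (@continuous_measurable_fun _ cos (@continuous_cos R)).
have mst : measurable_fun setT (fun y : R => sin (theta * y)).
  apply: measurableT_comp; last exact: measurable_funM.
  exact: (@continuous_measurable_fun _ sin (@continuous_sin R)).
have Ec := expectation_indep mY indep iN mc bc mct (fun x => cos_max (theta * x)).
have Es := expectation_indep mY indep iN ms bs mst (fun x => sin_max (theta * x)).
have -> : \int[P]_w (F w * cos (a + theta * walk i.+1 w)) =
    \int[P]_w (F w * cos (a + theta * walk i w) * cos (theta * Y i.+1 w) -
      F w * sin (a + theta * walk i w) * sin (theta * Y i.+1 w)).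
  apply: eq_Rintegral => w _; rewrite walkS mulrDr addrA [cos (_ + theta * Y _ _)]cosD.
  by rewrite mulrBr !mulrA.
rewrite RintegralB//; first by rewrite Ec Es (sinY (i := i.+1))// mulr0 subr0 mulrC.
- apply: (@bounded_integrable _ _ _ _ _ K) => [|w].
    apply: measurable_funM; first exact: past_measurable_fun mc.
    by apply: measurableT_comp mct _; exact: mY.
  by rewrite normrM -[leRHS]mulr1 ler_pM// cos_max.
- apply: (@bounded_integrable _ _ _ _ _ K) => [|w].
    apply: measurable_funM; first exact: past_measurable_fun ms.
    by apply: measurableT_comp mst _; exact: mY.
  by rewrite normrM -[leRHS]mulr1 ler_pM// sin_max.
Qed.

(** The expected attenuation of a phase over r steps after step k. *)
Definition damping k r := \prod_(j < r) psi (k + j.+1)%N.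

Lemma expectation_cos_iter k r (F : T -> R) (K a : R) : (k + r < N)%N ->
  measurable_fun [set: past k] F -> (forall w, `|F w| <= K) ->
  \int[P]_w (F w * cos (a + theta * walk (k + r) w)) =
  damping k r * \int[P]_w (F w * cos (a + theta * walk k w)).
Proof.
move=> + mF FK; elim: r => [|r IH] krN.
  by rewrite /damping big_ord0 mul1r addn0.
have krN' : ((k + r).+1 < N)%N by rewrite -addnS.
have mF' : measurable_fun [set: past (k + r).+1] F.
  by apply: past_measurable_fun_le mF; rewrite -addnS leq_addr.
rewrite addnS (expectation_cos_step a krN' mF' FK) IH; last exact: ltnW.
by rewrite /damping big_ord_recr/= mulrA (mulrC (psi _)) addnS.
Qed.

Variables (l : nat) (h eta phi lam kappa : R).
Hypotheses (h0 : 0 <= h) (lam0 : 0 <= lam).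
Hypothesis psi01 : forall i, (0 < i < N)%N -> 0 <= psi i <= 1.
Hypothesis compensator_le : forall b a, (b.+1 * l <= N)%N ->
  `|h * \sum_(r < l) cos (a + eta * r%:R) * damping (b * l) r| <= kappa.

Lemma damping01 k r : (k + r < N)%N -> 0 <= damping k r <= 1.
Proof.
elim: r => [|r IH] krN; first by rewrite /damping big_ord0 ler01 lexx.
have /IH/andP[d0 d1] : (k + r < N)%N by rewrite (leq_trans _ krN)// addnS.
have /andP[p0 p1] : 0 <= psi (k + r.+1)%N <= 1 by rewrite psi01// krN addnS.
by rewrite /damping big_ord_recr/= mulr_ge0//= mulr_ile1.
Qed.

Definition osc_sum n (w : T) :=
  h * \sum_(0 <= i < n * l) cos (phi + eta * i%:R + theta * walk i w).

Definition block_sum b (w : T) :=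
  h * \sum_(r < l) cos (phi + eta * (b * l + r)%:R + theta * walk (b * l + r) w).

(** The conditional expectation of [block_sum b] given the walk up to the first
    index of the block. *)
Definition block_compensator b (w : T) :=
  h * \sum_(r < l) damping (b * l) r *
    cos (phi + eta * (b * l + r)%:R + theta * walk (b * l) w).

Lemma osc_sumS n w : osc_sum n.+1 w = osc_sum n w + block_sum n w.
Proof.
rewrite /osc_sum /block_sum -mulrDr; congr (_ * _).
rewrite (@big_cat_nat _ _ _ (n * l)%N) ?leq_mul//=; congr (_ + _).
rewrite -{1}[(n * l)%N]add0n big_addn mulSn addnK big_mkord.
by apply: eq_bigr => i _; rewrite addnC.
Qed.

Definition block_martingale b w := block_sum b w - block_compensator b w.

Lemma measurable_block_martingale b k : (b.+1 * l <= k)%N ->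
  measurable_fun [set: past k] (block_martingale b).
Proof.
move=> blk; apply: measurable_funB; apply: measurable_funM => //;
  apply: measurable_sum => r.
  apply: measurable_cos_walk; apply: leq_trans blk.
  by rewrite mulSn addnC ltn_add2r ltn_ord.
apply: measurable_funM => //; apply: measurable_cos_walk; apply: leq_trans blk.
by rewrite mulSn -[X in (X < _)%N]add0n ltn_add2r (leq_ltn_trans _ (ltn_ord r)).
Qed.

Lemma normr_block_sum b w : `|block_sum b w| <= h * l%:R.
Proof.
rewrite /block_sum normrM ger0_norm// ler_wpM2l//.
apply: (le_trans (ler_norm_sum _ _ _)).
rewrite -[l in leRHS]card_ord -sum1_card natr_sum; apply: ler_sum => i _.
exact: cos_max.
Qed.

Lemma normr_block_compensator b w : (b.+1 * l <= N)%N ->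
  `|block_compensator b w| <= h * l%:R.
Proof.
move=> bN; rewrite /block_compensator normrM ger0_norm// ler_wpM2l//.
apply: (le_trans (ler_norm_sum _ _ _)).
rewrite -[l in leRHS]card_ord -sum1_card natr_sum; apply: ler_sum => i _.
have /andP[d0 d1] : 0 <= damping (b * l) i <= 1.
  by apply: damping01; apply: leq_trans bN; rewrite mulSn addnC ltn_add2r.
by rewrite normrM ger0_norm// mulr_ile1// cos_max.
Qed.

Lemma normr_block_martingale b w : (b.+1 * l <= N)%N ->
  `|block_martingale b w| <= 2 * (h * l%:R).
Proof.
move=> bN; apply: (le_trans (ler_normB _ _)).
have := normr_block_sum b w; have := normr_block_compensator w bN; lra.
Qed.

Lemma block_compensator_le b w : (b.+1 * l <= N)%N ->
  `|block_compensator b w| <= kappa.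
Proof.
move=> bN; apply: le_trans (compensator_le
  (phi + eta * (b * l)%:R + theta * walk (b * l) w) bN).
rewrite le_eqVlt; apply/orP; left; apply/eqP; congr (`|_ * _|).
apply: eq_bigr => r _; rewrite mulrC; congr (cos _ * _).
by rewrite natrD; ring.
Qed.

Lemma expectation_block_martingale b (F : T -> R) (K : R) : (b.+1 * l <= N)%N ->
  measurable_fun [set: past (b * l)] F -> (forall w, `|F w| <= K) ->
  \int[P]_w (F w * block_martingale b w) = 0.
Proof.
move=> bN mF FK.
have K0 : 0 <= K by apply: le_trans (FK point).
have mFT := past_measurable_fun mY mF.
have mc a i : measurable_fun setT (fun w => F w * cos (a + theta * walk i w)).
  apply: measurable_funM => //.
  exact: (past_measurable_fun mY (measurable_cos_walk a (ltnSn i))).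
have intc a i : P.-integrable setT (EFin \o (fun w => F w * cos (a + theta * walk i w))).
  apply: (@bounded_integrable _ _ _ _ _ K) => [//|w].
  by rewrite normrM -[leRHS]mulr1 ler_pM// cos_max.
have intcZ a c i : P.-integrable setT (EFin \o (fun w => c * (F w * cos (a + theta * walk i w)))).
  apply: (@bounded_integrable _ _ _ _ _ (`|c| * K)) => [|w]; first exact: measurable_funM.
  by rewrite normrM ler_wpM2l// normrM -[leRHS]mulr1 ler_pM// cos_max.
pose G (r : 'I_l) w :=
  F w * cos (phi + eta * (b * l + r)%:R + theta * walk (b * l + r) w) -
  damping (b * l) r * (F w * cos (phi + eta * (b * l + r)%:R + theta * walk (b * l) w)).
have -> : \int[P]_w (F w * block_martingale b w) = \int[P]_w (h * \sum_(r < l) G r w).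
  apply: eq_Rintegral => w _.
  rewrite /block_martingale /block_sum /block_compensator -mulrBr -sumrB mulrCA.
  congr (_ * _); rewrite mulr_sumr; apply: eq_bigr => r _.
  by rewrite /G mulrBr; congr (_ - _); rewrite mulrCA.
have intG r : P.-integrable setT (EFin \o G r).
  by apply: (@integrableB _ _ _ _ _ measurableT (EFin \o _) (EFin \o _)).
rewrite RintegralZl//; last first.
  rewrite (_ : EFin \o _ = fun w => (\sum_(r < l) (EFin \o G r) w)%E); last first.
    by apply/funext => w /=; rewrite sumEFin.
  exact: integrable_sum.
rewrite (_ : \int[P]_w _ = \sum_(r < l) \int[P]_w G r w); last first.
  apply: EFin_inj; rewrite -sumEFin -integral_fin_Rintegral; last first.
    rewrite (_ : EFin \o _ = fun w => (\sum_(r < l) (EFin \o G r) w)%E); last first.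
      by apply/funext => w /=; rewrite sumEFin.
    exact: integrable_sum.
  under eq_bigr do rewrite -integral_fin_Rintegral//.
  by rewrite -integral_sum//; apply: eq_integral => w _; rewrite sumEFin.
rewrite big1 ?mulr0// => r _.
rewrite RintegralB// RintegralZl//.
rewrite (expectation_cos_iter (K := K)) ?subrr//.
by apply: leq_trans bN; rewrite mulSn addnC ltn_add2r.
Qed.

Definition exp_martingale n w := expR (lam * \sum_(b < n) block_martingale b w).

Lemma measurable_exp_martingale n : measurable_fun [set: past (n * l)] (exp_martingale n).
Proof.
apply: measurableT_comp; first exact: measurable_expR.
apply: measurable_funM => //; apply: measurable_sum => b.
by apply: measurable_block_martingale; rewrite leq_mul2r ltn_ord orbT.
Qed.

Lemma exp_martingale_le n w : (n * l <= N)%N ->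
  `|exp_martingale n w| <= expR (lam * (n%:R * (2 * (h * l%:R)))).
Proof.
move=> nN; rewrite ger0_norm ?expR_ge0// ler_expR ler_wpM2l//.
rewrite mulr_natl -[n in leRHS]card_ord -sumr_const; apply: ler_sum => b _.
apply: (le_trans (ler_norm _)); apply: normr_block_martingale.
by apply: leq_trans nN; rewrite leq_mul2r ltn_ord orbT.
Qed.

(** Azuma's argument: [expR_le_id_add] bounds the exponential of one block
    difference D by lam D + e^c, and lam D integrates to zero against the past,
    so each block costs one factor e^c. *)
Lemma expectation_exp_martingale n : (n * l <= N)%N ->
  \int[P]_w exp_martingale n w <= expR (n%:R * (8 * lam ^+ 2 * (h * l%:R) ^+ 2)).
Proof.
elim: n => [|n IH] nN.
  rewrite mul0r expR0 (_ : exp_martingale 0 = fun=> 1) ?expectation_cst//.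
  by apply/funext => w; rewrite /exp_martingale big_ord0 mulr0 expR0.
have nN' : (n * l <= N)%N by apply: leq_trans nN; rewrite leq_mul2r leqnSn orbT.
set c := 8 * lam ^+ 2 * _ in IH *.
pose F := exp_martingale n; pose D := block_martingale n.
pose K := expR (lam * (n%:R * (2 * (h * l%:R)))).
have FK w : `|F w| <= K by exact: exp_martingale_le.
have mF : measurable_fun setT F.
  exact: (past_measurable_fun mY (@measurable_exp_martingale n)).
have mD : measurable_fun setT D.
  exact: (past_measurable_fun mY (measurable_block_martingale (leqnn _))).
have DK w : `|D w| <= 2 * (h * l%:R) by exact: normr_block_martingale.
have intF : P.-integrable setT (EFin \o F) by exact: (@bounded_integrable _ _ _ _ _ K).
have F0 w : 0 <= F w by exact: expR_ge0.
have K0 : 0 <= K by exact: expR_ge0.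
have intFD : P.-integrable setT (EFin \o (fun w => F w * D w)).
  apply: (@bounded_integrable _ _ _ _ _ (K * (2 * (h * l%:R)))) => [|w].
    exact: measurable_funM.
  by rewrite normrM ler_pM.
have intR : P.-integrable setT (EFin \o (fun w => lam * (F w * D w) + expR c * F w)).
  apply: (@integrableD _ _ _ _ _ measurableT (fun w => lam%:E * (F w * D w)%:E)%E
    (fun w => (expR c)%:E * (F w)%:E)%E) => //.
    exact: integrableZl.
  exact: integrableZl.
have E0 : \int[P]_w (F w * D w) = 0.
  exact: (expectation_block_martingale (K := K) nN (@measurable_exp_martingale n)).
apply: (@le_trans _ _ (\int[P]_w (lam * (F w * D w) + expR c * F w))).
  apply: le_Rintegral => //.
    apply: (@bounded_integrable _ _ _ _ _ (expR (lam * (n.+1%:R * (2 * (h * l%:R)))))) => [|w].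
      exact: (past_measurable_fun mY (@measurable_exp_martingale n.+1)).
    exact: exp_martingale_le.
  move=> w _; rewrite /exp_martingale big_ord_recr/= mulrDr expRD -/(F w) -/(D w).
  have -> : lam * (F w * D w) + expR c * F w = F w * (lam * D w + expR c) by ring.
  rewrite ler_wpM2l//; apply: (le_trans (expR_le_id_add _)).
  rewrite lerD2l ler_expR /c exprMn.
  have : D w ^+ 2 <= (2 * (h * l%:R)) ^+ 2.
    rewrite -(real_normK (num_real (D w))) lerXn2r// nnegrE.
    by rewrite !mulr_ge0.
  move=> /(ler_wpM2l (sqr_ge0 lam)) => hh.
  have -> : 8 * lam ^+ 2 * (h * l%:R) ^+ 2 = 2 * (lam ^+ 2 * (2 * (h * l%:R)) ^+ 2) by ring.
  by rewrite ler_wpM2l.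
rewrite RintegralD//; [|exact: (integrableZl measurableT lam intFD)
  |exact: (integrableZl measurableT (expR c) intF)].
rewrite RintegralZl// E0 mulr0 add0r RintegralZl//.
rewrite (_ : n.+1%:R * c = c + n%:R * c); last by rewrite -natr1; ring.
by rewrite expRD ler_wpM2l ?expR_ge0// IH.
Qed.

Lemma expectation_exp_osc_sum n : (n * l <= N)%N ->
  \int[P]_w expR (lam * osc_sum n w) <=
  expR (n%:R * (lam * kappa + 8 * lam ^+ 2 * (h * l%:R) ^+ 2)).
Proof.
move=> nN.
have oscE w : osc_sum n w = \sum_(b < n) block_sum b w.
  elim: {nN} n => [|n IH]; first by rewrite big_ord0 /osc_sum mul0n big_geq// mulr0.
  by rewrite osc_sumS big_ord_recr IH.
have le1 w : expR (lam * osc_sum n w) <= expR (n%:R * (lam * kappa)) * exp_martingale n w.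
  rewrite -expRD ler_expR oscE mulrCA -mulrDr ler_wpM2l// /block_martingale.
  rewrite sumrB -lerBlDr opprB addrC subrK mulr_natl -[n in leRHS]card_ord -sumr_const.
  apply: ler_sum => b _; apply: (le_trans (ler_norm _)); apply: block_compensator_le.
  by apply: leq_trans nN; rewrite leq_mul2r ltn_ord orbT.
have intM : P.-integrable setT (EFin \o exp_martingale n).
  apply: (@bounded_integrable _ _ _ _ _ (expR (lam * (n%:R * (2 * (h * l%:R)))))) => [|w].
    exact: (past_measurable_fun mY (@measurable_exp_martingale n)).
  exact: exp_martingale_le.
have mosc : measurable_fun setT (fun w => expR (lam * osc_sum n w)).
  apply: measurableT_comp; first exact: measurable_expR.
  apply: measurable_funM => //; apply: measurable_funM => //; apply: measurable_sum => i.
  exact: (past_measurable_fun mY (measurable_cos_walk _ (ltnSn i))).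
apply: (@le_trans _ _ (\int[P]_w (expR (n%:R * (lam * kappa)) * exp_martingale n w))).
  apply: le_Rintegral => //; last exact: (integrableZl measurableT _ intM).
  apply: (@bounded_integrable _ _ _ _ _ (expR (n%:R * (lam * kappa)) *
    expR (lam * (n%:R * (2 * (h * l%:R)))))) => [//|w].
  rewrite ger0_norm ?expR_ge0//; apply: (le_trans (le1 w)).
  rewrite ler_wpM2l ?expR_ge0//; apply: le_trans (exp_martingale_le w nN); exact: ler_norm.
rewrite RintegralZl// mulrDr expRD ler_wpM2l ?expR_ge0//.
exact: expectation_exp_martingale.
Qed.

End concentration.

(** * Uniform grids and Riemann sums *)

Section grid.
Context (R : realType).
Local Notation mu := (@lebesgue_measure R).
Variables (a h : R).
Hypothesis h0 : 0 < h.

Definition grid_pt (i : nat) : R := a + i%:R * h.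

Definition grid_floor (t : R) : R := grid_pt (Num.truncn ((t - a) / h)).

Lemma grid_pt_le i j : (i <= j)%N -> grid_pt i <= grid_pt j.
Proof. by move=> ij; rewrite lerD2l ler_wpM2r ?ler_nat// ltW. Qed.

Lemma grid_ptS i : grid_pt i.+1 = grid_pt i + h.
Proof. by rewrite /grid_pt -natr1; ring. Qed.

Lemma grid_floorE i t : grid_pt i <= t < grid_pt i.+1 -> grid_floor t = grid_pt i.
Proof.
move=> /andP[it ti]; rewrite /grid_floor; congr grid_pt; apply: truncn_def.
by rewrite ler_pdivlMr// ltr_pdivrMr//; move: it ti; rewrite /grid_pt; lra.
Qed.

Lemma grid_floorP n t : a <= t < grid_pt n ->
  exists i, [/\ (i < n)%N, grid_pt i <= t < grid_pt i.+1 & grid_floor t = grid_pt i].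
Proof.
move=> /andP[at_ tn]; exists (Num.truncn ((t - a) / h)).
have t0 : 0 <= (t - a) / h by rewrite divr_ge0 ?subr_ge0// ltW.
have /andP[] := truncn_itv t0.
rewrite ler_pdivlMr// ltr_pdivrMr// => h1 h2; split=> //.
  by rewrite truncn_lt_nat// ltr_pdivrMr// ltrBlDl.
by apply/andP; split; rewrite /grid_pt; lra.
Qed.

Lemma grid_floor_near n t : a <= t < grid_pt n ->
  [/\ a <= grid_floor t, grid_floor t <= t & t - grid_floor t < h].
Proof.
move=> /grid_floorP[i [_ /andP[h1 h2] ->]]; split=> //.
  by rewrite /grid_pt lerDl mulr_ge0// ltW.
by move: h2; rewrite grid_ptS; lra.
Qed.

Lemma grid_itvS n : `[a, grid_pt n.+1[%classic =
  `[a, grid_pt n[%classic `|` `[grid_pt n, grid_pt n.+1[%classic.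
Proof.
have an : a <= grid_pt n by rewrite /grid_pt lerDl mulr_ge0// ltW.
apply: itv_bndbnd_setU; by rewrite bnd_simp ?grid_pt_le.
Qed.

Lemma measurable_grid_floor (G : R -> R) n :
  measurable_fun `[a, grid_pt n[%classic (G \o grid_floor).
Proof.
elim: n => [|n IH].
  by rewrite /grid_pt mul0r addr0 set_itvco0; exact: measurable_fun_set0.
rewrite grid_itvS measurable_funU//; split => //.
apply: (eq_measurable_fun (cst (G (grid_pt n)))) => // t.
by rewrite inE/= in_itv/= => tn; rewrite /= (grid_floorE tn).
Qed.

(** A Riemann sum is the integral of the function frozen at the last grid point;
    Fatou's lemma and dominated convergence thus apply to Riemann sums. *)
Lemma grid_integral (G : R -> R) n : (forall i, 0 <= G i) ->
  (\int[mu]_(t in `[a, grid_pt n[) (G (grid_floor t))%:E =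
   (h * \sum_(i < n) G (grid_pt i))%:E)%E.
Proof.
move=> G0; elim: n => [|n IH].
  by rewrite /grid_pt mul0r addr0 set_itvco0 integral_set0 big_ord0 mulr0.
rewrite grid_itvS ge0_integral_setU//.
- rewrite IH big_ord_recr/= mulrDr EFinD; congr (_ + _)%E.
  rewrite (eq_integral (fun=> (G (grid_pt n))%:E)).
    rewrite integral_cst//= lebesgue_measure_itv/= lte_fin.
    rewrite grid_ptS ltrDl h0 -EFinB -EFinM; congr (_%:E); ring.
  by move=> t; rewrite inE/= in_itv/= => tn; rewrite (grid_floorE tn).
- by rewrite -grid_itvS; apply/measurable_EFinP; exact: measurable_grid_floor.
- by move=> t _; rewrite lee_fin.
- apply/disj_setPS => t []/=; rewrite !in_itv/= => /andP[_ h1] /andP[h2 _].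
  by move: h1; rewrite ltNge h2.
Qed.

End grid.

Section riemann.
Context (R : realType).
Local Notation mu := (@lebesgue_measure R).
Variables (a b : R).
Hypothesis ab : a < b.

Definition mesh (n : nat) : R := (b - a) / n.+1%:R.

Lemma mesh_gt0 n : 0 < mesh n.
Proof. by rewrite divr_gt0// subr_gt0. Qed.

Lemma grid_pt_mesh n : grid_pt a (mesh n) n.+1 = b.
Proof. by rewrite /grid_pt /mesh mulrC divfK// subrKC. Qed.

Lemma mesh_small e : 0 < e -> \forall n \near \oo, mesh n < e.
Proof.
move=> e0; near=> n; rewrite /mesh ltr_pdivrMr// -ltr_pdivrMl//.
rewrite mulrC; apply: (@le_lt_trans _ _ n%:R); last by rewrite ltr_nat.
by near: n; exact: nbhs_infty_ger.
Unshelve. all: by end_near. Qed.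

Lemma grid_floor_cvg t : a <= t < b -> grid_floor a (mesh n) t @[n --> \oo] --> t.
Proof.
move=> atb; apply/cvgrPdist_lt => e e0.
near=> n.
have := @grid_floor_near _ a _ (mesh_gt0 n) n.+1 t; rewrite grid_pt_mesh => /(_ atb)[_ h1 h2].
rewrite ger0_norm ?subr_ge0//; apply: (lt_trans h2).
by near: n; exact: mesh_small.
Unshelve. all: by end_near. Qed.

Lemma riemann_sum_cvg (f : R -> R) : continuous f -> (forall x, 0 <= f x) ->
  (exists M, forall x, f x <= M) ->
  (mesh n * \sum_(i < n.+1) f (grid_pt a (mesh n) i))%:E @[n --> \oo] -->
  (\int[mu]_(t in `[a, b]) (f t)%:E)%E.
Proof.
move=> cf f0 [M fM].
rewrite -integral_itv_bndo_bndc; last first.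
  by apply: measurable_funTS; apply/measurable_EFinP; exact: continuous_measurable_fun.
have -> : (fun n => (mesh n * \sum_(i < n.+1) f (grid_pt a (mesh n) i))%:E) =
    (fun n => \int[mu]_(t in `[a, b[) (f (grid_floor a (mesh n) t))%:E)%E.
  by apply/funext => n; rewrite -(grid_integral _ (mesh_gt0 _))// grid_pt_mesh.
apply: (@dominated_cvg _ _ _ mu _ _ (fun n t => (f (grid_floor a (mesh n) t))%:E) _ (cst M%:E)) => //.
- move=> n; apply/measurable_EFinP;
  by have := @measurable_grid_floor _ a _ (mesh_gt0 n) f n.+1; rewrite grid_pt_mesh.
- move=> t; rewrite /= in_itv/= => atb; apply/cvg_EFin; first exact: nearW.
  exact: (cvg_comp _ _ (grid_floor_cvg atb) (cf t)).
- apply: measurable_bounded_integrable => //.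
    by rewrite /= lebesgue_measure_itv/=; case: ifP => _; rewrite ?ltry -?EFinB ?ltry.
  by exists M; split; [exact: num_real|move=> x Mx t _ /=];
    rewrite ger0_norm; [exact: ltW|exact: le_trans (f0 0) (fM 0)].
- by move=> n t _; rewrite /= lee_fin ger0_norm.
Qed.

End riemann.

(** * Oscillatory Riemann sums along a regular process *)

Section abel.
Context (R : realType).
Implicit Types (a eta x B : R).

(** Summation by parts. *)
Lemma abel_bound (c w : nat -> R) (B : R) (l : nat) : 0 <= B ->
  (forall n, `|\sum_(r < n) c r| <= B) ->
  (forall r, (r < l)%N -> 0 <= w r <= 1) ->
  (forall r, (r.+1 < l)%N -> w r.+1 <= w r) ->
  `|\sum_(r < l) c r * w r| <= B.
Proof.
move=> B0 SB w01 wd; case: l => [|l] in w01 wd *; first by rewrite big_ord0 normr0.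
have key n : (n <= l)%N ->
    `|\sum_(r < n) c r * w r - (\sum_(r < n) c r) * w n| <= B * (w 0%N - w n).
  elim: n => [|n IH] nl; first by rewrite !big_ord0 mul0r subrr normr0 subrr mulr0.
  rewrite big_ord_recr/=.
  have -> : \sum_(i < n) c i * w i + c n * w n - (\sum_(r < n.+1) c r) * w n.+1 =
    (\sum_(i < n) c i * w i - (\sum_(r < n) c r) * w n) +
    (\sum_(r < n.+1) c r) * (w n - w n.+1) by rewrite big_ord_recr/=; ring.
  apply: (le_trans (ler_normD _ _)).
  have -> : B * (w 0%N - w n.+1) = B * (w 0%N - w n) + B * (w n - w n.+1) by ring.
  apply: lerD; first exact: IH (ltnW nl).
  have wn : 0 <= w n - w n.+1 by rewrite subr_ge0 wd.
  by rewrite normrM (ger0_norm wn) ler_wpM2r.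
rewrite big_ord_recr/=.
have -> : \sum_(i < l) c i * w i + c l * w l =
  (\sum_(i < l) c i * w i - (\sum_(i < l) c i) * w l) + (\sum_(i < l.+1) c i) * w l.
  by rewrite big_ord_recr/=; ring.
apply: (le_trans (ler_normD _ _)).
have /andP[wl0 wl1] := w01 l (ltnSn l).
have /andP[_ w01'] := w01 0%N (ltn0Sn l).
apply: (@le_trans _ _ (B * (w 0%N - w l) + B * w l)).
  by apply: lerD; [exact: key|rewrite normrM (ger0_norm wl0) ler_wpM2r].
by rewrite -mulrDr subrK ler_piMr.
Qed.

(** The closed form telescopes, by the addition formulas for the sine. *)
Lemma dirichlet_cos a eta n :
  2 * sin (eta / 2) * (\sum_(r < n) cos (a + eta * r%:R)) =
  sin (a + eta * n%:R - eta / 2) - sin (a - eta / 2).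
Proof.
elim: n => [|n IH]; first by rewrite big_ord0 !mulr0 addr0 subrr.
rewrite big_ord_recr/= mulrDr IH.
have -> : a + eta * n.+1%:R - eta / 2 = (a + eta * n%:R) + eta / 2.
  by rewrite -natr1; field.
by have := sinD (a + eta * n%:R) (eta / 2); have := sinB (a + eta * n%:R) (eta / 2);
  move=> -> ->; ring.
Qed.

Lemma dirichlet_cos_bound a eta n : eta != 0 -> `|eta| <= 1 ->
  `|\sum_(r < n) cos (a + eta * r%:R)| <= 4 / `|eta|.
Proof.
move=> eta0 eta1; have e0 : 0 < `|eta| by rewrite normr_gt0.
rewrite ler_pdivlMr//; set S := \sum_(r < n) _.
have e2 : `|eta / 2| = `|eta| / 2 by rewrite normrM (@ger0_norm _ 2^-1).
have h := @sin_norm_ge_half _ (eta / 2); rewrite e2 in h.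
have {}h : `|eta| / 2 / 2 <= `|sin (eta / 2)| by apply: h; lra.
have : `|2 * sin (eta / 2) * S| <= 2.
  rewrite dirichlet_cos (le_trans (ler_normB _ _))//.
  by have := sin_max (a + eta * n%:R - eta / 2); have := sin_max (a - eta / 2); lra.
rewrite normrM normrM (@ger0_norm _ 2)//.
have S0 := normr_ge0 S; move: h; set s := `|sin _| => h h2.
have := ler_wpM2r S0 h; lra.
Qed.

Lemma geometric_sum_le x l : 0 < x <= 1 -> \sum_(r < l) (1 - x) ^+ r <= x^-1.
Proof.
move=> /andP[x0 x1]; rewrite -[leRHS]mul1r ler_pdivlMr// mulrC.
have := subrX1 (1 - x) l; set S := \sum_(r < l) _.
have -> : 1 - x - 1 = - x by ring.
move=> h; have : 0 <= (1 - x) ^+ l by rewrite exprn_ge0// subr_ge0.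
by move: h; set q := _ ^+ l; lra.
Qed.

End abel.

Section regular.
Context d (T : measurableType d) (R : realType) (P : probability T R).

(** The independence is required from time 0 on, so that X at the first grid
    point a is itself the first step X a - X 0 of the walk. *)
Record regular_on (X : R -> T -> R) (a b c C : R) : Prop := RegularOn {
  reg_a0 : 0 < a ;
  reg_ab : a < b ;
  reg_len : b - a <= 1 ;
  reg_c0 : 0 < c ;
  reg_C0 : 0 < C ;
  reg_meas : forall t, measurable_fun setT (X t) ;
  reg_indep : forall (n : nat) (t : nat -> R),
    (forall i, (i <= n)%N -> 0 <= t i <= b) ->
    (forall i, (i < n)%N -> t i < t i.+1) ->
    mutually_independent P (fun (i : 'I_n) w => X (t i.+1) w - X (t i) w) ;
  reg_law : forall s t, a <= s -> s < t -> t <= b -> exists sg : R,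
    [/\ 0 < sg, c * (t - s) <= sg ^+ 2 <= C * (t - s) &
        gaussian_law P sg (fun w => X t w - X s w)]
}.

Section decay.
Variables (X : R -> T -> R) (a b c C : R).
Hypothesis reg : regular_on X a b c C.

(** The frequency pairs with (t - a, X t - X 0) and not with (t, X t), so that at
    a grid point the phase is that of the walk of the increments; the
    difference is a rotation that does not depend on t. *)
Definition osc_integrand (phi xi1 xi2 : R) (w : T) (t : R) :=
  cos (phi + 2 * pi * xi1 * (t - a) + 2 * pi * xi2 * (X t w - X 0 w)).

Definition osc_riemann phi xi1 xi2 (n : nat) w :=
  mesh a b n * \sum_(i < n.+1) osc_integrand phi xi1 xi2 w (grid_pt a (mesh a b n) i).

Lemma increment_cos th s t : a <= s -> s < t -> t <= b ->
  th ^+ 2 * (C * (t - s)) <= 1 / 256 ->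
  0 <= \int[P]_w cos (th * (X t w - X s w)) <= 1 - th ^+ 2 * (c * (t - s)) / 256.
Proof.
move=> as_ st tb hth; have [sg [sg0 /andP[sgc sgC] law]] := reg_law reg as_ st tb.
have mD : measurable_fun setT (fun w => X t w - X s w).
  by apply: measurable_funB; exact: (reg_meas reg).
have h : `|th| * sg <= 1 / 16.
  rewrite -(@ler_pXn2r _ 2)// ?nnegrE; last 2 first.
  - by rewrite mulr_ge0// ltW.
  - by rewrite divr_ge0.
  rewrite exprMn real_normK ?num_real//.
  have := ler_wpM2l (sqr_ge0 th) sgC; lra.
have /andP[-> /= h1] := gaussian_cos sg0 mD law h.
apply: (le_trans h1); have := ler_wpM2l (sqr_ge0 th) sgc; lra.
Qed.

(** Only the existence of a rate that depends neither on the frequency nor on the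
    times matters, not its value. *)
Lemma increment_cos_rate : exists2 q : R, 0 < q & forall th s t,
  a <= s -> s < t -> t <= b -> th ^+ 2 * (C * (t - s)) <= q ->
  0 <= \int[P]_w cos (th * (X t w - X s w)) <= 1 - q * (th ^+ 2 * (c * (t - s))).
Proof.
exists (1 / 256); first by rewrite div1r invr_gt0 ltr0n.
move=> th s t as_ st tb /(increment_cos as_ st tb)/andP[-> /= h].
by apply: (le_trans h); rewrite div1r mulrC.
Qed.

Lemma increment_sin th s t : a <= s -> s < t -> t <= b ->
  \int[P]_w sin (th * (X t w - X s w)) = 0.
Proof.
move=> as_ st tb; have [sg [sg0 _ law]] := reg_law reg as_ st tb.
apply: (gaussian_sin sg0 _ law).
by apply: measurable_funB; exact: (reg_meas reg).
Qed.

(** There are 4^k blocks of j.+1 grid points, and lam = 2^k.  The compensator of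
    a block is at most Q0 / 8^k, so the 4^k blocks contribute
    2^k * 4^k * Q0 / 8^k = Q0 to the exponent; the quadratic terms contribute
    4^k * 8 * 4^k * (length / 4^k)^2, at most 8.  The bound is uniform in k, in
    the frequency and in the fineness j of the grid. *)
Lemma expectation_exp_osc_riemann : exists Q : R, forall k phi xi1 xi2,
  (0 < k)%N -> (8 ^+ k / 16 <= `|xi1|) \/ (8 ^+ k / 16 <= `|xi2|) ->
  exists j0, forall j, (j0 <= j)%N ->
  \int[P]_w expR (2 ^+ k * osc_riemann phi xi1 xi2 (4 ^ k * j.+1).-1 w) <= Q.
Proof.
have ab := reg_ab reg; have c0 := reg_c0 reg; have C0 := reg_C0 reg.
have len := reg_len reg; have a0 := reg_a0 reg.
have [q q0 qP] := increment_cos_rate.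
pose Q0 : R := 16 + 2 / (q * c); exists (expR (Q0 + 8)) => k phi xi1 xi2 k0 xik.
pose th : R := 2 * pi * xi2.
have cC : c <= C.
  have [sg [_ /andP[h1 h2] _]] := reg_law reg (lexx a) ab (lexx b).
  by have := le_trans h1 h2; rewrite ler_pM2r// subr_gt0.
have [j0 hj0] : exists j0, forall n, (j0 <= n)%N ->
    mesh a b n * (th ^+ 2 * C) <= q /\ mesh a b n * `|2 * pi * xi1| <= 1.
  (* A mesh below e satisfies both smallness conditions at once. *)
  pose e : R := (1 + th ^+ 2 * C / q + `|2 * pi * xi1|)^-1.
  have tC : 0 <= th ^+ 2 * C by rewrite mulr_ge0 ?sqr_ge0// ltW.
  have nx := normr_ge0 (2 * pi * xi1).
  have tCq : 0 <= th ^+ 2 * C / q by rewrite divr_ge0// ltW.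
  have e0 : 0 < e by rewrite invr_gt0; lra.
  have [j0 _ hj] := @mesh_small _ a b e e0; exists j0 => n /hj /= hn.
  have hm := mesh_gt0 ab n.
  have d0 : 0 < 1 + th ^+ 2 * C / q + `|2 * pi * xi1| by lra.
  have : mesh a b n * (1 + th ^+ 2 * C / q + `|2 * pi * xi1|) <= 1.
    by rewrite -ler_pdivlMr// div1r ltW.
  move: tCq nx hm; set u := _ / q; set v := `|_|; set m := mesh a b n => u0 v0 hm.
  have mu0 : 0 <= m * u by rewrite mulr_ge0// ltW.
  have mv0 : 0 <= m * v by rewrite mulr_ge0// ltW.
  have -> : m * (1 + u + v) = m + m * u + m * v by ring.
  move=> hh; split; last by lra.
  have : m * u <= 1 by lra.
  rewrite (_ : m * u = m * (th ^+ 2 * C) / q); last by rewrite /u; ring.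
  by rewrite ler_pdivrMr// mul1r.
exists j0 => j j0j; set N := (4 ^ k * j.+1)%N.
have N0 : (0 < N)%N by rewrite muln_gt0 expn_gt0.
have NE : N.-1.+1 = N by rewrite prednK.
have jN : (j0 <= N.-1)%N.
  rewrite -ltnS NE; apply: (@leq_trans j.+1) => //; rewrite /N leq_pmull// expn_gt0//.
have [meshC mesh1] := hj0 _ jN; move: meshC mesh1.
have [h hE] : exists h, h = mesh a b N.-1 by eexists.
rewrite -hE => meshC mesh1.
have h0 : 0 < h by rewrite hE; exact: mesh_gt0.
have hN : h * N%:R = b - a by rewrite hE /mesh NE divfK// pnatr_eq0 -lt0n.
have tb i : (i < N)%N -> a <= grid_pt a h i <= b.
  move=> iN; rewrite /grid_pt lerDl mulr_ge0//= ?(ltW h0)//.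
  have : i%:R * h <= N%:R * h by rewrite ler_pM2r// ler_nat ltnW.
  by lra.
(* Step 0 runs from time 0 to a and is not small; the remaining steps have
   length h. *)
pose s (i : nat) : R := if i is i'.+1 then grid_pt a h i' else 0.
pose Y (i : nat) (w : T) : R := X (s i.+1) w - X (s i) w.
have mY i : measurable_fun setT (Y i) by apply: measurable_funB; exact: (reg_meas reg).
have indep : mutually_independent P (fun i : 'I_N => Y i).
  apply: (reg_indep reg (t := s)) => [[|i]|[|i]] iN /=.
  - by rewrite lexx/= ltW// (lt_trans a0).
  - by have /andP[h1 ->] := tb i iN; rewrite andbT (le_trans _ h1)// ltW.
  - by rewrite /grid_pt mul0r addr0.
  - by rewrite grid_ptS ltrDl.
have sgrid i : (0 < i < N)%N -> [/\ a <= s i, s i < s i.+1, s i.+1 <= b & s i.+1 - s i = h].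
  case: i => // i /= iN; have /andP[h1 _] := tb i (ltnW iN).
  have /andP[_ h2] := tb i.+1 iN.
  by rewrite grid_ptS ltrDl; split => //; [rewrite -grid_ptS|ring].
have sinY i : (0 < i < N)%N -> \int[P]_w sin (th * Y i w) = 0.
  by move=> /sgrid[s1 s2 s3 _]; exact: increment_sin.
pose x : R := q * (th ^+ 2 * (c * h)).
have ch0 : 0 <= c * h by rewrite mulr_ge0// ltW.
have x0 : 0 <= x.
  by apply: mulr_ge0; [exact: ltW|apply: mulr_ge0 => //; exact: sqr_ge0].
have psiY i : (0 < i < N)%N -> 0 <= \int[P]_w cos (th * Y i w) <= 1 - x.
  move=> /sgrid[s1 s2 s3 s4].
  have := qP th _ _ s1 s2 s3; rewrite s4; apply.
  by rewrite mulrA mulrC.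
have psi01 i : (0 < i < N)%N -> 0 <= \int[P]_w cos (th * Y i w) <= 1.
  by move=> /psiY/andP[-> h1] /=; apply: (le_trans h1); lra.
pose eta := 2 * pi * xi1 * h.
have k8 : 0 < (8 : R) ^+ k by rewrite exprn_gt0.
pose kappa : R := Q0 / 8 ^+ k.
have qc0 : 0 < q * c by rewrite mulr_gt0.
have qci : 0 <= 2 / (q * c) by rewrite divr_ge0// ltW.
have Q00 : 0 <= Q0 by rewrite /Q0 addr_ge0.
have comp_le bb aa : (bb.+1 * j.+1 <= N)%N ->
    `|h * \sum_(r < j.+1) cos (aa + eta * r%:R) * damping P Y th (bb * j.+1) r| <= kappa.
  move=> bN.
  have dam r : (r < j.+1)%N -> 0 <= damping P Y th (bb * j.+1) r <= 1.
    move=> rj; apply: (damping01 psi01); apply: leq_trans bN.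
    by rewrite mulSn addnC ltn_add2r.
  have idx r : (r < j.+1)%N -> (bb * j.+1 + r < N)%N.
    by move=> rj; apply: leq_trans bN; rewrite mulSn addnC ltn_add2r.
  rewrite normrM (gtr0_norm h0).
  have pi0 : 2 <= pi :> R by exact: pi_ge2.
  (* High first coordinate: Abel summation against the Dirichlet kernel.  High
     second coordinate: the damping is at most (1 - x)^r. *)
  case: xik => [xi1k|xi2k].
    have xi10 : 0 < `|xi1| by apply: lt_le_trans xi1k; rewrite divr_gt0.
    have xi1n : xi1 != 0 by rewrite -normr_gt0.
    have nxi1n : `|xi1| != 0 by rewrite lt0r_neq0.
    have pin : pi != 0 :> R by rewrite lt0r_neq0// pi_gt0.
    have hn : h != 0 by rewrite lt0r_neq0.
    have eta0 : eta != 0.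
      by apply: (mulf_neq0 _ hn); apply: (mulf_neq0 _ xi1n); apply: (mulf_neq0 _ pin); rewrite pnatr_eq0.
    have etaE : `|eta| = 2 * pi * `|xi1| * h.
      by rewrite /eta normrM (gtr0_norm h0) normrM ger0_norm// mulr_ge0// pi_ge0.
    have eta1 : `|eta| <= 1.
      by move: mesh1; rewrite mulrC normrM ger0_norm ?mulr_ge0 ?pi_ge0// etaE.
    apply: (@le_trans _ _ (h * (4 / `|eta|))).
      rewrite ler_wpM2l ?(ltW h0)//.
      apply: (@abel_bound _ (fun r => cos (aa + eta * r%:R)) (damping P Y th (bb * j.+1))).
      - by rewrite divr_ge0.
      - by move=> n; exact: dirichlet_cos_bound.
      - exact: dam.
      - move=> r rj; rewrite /damping big_ord_recr/= ler_piMr//.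
          by have /andP[] := dam r (ltnW rj).
        have /psi01/andP[] // : (0 < bb * j.+1 + r.+1 < N)%N.
        by rewrite idx// addnS.
    rewrite etaE.
    have -> : h * (4 / (2 * pi * `|xi1| * h)) = 2 / (pi * `|xi1|).
      have canc (y p z : R) : y != 0 -> p != 0 -> z != 0 ->
          z * (4 / (2 * p * y * z)) = 2 / (p * y).
        by move=> y0 p0 z0; field; rewrite y0 p0 z0.
      exact: canc.
    rewrite /kappa; apply: (@le_trans _ _ (1 / `|xi1|)).
      by rewrite invfM mulrA ler_wpM2r ?invr_ge0// ler_pdivrMr ?pi_gt0//; lra.
    rewrite ler_pdivrMr// mulrAC ler_pdivlMr// mul1r.
    have : 16 * (8 ^+ k / 16) <= Q0 * `|xi1|.
      have Q16 : 16 <= Q0 by rewrite /Q0 lerDl.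
      have k16 : 0 <= (8 : R) ^+ k / 16 by rewrite divr_ge0// ltW.
      exact: ler_pM.
    by rewrite mulrC divfK.
  have xi20 : 0 < `|xi2| by apply: lt_le_trans xi2k; rewrite divr_gt0.
  have th2 : th ^+ 2 = 4 * pi ^+ 2 * xi2 ^+ 2 by rewrite /th; ring.
  have pi20 : 4 <= pi ^+ 2 :> R by nra.
  have xi22 : 0 < xi2 ^+ 2 by rewrite -(real_normK (num_real xi2)) exprn_gt0.
  have th0 : 0 < th ^+ 2 by rewrite th2; apply: mulr_gt0 => //; apply: mulr_gt0 => //;
    rewrite exprn_gt0// pi_gt0.
  have xgt0 : 0 < x.
    by apply: (mulr_gt0 q0); apply: (mulr_gt0 th0); exact: mulr_gt0.
  have x1 : x <= 1.
    have [i0 /psiY/andP[p0 p1]] : exists i, (0 < i < N)%N.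
      exists 1%N => /=; apply: (@leq_trans (4 ^ k)).
        by rewrite (@leq_trans (4 ^ 1))// leq_pexp2l.
      by rewrite /N leq_pmulr.
    by have := le_trans p0 p1; lra.
  apply: (@le_trans _ _ (h * x^-1)).
    rewrite ler_wpM2l ?(ltW h0)//; apply: (le_trans (ler_norm_sum _ _ _)).
    apply: le_trans (geometric_sum_le j.+1 _); last by rewrite xgt0.
    apply: ler_sum => r _; have /andP[d0 d1] := dam r (ltn_ord r).
    rewrite normrM (ger0_norm d0); apply: (@le_trans _ _ (damping P Y th (bb * j.+1) r)).
      by rewrite ler_piMl// cos_max.
    have -> : (1 - x) ^+ r = \prod_(i < r) (1 - x) by rewrite prodr_const card_ord.
    rewrite /damping; apply: ler_prod => i _.
    apply: psiY; rewrite addnS/=; apply: leq_ltn_trans (idx r (ltn_ord r)).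
    by rewrite -addnS leq_add2l.
  have canc (q' c' t z : R) : q' != 0 -> c' != 0 -> t != 0 -> z != 0 ->
      z * (q' * (t * (c' * z)))^-1 = 1 / (q' * c') / t.
    by move=> q'0 c'0 t0 z0; field; rewrite q'0 c'0 t0 z0.
  have -> : h * x^-1 = 1 / (q * c) / th ^+ 2 by apply: canc; rewrite lt0r_neq0.
  have k81 : (8 : R) <= 8 ^+ k.
    by rewrite -[leLHS]expr1 ler_weXn2l// ler1n.
  have xi2ge : (8 ^+ k / 16) ^+ 2 <= xi2 ^+ 2.
    by rewrite -(real_normK (num_real xi2)) lerXn2r// nnegrE// divr_ge0// ltW.
  have th2ge : 8 ^+ k / 2 <= th ^+ 2.
    rewrite th2; move: xi2ge pi20 xi22 k81; set y := 8 ^+ k; set z := xi2 ^+ 2; set p := pi ^+ 2.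
    move=> h1 h2 h3 h4; have h5 : 4 * z <= p * z by rewrite ler_wpM2r// ltW.
    by nra.
  rewrite ler_pdivrMr// /kappa.
  apply: (@le_trans _ _ (Q0 / 8 ^+ k * (8 ^+ k / 2))); last first.
    by rewrite ler_wpM2l// divr_ge0// ltW.
  have -> : Q0 / 8 ^+ k * (8 ^+ k / 2) = Q0 / 2 by field; rewrite gt_eqF.
  rewrite /Q0 (_ : 2 / (q * c) = 2 * (1 / (q * c))); last by rewrite mulrA mulr1.
  by lra.
have lam0 : 0 <= (2 : R) ^+ k by rewrite exprn_ge0.
have := expectation_exp_osc_sum mY indep sinY phi (ltW h0) lam0 psi01 comp_le (leqnn N : (4 ^ k * j.+1 <= N)%N).
have walkE i w : walk Y i w = X (grid_pt a h i) w - X 0 w.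
  elim: i => [|i IH]; first by rewrite /walk big_ord1.
  by rewrite walkS IH /Y /=; ring.
have -> : \int[P]_w expR (2 ^+ k * osc_sum Y th j.+1 h eta phi (4 ^ k) w) =
   \int[P]_w expR (2 ^+ k * osc_riemann phi xi1 xi2 N.-1 w).
  apply: eq_Rintegral => w _; congr (expR (_ * _)).
  rewrite /osc_sum /osc_riemann -/N NE -hE big_mkord; congr (_ * _).
  apply: eq_bigr => i _; rewrite walkE /osc_integrand; congr cos.
  by rewrite /eta /th /grid_pt; ring.
move=> hh; apply: (le_trans hh); rewrite ler_expR.
have hl : h * j.+1%:R = (b - a) / 4 ^+ k.
  by rewrite -hN /N natrM natrX; field; rewrite !expf_neq0.
have e8 : (8 : R) ^+ k = 4 ^+ k * 2 ^+ k by rewrite -exprMn; congr (_ ^+ _); ring.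
have e4 : (4 : R) ^+ k = 2 ^+ k * 2 ^+ k by rewrite -exprMn; congr (_ ^+ _); ring.
have p0 : (2 : R) ^+ k != 0 by rewrite expf_neq0.
have -> : (4 ^ k)%:R * (2 ^+ k * kappa + 8 * (2 ^+ k) ^+ 2 * (h * j.+1%:R) ^+ 2) =
    Q0 + 8 * (b - a) ^+ 2.
  by rewrite hl /kappa natrX e8 e4; field; rewrite p0.
rewrite lerD2l ler_piMr// -[leRHS](expr1n _ 2) lerXn2r// ?nnegrE// subr_ge0 ltW//.
Qed.

End decay.
End regular.

(** * Almost sure bounds and clamped paths *)

Section expectation_tools.
Context d (T : measurableType d) (R : realType) (P : probability T R).
Local Open Scope ereal_scope.

Lemma measurable_limn_einf (f : (T -> \bar R)^nat) :
  (forall n, measurable_fun setT (f n)) ->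
  measurable_fun setT (fun w => limn_einf (f ^~ w)).
Proof.
move=> mf; rewrite /limn_einf; apply: measurableT_comp => //.
have := @measurable_fun_limn_esup _ _ _ setT (fun n w => - f n w).
by apply => n; apply: measurableT_comp => //.
Qed.

Lemma limn_einf_ge0 (u : (\bar R)^nat) : (forall n, 0 <= u n) -> 0 <= limn_einf u.
Proof.
move=> u0; rewrite limn_einf_lim; apply: lime_ge; first exact: is_cvg_einfs.
by apply: nearW => n; apply: le_ereal_inf_tmp => _ [m _ <-].
Qed.

Lemma limn_einf_le_bound (u : (\bar R)^nat) (Q : \bar R) :
  (forall n, u n <= Q) -> limn_einf u <= Q.
Proof.
move=> uQ; rewrite limn_einf_lim; apply: lime_le; first exact: is_cvg_einfs.
by apply: nearW => n; apply: le_trans (uQ n); apply: ereal_inf_lbound; exists n => /=.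
Qed.

Lemma expectation_limn_einf_le (f : (T -> \bar R)^nat) (Q : \bar R) :
  (forall n, measurable_fun setT (f n)) -> (forall n w, 0 <= f n w) ->
  (forall n, \int[P]_w f n w <= Q) ->
  \int[P]_w limn_einf (f ^~ w) <= Q.
Proof.
move=> mf f0 fQ; apply: le_trans (limn_einf_le_bound fQ).
by apply: fatou => // n w _; exact: f0.
Qed.

(** The weights 2^-(k+1) make the sum of the g k integrable, hence finite almost
    everywhere.  The weights are paid for by the factor 2^(k+1). *)
Lemma ae_bounded_of_expectation (g : (T -> \bar R)^nat) (Q : R) :
  (forall k, measurable_fun setT (g k)) -> (forall k w, 0 <= g k w) ->
  (forall k, \int[P]_w g k w <= Q%:E) ->
  {ae P, forall w, exists2 K : R, (0 <= K)%R &
     forall k, g k w <= (K * 2 ^+ k.+1)%:E}.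
Proof.
move=> mg g0 gQ; pose c k : R := ((2 ^+ k.+1)^-1)%R.
have c0 k : (0 <= c k)%R by rewrite invr_ge0 exprn_ge0.
have cg0 k w : 0 <= (c k)%:E * g k w by rewrite mule_ge0// lee_fin.
have mcg k : measurable_fun setT (fun w => (c k)%:E * g k w).
  exact: emeasurable_funM.
have intE : \int[P]_w (\sum_(0 <= k <oo) ((c k)%:E * g k w)) <= Q%:E.
  rewrite integral_nneseries//.
  apply: (@le_trans _ _ (\sum_(0 <= k <oo) (Q / (2 ^ (k + 1))%:R)%:E)).
    apply: lee_nneseries => [k _ _|k _]; first by apply: integral_ge0 => w _.
    rewrite ge0_integralZl_EFin// mulrC EFinM natrX addn1.
    by apply: lee_wpmul2l => //; rewrite lee_fin.
  have := cvg_lim _ (@cvg_geometric_eseries_half R Q 0).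
  by rewrite /eseries/= expr0 divr1 => ->.
have intZ : P.-integrable setT (fun w => \sum_(0 <= k <oo) ((c k)%:E * g k w)).
  apply/integrableP; split.
    by apply: ge0_emeasurable_sum => // k w _ _; exact: cg0.
  under eq_integral => w _ do rewrite gee0_abs ?nneseries_ge0//.
  by apply: (le_lt_trans intE); rewrite ltry.
have := integrable_ae measurableT intZ; apply: filterS => w /(_ I) Zfin.
exists (fine (\sum_(0 <= k <oo) ((c k)%:E * g k w))).
  by rewrite fine_ge0// nneseries_ge0.
move=> k; have : (c k)%:E * g k w <= \sum_(0 <= k <oo) ((c k)%:E * g k w).
  rewrite (@nneseriesD1 _ _ k)//; rewrite leeDl// nneseries_ge0//.
rewrite -{1}(fineK Zfin) => h.
rewrite EFinM muleC -lee_pdivrMl ?exprn_gt0//.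
Qed.

End expectation_tools.

Section clamp.
Context (R : realType).
Variables (a b : R).
Hypothesis ab : a <= b.

(** Composition with [clamp a b] replaces a path that is only continuous on
    [a, b] by one that is continuous on the whole line. *)
Definition clamp (t : R) : R := Num.max a (Num.min b t).

Lemma clamp_itv t : a <= clamp t <= b.
Proof. by rewrite /clamp le_max lexx/= ge_max ab/= ge_min lexx. Qed.

Lemma clamp_id t : a <= t <= b -> clamp t = t.
Proof. by move=> /andP[h1 h2]; rewrite /clamp min_r// max_r. Qed.

Lemma clamp_continuous : continuous clamp.
Proof.
move=> x; apply: (@continuous_max R R (cst a) (fun t => Num.min b t)); first exact: cvg_cst.
by apply: (@continuous_min R R (cst b) id); [exact: cvg_cst|exact: cvg_id].
Qed.

Lemma continuous_clamp_comp (D : set R) (f : R -> R) :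
  `[a, b]%classic `<=` D ->
  {within D, continuous f} -> continuous (f \o clamp).
Proof.
move=> abD /subspace_continuousP cf x.
have Dx y : D (clamp y) by apply: abD; rewrite /= in_itv/= clamp_itv.
apply: (cvg_comp clamp f _ (cf _ (Dx x))).
move=> A hA.
have h2 : nbhs x (clamp @^-1` [set y | D y -> A y]) := @clamp_continuous x _ hA.
suff : nbhs x (clamp @^-1` A) by [].
by apply: filterS h2 => y /(_ (Dx y)).
Qed.

Lemma clamp_bounded (f : R -> R) : continuous (f \o clamp) ->
  exists M, forall t, `|f (clamp t)| <= M.
Proof.
move=> cf.
have [u _ hu] := EVT_max ab (continuous_subspaceT cf).
have [v _ hv] := EVT_min ab (continuous_subspaceT cf).
exists (`|f (clamp u)| + `|f (clamp v)|) => t.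
have ct : clamp t \in `[a, b] by rewrite in_itv/= clamp_itv.
have := hu _ ct; have := hv _ ct; rewrite /= (clamp_id (clamp_itv t)) => h1 h2.
have := ler_norm (f (clamp u)); have := ler_norm (- f (clamp v)); rewrite normrN.
have := normr_ge0 (f (clamp u)); have := normr_ge0 (f (clamp v)).
rewrite ler_norml; lra.
Qed.

End clamp.

(** * Almost sure Fourier decay *)

Section fourier_ae.
Context d (T : measurableType d) (R : realType) (P : probability T R).
Local Notation mu := (@lebesgue_measure R).
Variables (X : R -> T -> R) (a b c C : R).
Hypothesis reg : regular_on P X a b c C.

Definition osc_int phi xi1 xi2 (w : T) : R :=
  \int[mu]_(t in `[a, b]) osc_integrand X a phi xi1 xi2 w t.

Let ab := reg_ab reg.

Definition path_continuous (w : T) : Prop :=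
  {within `[a, b], continuous (fun t => X t w)}.

(** The continuous integrand on the whole line that agrees with the original one
    on [a, b]. *)
Let osc_clamped phi xi1 xi2 w t :=
  cos (phi + 2 * pi * xi1 * (t - a) + 2 * pi * xi2 * (X (clamp a b t) w - X 0 w)).

Lemma osc_clamped_continuous phi xi1 xi2 w : path_continuous w ->
  continuous (osc_clamped phi xi1 xi2 w).
Proof.
move=> cw.
have cX : continuous ((fun t => X t w) \o clamp a b).
  exact: (continuous_clamp_comp (ltW ab) (@subset_refl _ _) cw).
move=> t; apply: (continuous_comp (f := fun t => phi + 2 * pi * xi1 * (t - a) +
   2 * pi * xi2 * (X (clamp a b t) w - X 0 w)) (g := cos)); last exact: continuous_cos.
apply: (@continuousD R R R); last first.
  apply: (@continuousM R R); first exact: cvg_cst.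
  by apply: (@continuousB R R R); [exact: cX|exact: cvg_cst].
apply: (@continuousD R R R); first exact: cvg_cst.
apply: (@continuousM R R); first exact: cvg_cst.
by apply: (@continuousB R R R); [exact: cvg_id|exact: cvg_cst].
Qed.

Lemma osc_clampedE phi xi1 xi2 w t : a <= t <= b ->
  osc_clamped phi xi1 xi2 w t = osc_integrand X a phi xi1 xi2 w t.
Proof. by move=> tab; rewrite /osc_clamped clamp_id. Qed.

Lemma interval_finite : (mu `[a, b]%classic < +oo)%E.
Proof. by rewrite /= lebesgue_measure_itv/=; case: ifP => _; rewrite ?ltry -?EFinB ?ltry. Qed.

Lemma interval_lengthE : fine (mu `[a, b]%classic) = b - a.
Proof. by rewrite /= lebesgue_measure_itv/= lte_fin ab. Qed.

Lemma bounded_continuous_integrable (f : R -> R) (M : R) : continuous f ->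
  (forall t, `|f t| <= M) -> mu.-integrable `[a, b]%classic (EFin \o f).
Proof.
move=> cf fM; apply: measurable_bounded_integrable => //; first exact: interval_finite.
  by apply: measurable_funTS; exact: continuous_measurable_fun.
by exists M; split; [exact: num_real|move=> x Mx t _ /=]; rewrite (le_trans (fM t))// ltW.
Qed.

Lemma osc_int_clamped phi xi1 xi2 w :
  osc_int phi xi1 xi2 w = \int[mu]_(t in `[a, b]) osc_clamped phi xi1 xi2 w t.
Proof.
by apply: eq_Rintegral => t; rewrite inE/= in_itv/= => tab; rewrite osc_clampedE.
Qed.

Lemma osc_integrable phi xi1 xi2 w : path_continuous w ->
  mu.-integrable `[a, b]%classic (EFin \o osc_integrand X a phi xi1 xi2 w).
Proof.
move=> cw.
have ic : mu.-integrable `[a, b]%classic (EFin \o osc_clamped phi xi1 xi2 w).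
  apply: (@bounded_continuous_integrable _ 1); first exact: osc_clamped_continuous.
  by move=> t; exact: cos_max.
apply: eq_integrable ic => // t.
by rewrite inE/= in_itv/= => tab; rewrite /= osc_clampedE.
Qed.

Lemma osc_riemann_cvg phi xi1 xi2 w : path_continuous w ->
  osc_riemann X a b phi xi1 xi2 n w @[n --> \oo] --> osc_int phi xi1 xi2 w.
Proof.
move=> cw; have cg := osc_clamped_continuous (phi := phi) (xi1 := xi1) (xi2 := xi2) cw.
set g := osc_clamped phi xi1 xi2 w in cg.
have c1g : continuous (fun t => 1 + g t).
  by move=> t; apply: (@continuousD R R R); [exact: cvg_cst|exact: cg].
have g1 t : `|g t| <= 1 by exact: cos_max.
have g0 t : 0 <= 1 + g t by have := cos_geN1 (phi + 2 * pi * xi1 * (t - a) +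
   2 * pi * xi2 * (X (clamp a b t) w - X 0 w)); rewrite /g /osc_clamped; lra.
have ig : mu.-integrable `[a, b]%classic (EFin \o g).
  exact: bounded_continuous_integrable g1.
have i1 : mu.-integrable `[a, b]%classic (EFin \o (fun _ : R => 1 : R)).
  apply: (@bounded_continuous_integrable _ 1) => [t|t]; first exact: cvg_cst.
  by rewrite normr1.
have ub : exists M, forall t, 1 + g t <= M.
  by exists 2 => t; have := ler_norm (g t); have := g1 t; lra.
have := riemann_sum_cvg ab c1g g0 ub.
have -> : (\int[mu]_(t in `[a, b]) (1 + g t)%:E = ((b - a) + osc_int phi xi1 xi2 w)%:E)%E.
  have i1g : mu.-integrable `[a, b]%classic (EFin \o (fun t => 1 + g t)).
    apply: (@bounded_continuous_integrable _ 2) => [//|t].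
    by rewrite ger0_norm//; have := ler_norm (g t); have := g1 t; lra.
  rewrite -[LHS]fineK ?integrable_fin_num//; congr (_%:E).
  rewrite -/(Rintegral _ _ _) RintegralD// Rintegral_cst// interval_lengthE mul1r.
  by rewrite osc_int_clamped.
have -> : (fun n => (mesh a b n * \sum_(i < n.+1) (1 + g (grid_pt a (mesh a b n) i)))%:E) =
    EFin \o (fun n => (b - a) + osc_riemann X a b phi xi1 xi2 n w).
  apply/funext => n /=; congr (_%:E); rewrite big_split/= mulrDr; congr (_ + _).
    by rewrite sumr_const card_ord /mesh divfK.
  rewrite /osc_riemann; congr (_ * _); apply: eq_bigr => i _.
  have hi := grid_pt_le a (mesh_gt0 ab n) (ltnW (ltn_ord i)).
  have lo : a <= grid_pt a (mesh a b n) i.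
    by rewrite /grid_pt lerDl mulr_ge0// ltW// mesh_gt0.
  rewrite grid_pt_mesh in hi.
  by rewrite /g osc_clampedE// lo.
move=> /fine_cvg/= h.
have hB := cvgB h (cvg_cst (b - a)).
have E : b - a + osc_int phi xi1 xi2 w - (b - a) = osc_int phi xi1 xi2 w by ring.
rewrite E in hB.
suff -> : (fun n => osc_riemann X a b phi xi1 xi2 n w) =
  (fun n => b - a + osc_riemann X a b phi xi1 xi2 n w - (b - a)) by exact: hB.
by apply/funext => n; ring.
Qed.

(** A grid of step 8^-k in the square of half-side 8^k, and four phases. *)
Definition freq_index k : finType := ('I_(2 * 64 ^ k).+1 * 'I_(2 * 64 ^ k).+1 * 'I_4)%type.

Definition freq k (i : nat) : R := (i%:R - 64 ^+ k) / 8 ^+ k.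

(** The quarter turns: cos with these phases is cos, -sin, -cos and sin, and
    upper bounds for all four bound both parts of the transform in absolute
    value. *)
Definition phase (q : nat) : R := q%:R * (pi / 2).

Definition high_freq k (xi1 xi2 : R) :=
  (0 < k)%N /\ ((8 ^+ k / 16 <= `|xi1|) \/ (8 ^+ k / 16 <= `|xi2|)).

(** The oscillating integral is only known to be a limit of Riemann sums on
    continuous paths, so its measurability is replaced by that of a lower limit
    that coincides with it there; Fatou's lemma gives the bound. *)
Lemma exp_osc_majorant : exists2 Q : R, 0 <= Q & forall k phi xi1 xi2, exists g : T -> \bar R,
  [/\ measurable_fun setT g, forall w, (0 <= g w)%E, (\int[P]_w g w <= Q%:E)%E &
    high_freq k xi1 xi2 -> forall w, path_continuous w ->
      g w = (expR (2 ^+ k * osc_int phi xi1 xi2 w))%:E].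
Proof.
have [Q HQ] := expectation_exp_osc_riemann reg.
exists `|Q| => [//|k phi xi1 xi2].
have [[k0 hk]|nh] := pselect (high_freq k xi1 xi2); last first.
  exists (cst 0%E); split=> //; first by rewrite integral0 lee_fin.
have [j0 hj] := HQ k phi xi1 xi2 k0 hk.
pose n j := (4 ^ k * (j0 + j).+1).-1.
pose f j w := (expR (2 ^+ k * osc_riemann X a b phi xi1 xi2 (n j) w))%:E.
have mf j : measurable_fun setT (fun w => expR (2 ^+ k * osc_riemann X a b phi xi1 xi2 (n j) w)).
  apply: measurableT_comp; first exact: measurable_expR.
  apply: measurable_funM => //; apply: measurable_funM => //; apply: measurable_sum => i.
  apply: measurableT_comp; first exact: (@continuous_measurable_fun _ cos (@continuous_cos R)).
  apply: measurable_funD => //; apply: measurable_funM => //.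
  by apply: measurable_funB; exact: (reg_meas reg).
exists (fun w => limn_einf (f ^~ w)); split.
- by apply: measurable_limn_einf => j; apply/measurable_EFinP.
- by move=> w; apply: limn_einf_ge0 => j; rewrite lee_fin expR_ge0.
- apply: expectation_limn_einf_le.
  + by move=> j; apply/measurable_EFinP.
  + by move=> j w; rewrite lee_fin expR_ge0.
  + move=> j; rewrite /f integral_fin_Rintegral.
      by rewrite lee_fin (le_trans _ (ler_norm Q))// hj// leq_addr.
    apply: (@bounded_integrable _ _ _ _ _ (expR (2 ^+ k * (mesh a b (n j) * (n j).+1%:R)))) => // w.
    rewrite ger0_norm ?expR_ge0// ler_expR ler_wpM2l ?exprn_ge0//.
    apply: ler_wpM2l; first by rewrite ltW// mesh_gt0.
    have -> : (n j).+1%:R = \sum_(i < (n j).+1) (1 : R) by rewrite sumr_const card_ord.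
    by apply: ler_sum => i _; exact: cos_le1.
- move=> _ w cw; apply: (cvg_limn_einf_sup _).1.
  apply: cvg_EFin; first exact: nearW.
  apply: (cvg_comp _ expR); last exact: continuous_expR.
  apply: cvgM; first exact: cvg_cst.
  have ncvg : n j @[j --> \oo] --> \oo.
    move=> A [N _ NA]; exists N => // j /= Nj; apply: NA => /=.
    rewrite /n -ltnS prednK ?muln_gt0 ?expn_gt0//.
    apply: (@leq_trans (j0 + j).+1); first by rewrite ltnS (leq_trans Nj)// leq_addl.
    by rewrite leq_pmull// expn_gt0.
  apply: (@cvg_comp _ _ _ n (fun m => osc_riemann X a b phi xi1 xi2 m w) _ _ _ ncvg).
  exact: osc_riemann_cvg.
Qed.

(** Averaging over the finitely many frequencies of level k keeps the
    expectation bounded; undoing the average is the union bound. *)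
Lemma ae_exp_osc_bound : {ae P, forall w, path_continuous w ->
  exists2 K : R, 0 <= K & forall k (p : freq_index k),
    high_freq k (freq k p.1.1) (freq k p.1.2) ->
    expR (2 ^+ k * osc_int (phase p.2) (freq k p.1.1) (freq k p.1.2) w)
      <= K * #|freq_index k|%:R * 2 ^+ k.+1}.
Proof.
have [Q Q0 HQ] := exp_osc_majorant.
have [gf gfP] := choice (fun kp : {k & freq_index k} =>
  HQ (tag kp) (phase (tagged kp).2) (freq (tag kp) (tagged kp).1.1) (freq (tag kp) (tagged kp).1.2)).
pose card k : R := #|freq_index k|%:R.
have card0 k : 0 < card k.
  by rewrite ltr0n; apply/card_gt0P; exists (ord0, ord0, ord0).
pose g k w := (\sum_(p : freq_index k) (((card k)^-1)%:E * gf (Tagged freq_index p) w))%E.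
have gf0 kp w : (0 <= gf kp w)%E by have [_ + _ _] := gfP kp; exact.
have mgf kp : measurable_fun setT (gf kp) by have [] := gfP kp.
have igf kp : (\int[P]_w gf kp w <= Q%:E)%E by have [] := gfP kp.
have t0 k p w : (0 <= ((card k)^-1)%:E * gf (Tagged freq_index p) w)%E.
  by rewrite mule_ge0// lee_fin invr_ge0 ltW.
have mt k p : measurable_fun setT (fun w => ((card k)^-1)%:E * gf (Tagged freq_index p) w)%E.
  exact: emeasurable_funM.
have hB : {ae P, forall w, exists2 K : R, 0 <= K &
    forall k, (g k w <= (K * 2 ^+ k.+1)%:E)%E}.
  apply: (@ae_bounded_of_expectation _ _ _ P g Q).
- by move=> k; apply: emeasurable_sum.
- by move=> k w; apply: sume_ge0.
- move=> k; rewrite ge0_integral_sum//.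
  apply: (@le_trans _ _ (\sum_(p : freq_index k) ((card k)^-1 * Q)%:E)%E).
    apply: lee_sum => p _; rewrite ge0_integralZl_EFin ?invr_ge0 ?(ltW (card0 _))//.
    by rewrite EFinM lee_wpmul2l// lee_fin invr_ge0 ltW.
  rewrite sumEFin sumr_const lee_fin -mulr_natl -/(card k) mulrA divff ?mul1r//.
  by rewrite gt_eqF.
apply: filterS hB => w [K K0 hK] cw; exists K => // k p hf.
have [_ _ _ /(_ hf w cw) gE] := gfP (Tagged freq_index p).
rewrite -lee_fin -[X in (X <= _)%E]gE.
have : (((card k)^-1)%:E * gf (Tagged freq_index p) w <= (K * 2 ^+ k.+1)%:E)%E.
  apply: le_trans (hK k); rewrite /g (bigD1 p)//= leeDl// sume_ge0//.
by rewrite lee_pdivrMl// -EFinM mulrCA mulrA.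
Qed.

(** The path is bounded on [a, b], so the phase is Lipschitz in the frequency;
    a grid of step 8^-k therefore represents all frequencies up to an error
    O(8^-k). *)
Lemma osc_int_lip w : path_continuous w -> exists2 L : R, 0 <= L &
  forall phi xi1 xi2 xi1' xi2',
  `|osc_int phi xi1 xi2 w - osc_int phi xi1' xi2' w| <=
  L * (`|xi1 - xi1'| + `|xi2 - xi2'|).
Proof.
move=> cw.
have cX : continuous ((fun t => X t w) \o clamp a b).
  exact: (continuous_clamp_comp (ltW ab) (@subset_refl _ _) cw).
have [M hM] := clamp_bounded (ltW ab) cX.
pose M' := M + `|X 0 w|.
have M0 : 0 <= M by apply: le_trans (hM 0).
have M'0 : 0 <= M' by rewrite addr_ge0.
have pi0 : 0 <= pi :> R by exact: pi_ge0.
exists (2 * pi * (1 + M')) => [|phi xi1 xi2 xi1' xi2'].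
  by rewrite !mulr_ge0// addr_ge0.
set D := `|xi1 - xi1'| + `|xi2 - xi2'|.
have D0 : 0 <= D by rewrite addr_ge0.
have int x1 x2 : mu.-integrable `[a, b]%classic (EFin \o osc_clamped phi x1 x2 w).
  apply: (@bounded_continuous_integrable _ 1); first exact: osc_clamped_continuous.
  by move=> t; exact: cos_max.
rewrite !osc_int_clamped -RintegralB//.
have intB : mu.-integrable `[a, b]%classic
    (EFin \o (fun t => osc_clamped phi xi1 xi2 w t - osc_clamped phi xi1' xi2' w t)).
  apply: (@bounded_continuous_integrable _ 2) => [t|t].
    by apply: (@continuousB R R R); exact: osc_clamped_continuous.
  apply: (le_trans (ler_normB _ _)).
  have h1 := cos_max (phi + 2 * pi * xi1 * (t - a) + 2 * pi * xi2 * (X (clamp a b t) w - X 0 w)).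
  have h2 := cos_max (phi + 2 * pi * xi1' * (t - a) + 2 * pi * xi2' * (X (clamp a b t) w - X 0 w)).
  by rewrite /osc_clamped; lra.
apply: (le_trans (le_normr_Rintegral _ intB)) => //.
apply: (@le_trans _ _ (\int[mu]_(t in `[a, b]) (2 * pi * (1 + M') * D))).
  apply: le_Rintegral => //.
  - exact: integrable_norm.
  - apply: (@bounded_continuous_integrable _ `|2 * pi * (1 + M') * D|) => [t|t//].
    exact: cvg_cst.
  - move=> t /=; rewrite in_itv/= => /andP[at_ tb].
    apply: (le_trans (cos_lip _ _)).
    have -> : phi + 2 * pi * xi1 * (t - a) + 2 * pi * xi2 * (X (clamp a b t) w - X 0 w) -
      (phi + 2 * pi * xi1' * (t - a) + 2 * pi * xi2' * (X (clamp a b t) w - X 0 w)) =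
      2 * pi * ((xi1 - xi1') * (t - a) + (xi2 - xi2') * (X (clamp a b t) w - X 0 w)) by ring.
    rewrite normrM ger0_norm ?mulr_ge0// -mulrA ler_wpM2l ?mulr_ge0//.
    apply: (le_trans (ler_normD _ _)); rewrite !normrM.
    have h1 : `|t - a| <= 1 + M'.
      rewrite ger0_norm ?subr_ge0//; have := reg_len reg; lra.
    have h2 : `|X (clamp a b t) w - X 0 w| <= 1 + M'.
      apply: (le_trans (ler_normB _ _)); have := hM t; rewrite /M' /=; lra.
    rewrite /D mulrDr; apply: lerD; rewrite mulrC ler_wpM2r//.
rewrite Rintegral_cst// interval_lengthE ler_piMr//; last exact: reg_len reg.
by rewrite !mulr_ge0// addr_ge0.
Qed.

Lemma freq_approx k xi : `|xi| < 8 ^+ k ->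
  exists i : 'I_(2 * 64 ^ k).+1, `|xi - freq k i| <= 1 / 8 ^+ k.
Proof.
move=> xik; have k8 : 0 < (8 : R) ^+ k by rewrite exprn_gt0.
have e64 : (64 : R) ^+ k = 8 ^+ k * 8 ^+ k by rewrite -exprMn; congr (_ ^+ _); ring.
pose y := xi * 8 ^+ k + 64 ^+ k.
move: xik; rewrite ltr_norml => /andP[h1 h2].
have y0 : 0 <= y.
  have := ler_wpM2r (ltW k8) (ltW h1); rewrite /y e64; lra.
have y1 : y < (2 * 64 ^ k).+1%:R.
  have -> : (2 * 64 ^ k).+1%:R = 2 * 64 ^+ k + 1 :> R by rewrite -addn1 natrD natrM natrX.
  by have := ler_wpM2r (ltW k8) (ltW h2); rewrite /y e64; lra.
have yn : (Num.truncn y < (2 * 64 ^ k).+1)%N by rewrite truncn_lt_nat.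
exists (Ordinal yn) => /=; have /andP[t1 t2] := truncn_itv y0.
rewrite /freq.
have -> : xi - ((Num.truncn y)%:R - 64 ^+ k) / 8 ^+ k = (y - (Num.truncn y)%:R) / 8 ^+ k.
  by rewrite /y; field; rewrite gt_eqF.
have k8i : 0 <= ((8 : R) ^+ k)^-1 by rewrite invr_ge0 ltW.
rewrite normrM (ger0_norm k8i).
rewrite ler_wpM2r// ger0_norm ?subr_ge0//.
by move: t2; rewrite -[X in X%:R]addn1 natrD; lra.
Qed.

Lemma card_freq_index_le k : (#|freq_index k|%:R * 2 ^+ k.+1 : R) <= expR (14 * k.+1%:R).
Proof.
have le2e : 2 <= expR 1 :> R by apply: le_trans (expR_ge1Dx 1); lra.
apply: (@le_trans _ _ (2 ^+ (14 * k.+1))); last first.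
  by rewrite -natrM -[X in expR X]mulr1 expRM_natl lerXn2r// nnegrE ?expR_ge0.
rewrite -!natrX -natrM ler_nat /freq_index !card_prod !card_ord.
have h : ((2 * 64 ^ k).+1 <= 2 ^ (6 * k + 2))%N.
  rewrite expnD expnM (_ : 2 ^ 6 = 64)%N// (_ : 2 ^ 2 = 4)%N//.
  have : (0 < 64 ^ k)%N by rewrite expn_gt0.
  by move: (64 ^ k)%N => y y0; rewrite mulnC; lia.
apply: (@leq_trans (2 ^ (6 * k + 2) * 2 ^ (6 * k + 2) * 2 ^ 2 * 2 ^ k.+1)%N).
  by rewrite leq_mul2r leq_mul2r leq_mul ?orbT.
by rewrite -!expnD leq_exp2l//; lia.
Qed.

(** The logarithm of the union bound over e^O(k) frequencies is O(k), and
    dividing by lam = 2^k gives the rate. *)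
Lemma ae_osc_decay : {ae P, forall w, path_continuous w ->
  exists2 L : R, 0 <= L & forall k xi1 xi2 (q : 'I_4), (0 < k)%N ->
    `|xi1| < 8 ^+ k -> `|xi2| < 8 ^+ k ->
    (8 ^+ k.-1 <= `|xi1|) \/ (8 ^+ k.-1 <= `|xi2|) ->
    osc_int (phase q) xi1 xi2 w <= L * k.+1%:R / 2 ^+ k}.
Proof.
apply: filterS ae_exp_osc_bound => w hw cw.
have [K K0 hK] := hw cw; have [L0 L00 hL0] := osc_int_lip cw.
exists (K + 14 + 2 * L0) => [|k xi1 xi2 q k0 hx1 hx2 hx].
  by rewrite !addr_ge0// mulr_ge0.
have [i hi] := freq_approx hx1; have [j hj] := freq_approx hx2.
have k8 : 0 < (8 : R) ^+ k by rewrite exprn_gt0.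
have k2 : 0 < (2 : R) ^+ k by rewrite exprn_gt0.
have k28 : (2 : R) ^+ k <= 8 ^+ k by rewrite lerXn2r// ?nnegrE// ler_nat.
have kp : (1 : R) <= 8 ^+ k.-1 by rewrite exprn_ege1// ler1n.
have e8 : (8 : R) ^+ k = 8 * 8 ^+ k.-1 by rewrite -exprS prednK.
have k81 : 1 / (8 : R) ^+ k <= 1 / 8 by rewrite !div1r lef_pV2 ?posrE//; lra.
have big (x y : R) : 8 ^+ k.-1 <= `|x| -> `|x - y| <= 1 / 8 ^+ k -> 8 ^+ k / 16 <= `|y|.
  move=> h1 h2; have := ler_normD (x - y) y; rewrite subrK => h3.
  by have := e8; lra.
have hf : high_freq k (freq k i) (freq k j).
  by split=> //; case: hx => hx; [left; exact: big hi|right; exact: big hj].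
have /= h1 := hK k ((i, j), q) hf.
have h2 : 2 ^+ k * osc_int (phase q) (freq k i) (freq k j) w <= K + 14 * k.+1%:R.
  rewrite -ler_expR (le_trans h1)// -mulrA expRD; apply: ler_pM => //.
  - by apply: le_trans (expR_ge1Dx K); lra.
  - exact: card_freq_index_le.
have h3 := hL0 (phase q) xi1 xi2 (freq k i) (freq k j).
have h4 : osc_int (phase q) xi1 xi2 w <=
    osc_int (phase q) (freq k i) (freq k j) w + L0 * (2 / 8 ^+ k).
  have h5 : L0 * (`|xi1 - freq k i| + `|xi2 - freq k j|) <= L0 * (2 / 8 ^+ k).
    rewrite ler_wpM2l//; have -> : 2 / 8 ^+ k = 1 / 8 ^+ k + 1 / 8 ^+ k :> R by field; rewrite gt_eqF.
    exact: lerD.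
  have := ler_norm (osc_int (phase q) xi1 xi2 w - osc_int (phase q) (freq k i) (freq k j) w).
  by lra.
apply: (le_trans h4); rewrite ler_pdivlMr// mulrDl.
have k1 : (1 : R) <= k.+1%:R by rewrite ler1n.
have h6 : L0 * (2 / 8 ^+ k) * 2 ^+ k <= 2 * L0.
  have -> : L0 * (2 / 8 ^+ k) * 2 ^+ k = 2 * L0 * (2 ^+ k / 8 ^+ k) by field; rewrite gt_eqF.
  by rewrite ler_piMr ?mulr_ge0// ler_pdivrMr// mul1r.
have h7 : K + 2 * L0 <= (K + 2 * L0) * k.+1%:R by rewrite ler_peMr// addr_ge0// mulr_ge0.
by rewrite mulrC in h2; lra.
Qed.

End fourier_ae.

(** * Fourier dimension of the graph *)

Section fourier_deterministic.
Context (R : realType).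
Local Notation mu := (@lebesgue_measure R).

(** Adding the bound M makes f nonnegative. *)
Lemma expectation_uniform (a b : R) (ab : a < b) (f : R -> R) (M : R) :
  measurable_fun setT f -> (forall t, `|f t| <= M) ->
  \int[uniform_prob ab]_t f t = (b - a)^-1 * \int[mu]_(t in `[a, b]) f t.
Proof.
move=> mf fM.
have M0 : 0 <= M by apply: le_trans (fM 0).
have iu : (uniform_prob ab).-integrable setT (EFin \o f).
  exact: (@bounded_integrable _ _ _ (uniform_prob ab) f M mf fM).
have iM : (uniform_prob ab).-integrable setT (EFin \o (fun=> M)).
  by apply: (@bounded_integrable _ _ _ (uniform_prob ab) _ M) => // w; rewrite ger0_norm.
have len : fine (mu `[a, b]%classic) = b - a by rewrite /= lebesgue_measure_itv/= lte_fin ab.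
have fin : (mu `[a, b]%classic < +oo)%E.
  by rewrite /= lebesgue_measure_itv/=; case: ifP => _; rewrite ?ltry -?EFinB ?ltry.
have im (g : R -> R) : measurable_fun setT g -> (exists N, forall t : R, `|g t| <= N) ->
    mu.-integrable `[a, b]%classic (EFin \o g).
  move=> mg [N gN]; apply: measurable_bounded_integrable => //.
    exact: measurable_funTS.
  by exists N; split; [exact: num_real|move=> x Nx t _ /=]; rewrite (le_trans (gN t))// ltW.
have mfM : measurable_fun setT (fun t => f t + M) by exact: measurable_funD.
have fM0 t : 0 <= f t + M by have := fM t; rewrite ler_norml; lra.
have fM2 t : `|f t + M| <= 2 * M.
  by apply: (le_trans (ler_normD _ _)); rewrite (ger0_norm M0); have := fM t; lra.
have imf := im _ mf (ex_intro _ M fM).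
have imfM := im _ mfM (ex_intro _ _ fM2).
have iufM : (uniform_prob ab).-integrable setT (EFin \o (fun t => f t + M)).
  exact: (@bounded_integrable _ _ _ (uniform_prob ab) _ _ mfM fM2).
have imM : mu.-integrable `[a, b]%classic (EFin \o (fun=> M)).
  by apply: im => //; exists M => t; rewrite ger0_norm.
have mfME : measurable_fun setT (fun t : measurableTypeR R => (f t + M)%:E).
  exact/measurable_EFinP.
have := integral_uniform ab mfME (fun t => fM0 t).
move=> /(congr1 fine); rewrite -/(Rintegral _ _ _) RintegralD// expectation_cst.
have -> : (\int[mu]_(x in `[a, b]) (f x + M)%:E = (\int[mu]_(x in `[a, b]) (f x + M))%:E)%E.
  by rewrite /Rintegral fineK// integrable_fin_num.
rewrite /= RintegralD// Rintegral_cst// len mulrDr (mulrC M) mulrA mulVf ?mul1r.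
  by move/addIr.
by rewrite subr_eq0 gt_eqF.
Qed.

Lemma norm2_le (xi : R * R) : norm2 xi <= `|xi.1| + `|xi.2|.
Proof.
rewrite /norm2 /dot2 -[leRHS]ger0_norm ?addr_ge0// -sqrtr_sqr ler_wsqrtr//.
rewrite -!expr2 -(real_normK (num_real xi.1)) -(real_normK (num_real xi.2)).
by have := normr_ge0 xi.1; have := normr_ge0 xi.2; nra.
Qed.

Lemma normr_le_norm2 (xi : R * R) : `|xi.1| <= norm2 xi /\ `|xi.2| <= norm2 xi.
Proof.
rewrite /norm2 /dot2 -!expr2; split; rewrite -sqrtr_sqr ler_wsqrtr//.
  by rewrite lerDl sqr_ge0.
by rewrite lerDr sqr_ge0.
Qed.

Lemma norm2_gt0 (xi : R * R) : xi != 0 -> 0 < norm2 xi.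
Proof.
move=> xi0; have [h1 h2] := normr_le_norm2 xi.
have [x0|x0] := eqVneq xi.1 0; last by apply: lt_le_trans h1; rewrite normr_gt0.
apply: lt_le_trans h2; rewrite normr_gt0; apply: contra_neq xi0 => x20.
by rewrite [xi]surjective_pairing x0 x20.
Qed.

Lemma normc_le (x y : R) :
  ComplexField.Normc.normc (Complex x y) <= `|x| + `|y|.
Proof. exact: (norm2_le (x, y)). Qed.

Lemma linear_le_pow2 (e : R) : 0 < e ->
  exists2 K : R, 0 < K & forall k : nat, k.+1%:R <= K * 2 `^ (e * k%:R).
Proof.
move=> e0; have l2 : 0 < ln 2 :> R by rewrite ln_gt0// ltr1n.
have el : 0 < e * ln 2 by rewrite mulr_gt0.
exists (1 + (e * ln 2)^-1) => [|k]; first by rewrite addr_gt0// invr_gt0.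
have h : 1 + e * ln 2 * k%:R <= 2 `^ (e * k%:R).
  rewrite /powR gt_eqF//; apply: le_trans (expR_ge1Dx _).
  by rewrite lerD2l mulrAC.
have i0 : 0 < 1 + (e * ln 2)^-1 by rewrite addr_gt0// invr_gt0.
apply: le_trans (ler_wpM2l (ltW i0) h).
have k0 : 0 <= k%:R :> R by [].
rewrite mulrDl mul1r mulrDr mulr1 [_^-1 * (_ * _)]mulrA mulVf ?gt_eqF// mul1r -natr1.
have : 0 <= e * ln 2 * k%:R by rewrite mulr_ge0// ltW.
have : 0 < (e * ln 2)^-1 by rewrite invr_gt0.
by lra.
Qed.

Lemma scale_exists (m : R) : 1 <= m ->
  exists2 k, (0 < k)%N & 8 ^+ k.-1 <= m < 8 ^+ k.
Proof.
move=> m1.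
have ex : exists k, m < 8 ^+ k.
  exists (Num.truncn m).+1; apply: (lt_trans (truncnS_gt m)).
  by rewrite -natrX ltr_nat; apply: ltn_expl.
case: (ex_minnP ex) => k km kmin; exists k.
  by rewrite lt0n; apply/negP => /eqP k0; move: km; rewrite k0 expr0 ltNge m1.
rewrite km andbT leNgt; apply/negP => /kmin.
case: k km {kmin} => [|k] km; last by rewrite ltnn.
by move: km; rewrite expr0 ltNge m1.
Qed.

End fourier_deterministic.

Section fourier_dim_lower.
Context d (T : measurableType d) (R : realType) (P : probability T R).
Local Notation mu := (@lebesgue_measure R).
Variables (X : R -> T -> R) (a b c C : R) (J : set R).
Hypothesis reg : regular_on P X a b c C.
Hypothesis abJ : `[a, b]%classic `<=` J.
Variable w : T.
Hypothesis cw : path_continuous X a b w.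
Variable L : R.
Hypothesis L0 : 0 <= L.
Hypothesis decay : forall k xi1 xi2 (q : 'I_4), (0 < k)%N ->
    `|xi1| < 8 ^+ k -> `|xi2| < 8 ^+ k ->
    (8 ^+ k.-1 <= `|xi1|) \/ (8 ^+ k.-1 <= `|xi2|) ->
    osc_int X a b (phase R q) xi1 xi2 w <= L * k.+1%:R / 2 ^+ k.

Let ab := reg_ab reg.
Let f : R -> R := (fun t => X t w) \o clamp a b.

Lemma path_clamped_continuous : continuous f.
Proof. exact: (continuous_clamp_comp (ltW ab) (@subset_refl _ _) cw). Qed.

Definition path_curve (t : measurableTypeR R) : (R * R)%type := (t, f t).

Lemma measurable_path_curve : measurable_fun setT path_curve.
Proof.
apply/measurable_fun_pairP; split; first exact: measurable_id.
exact: (continuous_measurable_fun path_clamped_continuous).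
Qed.

Definition path_rv : {RV (uniform_prob ab) >-> (R * R)%type} :=
  MeasurableFun.Pack (MeasurableFun.Class
    (isMeasurableFun.Build _ _ _ _ path_curve measurable_path_curve)).

Let nu := distribution (uniform_prob ab) path_rv.

Lemma nu_negligible : nu.-negligible (~` graph (fun t => X t w) J).
Proof.
pose A := [set z : R * R | z.1 \in `[a, b] /\ z.2 - f z.1 = 0].
have mA : measurable A.
  have -> : A = (fst @^-1` `[a, b]%classic) `&` ((fun z : R * R => z.2 - f z.1) @^-1` [set 0]).
    by apply/seteqP; split => z [h1 h2]; split.
  apply: measurableI; rewrite -[X in measurable X]setTI.
    exact: measurable_fst.
  apply: measurable_funB => //.
  apply: measurableT_comp => //.
  exact: (continuous_measurable_fun path_clamped_continuous).
exists (~` A); split; first exact: measurableC.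
- rewrite /nu /distribution /pushforward/=.
  have -> : path_curve @^-1` (~` A) = ~` `[a, b]%classic.
    apply/seteqP; split => t /=.
      by move=> + tab; apply; split => //; rewrite /path_curve/= subrr.
    by move=> tab [].
  by rewrite /uniform_prob integral_uniform_pdf setICl integral_set0.
- apply: subsetC => z [z1 /eqP]; rewrite subr_eq0 => /eqP z2.
  exists z.1; first exact: abJ.
  rewrite [RHS]surjective_pairing z2 /f/= clamp_id//.
Qed.

Lemma osc_abs k xi1 xi2 : (0 < k)%N ->
    `|xi1| < 8 ^+ k -> `|xi2| < 8 ^+ k ->
    (8 ^+ k.-1 <= `|xi1|) \/ (8 ^+ k.-1 <= `|xi2|) ->
  `|osc_int X a b 0 xi1 xi2 w| <= L * k.+1%:R / 2 ^+ k /\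
  `|osc_int X a b (pi / 2) xi1 xi2 w| <= L * k.+1%:R / 2 ^+ k.
Proof.
move=> k0 h1 h2 h.
have dec q := @decay k xi1 xi2 q k0 h1 h2 h.
have oscN phi : osc_int X a b (phi + pi) xi1 xi2 w = - osc_int X a b phi xi1 xi2 w.
  rewrite -[RHS]mulN1r -RintegralZl//; last exact: (osc_integrable reg).
  apply: eq_Rintegral => t _; rewrite /osc_integrand mulN1r -cosDpi.
  by congr cos; ring.
have q0 := dec ord0; have q1 := dec (Ordinal (isT : (1 < 4)%N)).
have q2 := dec (Ordinal (isT : (2 < 4)%N)); have q3 := dec (Ordinal (isT : (3 < 4)%N)).
rewrite /phase/= mul0r in q0; rewrite /phase/= mul1r in q1.
have e2 : phase R 2 = 0 + pi by rewrite /phase; field.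
have e3 : phase R 3 = pi / 2 + pi by rewrite /phase; field.
rewrite /= e2 oscN in q2; rewrite /= e3 oscN in q3.
by rewrite !ler_norml; split; apply/andP; split => //; rewrite lerNl.
Qed.

Let argument (xi : R * R) (t : R) : R := 2 * pi * dot2 xi (path_curve t).

Lemma argument_continuous xi : continuous (argument xi).
Proof.
have -> : argument xi = (fun t => 2 * pi * (xi.1 * t + xi.2 * f t)) by [].
move=> t; apply: cvgM; first exact: cvg_cst.
apply: cvgD; apply: cvgM; try exact: cvg_cst; first exact: cvg_id.
exact: path_clamped_continuous.
Qed.

Lemma integral_nu (g : R -> R) (xi : R * R) : continuous g -> (forall x, `|g x| <= 1) ->
  \int[nu]_x g (2 * pi * dot2 xi x) = (b - a)^-1 * \int[mu]_(t in `[a, b]) g (argument xi t).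
Proof.
move=> cg g1.
have cga : continuous (fun t => g (argument xi t)).
  move=> t; apply: (continuous_comp (f := argument xi) (g := g)); first exact: argument_continuous.
  exact: cg.
rewrite -(@expectation_uniform _ _ _ ab _ 1)//; last exact: continuous_measurable_fun.
have mg : measurable_fun setT (fun x : (R * R)%type => (g (2 * pi * dot2 xi x))%:E).
  apply/measurable_EFinP; apply: measurableT_comp; first exact: continuous_measurable_fun.
  apply: measurable_funM => //; apply: measurable_funD; apply: measurable_funM => //.
rewrite /Rintegral (integral_pushforward measurable_path_curve mg _ measurableT)//.
apply: (@bounded_integrable _ _ _ (uniform_prob ab) _ 1) => [|t]; last exact: g1.
exact: continuous_measurable_fun cga.
Qed.

Lemma argument_integral xi t0 : t0 = 2 * pi * (xi.1 * a + xi.2 * X 0 w) ->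
  \int[mu]_(t in `[a, b]) cos (argument xi t) =
    cos t0 * osc_int X a b 0 xi.1 xi.2 w + sin t0 * osc_int X a b (pi / 2) xi.1 xi.2 w /\
  \int[mu]_(t in `[a, b]) sin (argument xi t) =
    sin t0 * osc_int X a b 0 xi.1 xi.2 w - cos t0 * osc_int X a b (pi / 2) xi.1 xi.2 w.
Proof.
move=> t0E.
have i0 := osc_integrable reg 0 xi.1 xi.2 cw.
have i1 := osc_integrable reg (pi / 2) xi.1 xi.2 cw.
have iZ phi (r : R) : mu.-integrable `[a, b]%classic
    (EFin \o (fun t => r * osc_integrand X a phi xi.1 xi.2 w t)).
  have ip := osc_integrable reg phi xi.1 xi.2 cw.
  have mab : measurable (`[a, b]%classic : set (measurableTypeR R)) by [].
  exact: (integrableZl mab r ip).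
have oz phi (r : R) : r * osc_int X a b phi xi.1 xi.2 w =
    \int[mu]_(t in `[a, b]) (r * osc_integrand X a phi xi.1 xi.2 w t).
  by rewrite RintegralZl//; exact: (osc_integrable reg).
pose A t := 2 * pi * xi.1 * (t - a) + 2 * pi * xi.2 * (X t w - X 0 w).
have arg t : t \in `[a, b]%classic -> argument xi t = A t + t0.
  rewrite inE/= in_itv/= => tab; rewrite /argument /dot2 /A t0E /=.
  by rewrite /f/= clamp_id//; ring.
have o0 t : osc_integrand X a 0 xi.1 xi.2 w t = cos (A t) by rewrite /osc_integrand add0r.
have o1 t : osc_integrand X a (pi / 2) xi.1 xi.2 w t = - sin (A t).
  by rewrite /osc_integrand -addrA addrC cosDpihalf.
split.
  rewrite !oz -RintegralD//.
  by apply: eq_Rintegral => t /arg ->; rewrite o0 o1 cosD; ring.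
rewrite !oz -RintegralB//.
by apply: eq_Rintegral => t /arg ->; rewrite o0 o1 sinD; ring.
Qed.

Lemma normc_fourier_le xi B :
  `|osc_int X a b 0 xi.1 xi.2 w| <= B -> `|osc_int X a b (pi / 2) xi.1 xi.2 w| <= B ->
  ComplexField.Normc.normc (fourier_transform nu xi) <= (b - a)^-1 * (4 * B).
Proof.
move=> h0 h1; apply: (le_trans (normc_le _ _)); rewrite normrN.
have [e1 e2] := argument_integral (erefl (2 * pi * (xi.1 * a + xi.2 * X 0 w))).
move: e1 e2; set t0 := 2 * pi * _ => e1 e2.
have li : 0 <= (b - a)^-1 by rewrite invr_ge0 subr_ge0 ltW.
rewrite (integral_nu xi (@continuous_cos R) (@cos_max R)) e1.
rewrite (integral_nu xi (@continuous_sin R) (@sin_max R)) e2.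
rewrite !normrM !(ger0_norm li) -mulrDr ler_wpM2l//.
have B0 : 0 <= B by apply: le_trans h0.
have hb x y : `|x| <= 1 -> `|y| <= B -> `|x * y| <= B.
  by move=> x1 yB; rewrite normrM -[leRHS]mul1r ler_pM.
have c1 := hb _ _ (cos_max t0) h0; have c2 := hb _ _ (cos_max t0) h1.
have s1 := hb _ _ (sin_max t0) h0; have s2 := hb _ _ (sin_max t0) h1.
have := ler_normD (cos t0 * osc_int X a b 0 xi.1 xi.2 w) (sin t0 * osc_int X a b (pi / 2) xi.1 xi.2 w).
have := ler_normB (sin t0 * osc_int X a b 0 xi.1 xi.2 w) (cos t0 * osc_int X a b (pi / 2) xi.1 xi.2 w).
by lra.
Qed.

Lemma osc_int_trivial phi xi1 xi2 : `|osc_int X a b phi xi1 xi2 w| <= b - a.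
Proof.
have i0 := osc_integrable reg phi xi1 xi2 cw.
apply: (le_trans (le_normr_Rintegral _ i0)) => //.
have -> : b - a = \int[mu]_(t in `[a, b]) 1.
  by rewrite Rintegral_cst// mul1r; apply/esym; rewrite /= lebesgue_measure_itv/= lte_fin ab.
apply: le_Rintegral => //; first exact: integrable_norm.
  apply: measurable_bounded_integrable => //; first exact: interval_finite.
  by exists 1; split; [exact: num_real|move=> x x1 t _ /=]; rewrite normr1 ltW.
by move=> t _; exact: cos_max.
Qed.

(** At scale 8^k the transform is O(k 2^-k), while |xi|^(-alpha/2) is about
    8^(-k alpha / 2).  Since 3 alpha / 2 < 1 the gain is 2^(e k) with
    e = 1 - 3 alpha / 2 > 0, and it absorbs the factor k. *)
Lemma fourier_dim_graph_ge (alpha : R) : 0 <= alpha < 2 / 3 ->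
  (alpha%:E <= fourier_dim (graph (fun t => X t w) J))%E.
Proof.
move=> /andP[al0 al1]; apply: ereal_sup_ubound; exists alpha => //; split => //.
exists nu; split.
- apply/eqP => h.
  have e1 : distribution (uniform_prob ab) path_rv setT = 1%E := probability_setT _.
  by move: (etrans (esym e1) h) => [] /eqP; rewrite oner_eq0.
- exact: nu_negligible.
pose e : R := 1 - 3 * (alpha / 2).
have e0 : 0 < e by rewrite /e; lra.
have [K K0 hK] := linear_le_pow2 e0.
pose li := (b - a)^-1.
have li0 : 0 <= li by rewrite invr_ge0 subr_ge0 ltW.
pose M := 4 * (li * (4 * (b - a))) + li * (4 * L) * K * 2.
have ba0 : 0 <= b - a by rewrite subr_ge0 ltW.
exists M => xi xi0.
have N0 := norm2_gt0 xi0; set N := norm2 xi in N0 *.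
have [n1 n2] := normr_le_norm2 xi; have n3 := norm2_le xi.
have [m mE] : exists m : R, m = Num.max `|xi.1| `|xi.2| by eexists.
have m1 : `|xi.1| <= m by rewrite mE le_max lexx.
have m2 : `|xi.2| <= m by rewrite mE le_max lexx orbT.
have Nm : N <= 2 * m by rewrite /N; lra.
have mp : 0 <= M by rewrite addr_ge0// !mulr_ge0// ltW.
have t2 : 0 <= 4 * (li * (4 * (b - a))) by rewrite !mulr_ge0.
have t3 : 0 <= li * (4 * L) * K * 2 by rewrite !mulr_ge0// ltW.
have mono x y : 0 < x -> x <= y -> y `^ (- (alpha / 2)) <= x `^ (- (alpha / 2)).
  move=> x0 xy; rewrite !powRN lef_pV2 ?posrE ?powR_gt0//; last exact: lt_le_trans xy.
  by rewrite ge0_ler_powR// ?nnegrE ?divr_ge0// ltW// (lt_le_trans x0).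
have half : 2^-1 <= 2 `^ (- (alpha / 2)) :> R.
  rewrite [leLHS](_ : _ = 2 `^ (-1)); last by rewrite powR_inv1.
  by rewrite ler_powR ?ler1n//; lra.
(* Frequencies of size less than 1 only need the trivial bound. *)
have [mlt|mge] := ltP m 1.
  apply: (le_trans (normc_fourier_le (osc_int_trivial _ _ _) (osc_int_trivial _ _ _))).
  have : 2 `^ (- (alpha / 2)) <= N `^ (- (alpha / 2)) by apply: mono => //; lra.
  move=> h; have h2 : 2^-1 <= N `^ (- (alpha / 2)) by exact: le_trans h.
  have : M * 2^-1 <= M * N `^ (- (alpha / 2)) by rewrite ler_wpM2l.
  by rewrite -/li; move: t2 t3; rewrite /M; set u := li * (4 * (b - a)); set v := _ * 2; lra.
have [k k0 /andP[mk1 mk2]] := scale_exists mge.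
have hx : (8 ^+ k.-1 <= `|xi.1|) \/ (8 ^+ k.-1 <= `|xi.2|).
  by move: mk1; rewrite mE le_max => /orP.
have [h0 h1] := osc_abs k0 (le_lt_trans m1 mk2) (le_lt_trans m2 mk2) hx.
apply: (le_trans (normc_fourier_le h0 h1)); rewrite -/li.
have k8 : 0 < (8 : R) ^+ k by rewrite exprn_gt0.
have N8 : (2 * 8 ^+ k) `^ (- (alpha / 2)) <= N `^ (- (alpha / 2)).
  by apply: mono => //; lra.
have hh : 2^-1 * (8 ^+ k) `^ (- (alpha / 2)) <= N `^ (- (alpha / 2)).
  apply: le_trans N8; rewrite powRM ?exprn_ge0//.
  by rewrite ler_wpM2r// powR_ge0.
have E8 : ((8 : R) ^+ k) `^ (- (alpha / 2)) = 2 `^ (e * k%:R) / 2 ^+ k.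
  have -> : (8 : R) ^+ k = 2 `^ (3 * k%:R).
    rewrite -natrM powR_mulrn// exprM; congr (_ ^+ _); ring.
  rewrite -powRrM -(@powR_mulrn _ 2 k)// -powRN -powRD.
    by congr (_ `^ _); rewrite /e; field.
  by rewrite pnatr_eq0 implybT.
have hk := hK k.
have k2 : 0 < (2 : R) ^+ k by rewrite exprn_gt0.
have h4 : L * k.+1%:R / 2 ^+ k <= L * K * ((8 ^+ k) `^ (- (alpha / 2))).
  rewrite E8 mulrA ler_wpM2r ?invr_ge0 ?(ltW k2)// -mulrA ler_wpM2l//.
have h5 : li * (4 * (L * k.+1%:R / 2 ^+ k)) <= li * (4 * (L * K * ((8 ^+ k) `^ (- (alpha / 2))))).
  by rewrite ler_wpM2l// ler_wpM2l.
apply: (le_trans h5).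
apply: (@le_trans _ _ (M * (2^-1 * (8 ^+ k) `^ (- (alpha / 2))))); last by rewrite ler_wpM2l.
have p0 : 0 <= ((8 : R) ^+ k) `^ (- (alpha / 2)) by exact: powR_ge0.
have := mulr_ge0 t2 p0; rewrite /M; set p := _ `^ _.
have -> : (4 * (li * (4 * (b - a))) + li * (4 * L) * K * 2) * (2^-1 * p) =
  (4 * (li * (4 * (b - a))) * p) / 2 + li * (4 * (L * K * p)) by field.
by lra.
Qed.

End fourier_dim_lower.

(** * Expected number of close pairs *)

Section potential.
Context (R : realType).
Variable (y : R).
Hypothesis y0 : 0 < y.

(** The summand k^(-1/2) 1(k < y); [sqrt_trunc], twice the square root stopped at
    y, is a discrete primitive of it. *)
Definition invsqrt_trunc (k : nat) : R :=
  if (0 < k)%N && (k%:R < y) then (Num.sqrt k%:R)^-1 else 0.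

Definition sqrt_trunc (k : nat) : R := 2 * Num.sqrt (Num.min k%:R y).

Lemma invsqrt_trunc_le k : invsqrt_trunc k <= sqrt_trunc k - sqrt_trunc k.-1.
Proof.
rewrite /invsqrt_trunc /sqrt_trunc; case: ifP => [/andP[k0 ky]|_]; last first.
  rewrite subr_ge0 ler_wpM2l// ler_wsqrtr// le_min ge_min.
  by rewrite ler_nat leq_pred/= ge_min lexx orbT.
case: k k0 ky => // k _ ky /=.
rewrite (min_l (ltW ky)) min_l; last first.
  by apply: le_trans (ltW ky); rewrite ler_nat.
set p := Num.sqrt k.+1%:R; set q := Num.sqrt k%:R.
have p0 : 0 < p by rewrite sqrtr_gt0 ltr0n.
have q0 : 0 <= q by rewrite sqrtr_ge0.
have p2 : p ^+ 2 = k.+1%:R by rewrite sqr_sqrtr.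
have q2 : q ^+ 2 = k%:R by rewrite sqr_sqrtr.
have pq : p ^+ 2 = q ^+ 2 + 1 by rewrite p2 q2 natr1.
have qp : q <= p by rewrite ler_wsqrtr// ler_nat.
rewrite -mulrBr -[leLHS]mul1r ler_pdivrMr//.
nra.
Qed.

Lemma sqrt_trunc_ge0 k : 0 <= sqrt_trunc k.
Proof. by rewrite mulr_ge0// sqrtr_ge0. Qed.

Lemma sqrt_trunc_le k : sqrt_trunc k <= 2 * Num.sqrt y.
Proof. by rewrite ler_wpM2l// ler_wsqrtr// ge_min lexx orbT. Qed.

Lemma sum_invsqrt_right i M : \sum_(j < M) invsqrt_trunc (j - i) <= sqrt_trunc (M.-1 - i).
Proof.
elim: M => [|M IH]; first by rewrite big_ord0 sqrt_trunc_ge0.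
rewrite big_ord_recr/=; have := invsqrt_trunc_le (M - i).
have -> : (M - i).-1 = (M.-1 - i)%N by case: M {IH} => [|M]; lia.
by move: IH; lra.
Qed.

Lemma sum_invsqrt_left i M : \sum_(j < M) invsqrt_trunc (i - j) <= sqrt_trunc i - sqrt_trunc (i - M).
Proof.
elim: M => [|M IH]; first by rewrite big_ord0 subn0 subrr.
rewrite big_ord_recr/=; have := invsqrt_trunc_le (i - M).
have -> : (i - M).-1 = (i - M.+1)%N by lia.
by move: IH; lra.
Qed.

Lemma sum_invsqrt_le i M :
  \sum_(j < M) (invsqrt_trunc (j - i) + invsqrt_trunc (i - j)) <= 4 * Num.sqrt y.
Proof.
rewrite big_split/=; have := sum_invsqrt_right i M; have := sum_invsqrt_left i M.
have := sqrt_trunc_ge0 (i - M); have := sqrt_trunc_le i; have := sqrt_trunc_le (M.-1 - i).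
lra.
Qed.

End potential.

Section return_time.
Context d (T : measurableType d) (R : realType) (P : probability T R).
Variables (X : R -> T -> R) (a b c C : R).
Hypothesis reg : regular_on P X a b c C.

Let ab := reg_ab reg.

Definition close_event (r : R) (s t : R) : set T :=
  [set w | `|s - t| < r /\ `|X s w - X t w| < r].

Definition close_count (r : R) (n : nat) (w : T) : R :=
  let h := mesh a b n in
  h * \sum_(i < n.+1) (h * \sum_(j < n.+1)
     \1_(close_event r (grid_pt a h i) (grid_pt a h j)) w).

Lemma measurable_close_event r s t : measurable (close_event r s t).
Proof.
have [st|st] := pselect (`|s - t| < r); last first.
  by rewrite (_ : close_event _ _ _ = set0)//; apply/seteqP; split => // w [].
have -> : close_event r s t = (fun w => X s w - X t w) @^-1` `]-r, r[%classic.
  apply/seteqP; split => w; rewrite /close_event /= in_itv /= -ltr_norml.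
    by move=> [].
  by move=> h; split.
by rewrite -[X in measurable X]setTI; apply: measurable_funB => //; exact: (reg_meas reg).
Qed.

Lemma measurable_close_count r n : measurable_fun setT (close_count r n).
Proof.
apply: measurable_funM => //; apply: measurable_sum => i.
apply: measurable_funM => //; apply: measurable_sum => j.
apply: measurable_indic; exact: measurable_close_event.
Qed.

Lemma close_event_prob r s t : 0 < r -> a <= s -> s < t -> t <= b ->
  (P (close_event r s t) <= (if t - s < r then r / Num.sqrt (c * (t - s)) else 0)%:E)%E.
Proof.
move=> r0 as_ st tb; case: ifPn => [str|]; last first.
  rewrite -leNgt => rts; have -> : close_event r s t = set0; last by rewrite measure0.
  apply/seteqP; split => // w [+ _].
  rewrite distrC ger0_norm; first by rewrite ltNge rts.
  by rewrite subr_ge0 ltW.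
have [sg [sg0 /andP[sgc _] law]] := reg_law reg as_ st tb.
have mD : measurable_fun setT (fun w => X t w - X s w).
  by apply: measurable_funB; exact: (reg_meas reg).
have cts : 0 < c * (t - s) by rewrite mulr_gt0 ?(reg_c0 reg)// subr_gt0.
apply: (@le_trans _ _ (r / sg)%:E).
  apply: le_trans (gaussian_small_ball sg0 law (ltW r0)).
  apply: le_measure; rewrite ?inE.
  - exact: measurable_close_event.
  - rewrite (_ : mkset _ = (fun w => X t w - X s w) @^-1` `]-r, r[%classic).
      by rewrite -[X in measurable X]setTI; exact: mD.
    by apply/seteqP; split => w /=; rewrite in_itv/= ltr_norml.
  - by move=> w [_]; rewrite distrC.
rewrite lee_fin ler_wpM2l ?(ltW r0)// lef_pV2 ?posrE// ?sqrtr_gt0//.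
by rewrite -[leRHS]ger0_norm ?(ltW sg0)// -sqrtr_sqr ler_wsqrtr.
Qed.

(** Grid points h (j - i) apart are close with probability at most
    r / sqrt (c h) times (j - i)^(-1/2), and never if h (j - i) >= r.  Of the
    two truncated terms one vanishes, by the truncated subtraction. *)
Lemma close_event_grid_prob r n h (i j : nat) : h = mesh a b n -> 0 < r ->
  (i <= n)%N -> (j <= n)%N ->
  (P (close_event r (grid_pt a h i) (grid_pt a h j)) <=
   ((i == j)%:R + r / Num.sqrt (c * h) *
     (invsqrt_trunc (r / h) (j - i) + invsqrt_trunc (r / h) (i - j)))%:E)%E.
Proof.
move=> hE r0 iN jN; have h0 : 0 < h by rewrite hE; exact: mesh_gt0.
have ch : 0 < c * h by rewrite mulr_gt0 ?(reg_c0 reg).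
have tb k : (k <= n)%N -> a <= grid_pt a h k <= b.
  move=> kn; have := grid_pt_le a h0 (leqW kn); rewrite {2}hE grid_pt_mesh => ->; rewrite andbT.
  by rewrite /grid_pt lerDl mulr_ge0// ltW.
have inv0 k : 0 <= invsqrt_trunc (r / h) k.
  by rewrite /invsqrt_trunc; case: ifP => // _; rewrite invr_ge0 sqrtr_ge0.
have rc0 : 0 <= r / Num.sqrt (c * h) by rewrite divr_ge0 ?sqrtr_ge0// ltW.
have sym : close_event r (grid_pt a h i) (grid_pt a h j) =
    close_event r (grid_pt a h j) (grid_pt a h i).
  by apply/seteqP; split => w [h1 h2]; split; rewrite distrC.
have main k l : (k < l)%N -> (l <= n)%N ->
  (P (close_event r (grid_pt a h k) (grid_pt a h l)) <=
     (r / Num.sqrt (c * h) * invsqrt_trunc (r / h) (l - k))%:E)%E.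
  move=> kl ln; have /andP[a1 _] := tb k (leq_trans (ltnW kl) ln); have /andP[_ b1] := tb l ln.
  have dl : grid_pt a h l - grid_pt a h k = (l - k)%:R * h.
    by rewrite /grid_pt natrB 1?ltnW//; ring.
  have lk : (0 < l - k)%N by rewrite subn_gt0.
  have lk0 : 0 < (l - k)%:R :> R by rewrite ltr0n.
  have gkl : grid_pt a h k < grid_pt a h l by rewrite -subr_gt0 dl mulr_gt0.
  apply: (le_trans (close_event_prob r0 a1 gkl b1)); rewrite dl lee_fin.
  rewrite /invsqrt_trunc lk/= ltr_pdivlMr//; case: ifP => _; last by rewrite mulr0.
  rewrite mulrCA (mulrC _ (c * h)) sqrtrM ?(ltW ch)// invfM.
  by rewrite mulrA.
have [ij|ij|ij] := ltngtP i j.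
- apply: (le_trans (main _ _ ij jN)); rewrite lee_fin add0r mulrDr lerDl.
  by rewrite mulr_ge0.
- rewrite sym; apply: (le_trans (main _ _ ij iN)); rewrite lee_fin add0r mulrDr lerDr.
  by rewrite mulr_ge0.
- apply: (le_trans (probability_le1 P _)); first exact: measurable_close_event.
  by rewrite lee_fin lerDl mulr_ge0// addr_ge0.
Qed.

(** The sum of k^(-1/2) over k < r / h is O(sqrt (r / h)), which gives
    r / sqrt h * sqrt (r / h) * h = r^(3/2).  The first summand, the mesh, comes
    from the diagonal. *)
Lemma expectation_close_count r n : 0 < r ->
  (\int[P]_w (close_count r n w)%:E <=
   (mesh a b n + 4 / Num.sqrt c * (r * Num.sqrt r))%:E)%E.
Proof.
move=> r0; set h := mesh a b n; have h0 : 0 < h by exact: mesh_gt0.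
have c0 := reg_c0 reg.
have m1 i j : measurable_fun setT (fun w => (\1_(close_event r (grid_pt a h i) (grid_pt a h j)) w)%:E : \bar R).
  by apply/measurable_EFinP; apply: measurable_indic; exact: measurable_close_event.
have E : (\int[P]_w (close_count r n w)%:E = h%:E * \sum_(i < n.+1) (h%:E * \sum_(j < n.+1)
     P (close_event r (grid_pt a h i) (grid_pt a h j))))%E.
  under eq_integral => w _.
    rewrite /close_count -/h EFinM -sumEFin; under eq_bigr do rewrite EFinM -sumEFin.
    over.
  have ms i : measurable_fun setT (fun w => (\sum_(j < n.+1)
      (\1_(close_event r (grid_pt a h i) (grid_pt a h j)) w)%:E)%E : \bar R).
    exact: emeasurable_sum.
  have s0 i w : (0 <= \sum_(j < n.+1)
      (\1_(close_event r (grid_pt a h i) (grid_pt a h j)) w)%:E :> \bar R)%E.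
    by apply: sume_ge0 => j _; rewrite lee_fin.
  rewrite ge0_integralZl_EFin//; last first.
  - exact: ltW.
  - by apply: emeasurable_sum => i; exact: emeasurable_funM.
  - by move=> w _; apply: sume_ge0 => i _; rewrite mule_ge0// lee_fin ltW.
  congr (_ * _)%E; rewrite ge0_integral_sum//; last first.
  - by move=> i w _; rewrite mule_ge0// lee_fin ltW.
  - by move=> i; exact: emeasurable_funM.
  apply: eq_bigr => i _; rewrite ge0_integralZl_EFin//; last exact: ltW.
  congr (_ * _)%E; rewrite ge0_integral_sum//.
  apply: eq_bigr => j _; rewrite integral_indic ?setIT//; exact: measurable_close_event.
rewrite {}E.
pose A i := \sum_(j < n.+1) ((i == j :> nat)%:R + r / Num.sqrt (c * h) *
     (invsqrt_trunc (r / h) (j - i) + invsqrt_trunc (r / h) (i - j))).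
have rh0 : 0 < r / h by rewrite divr_gt0.
have Ale (i : 'I_n.+1) : A i <= 1 + r / Num.sqrt (c * h) * (4 * Num.sqrt (r / h)).
  rewrite /A big_split/= -mulr_sumr; apply: lerD; last first.
    by apply: ler_wpM2l; [rewrite divr_ge0 ?sqrtr_ge0 ?(ltW r0)|exact: sum_invsqrt_le].
  rewrite (bigD1 i)//= eqxx big1 ?addr0// => j; rewrite eq_sym.
  by rewrite -(inj_eq val_inj)/= => /negbTE ->.
have Bnd : h * (1 + r / Num.sqrt (c * h) * (4 * Num.sqrt (r / h))) =
    h + 4 / Num.sqrt c * (r * Num.sqrt r).
  rewrite (sqrtrM _ (ltW c0)) (sqrtrM _ (ltW r0)) sqrtrV ?(ltW h0)//.
  have sh : Num.sqrt h * Num.sqrt h = h by rewrite -expr2 sqr_sqrtr// ltW.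
  have sh0 : Num.sqrt h != 0 by rewrite gt_eqF// sqrtr_gt0.
  have sc0 : Num.sqrt c != 0 by rewrite gt_eqF// sqrtr_gt0.
  have key (y z x q : R) : y != 0 -> z != 0 ->
      y * y * (1 + q / (z * y) * (4 * (x * y^-1))) = y * y + 4 / z * (q * x).
    by move=> y0 z0; field; rewrite y0 z0.
  by have := key _ _ (Num.sqrt r) r sh0 sc0; rewrite sh.
apply: (@le_trans _ _ (h%:E * \sum_(i < n.+1) (h * (1 + r / Num.sqrt (c * h) * (4 * Num.sqrt (r / h))))%:E)%E).
  rewrite lee_wpmul2l// ?lee_fin ?(ltW h0)//.
  apply: lee_sum => i _; rewrite [leRHS]EFinM; apply: lee_wpmul2l; first by rewrite lee_fin ltW.
  apply: le_trans (_ : ((A i)%:E <= _)%E); last by rewrite lee_fin Ale.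
  rewrite /A -sumEFin; apply: lee_sum => j _.
  by apply: close_event_grid_prob => //; rewrite -ltnS ltn_ord.
rewrite sumEFin sumr_const card_ord -EFinM lee_fin Bnd.
have hn (B : R) : h * (B *+ n.+1) = B * (b - a).
  by rewrite -mulr_natr mulrCA /h /mesh divfK.
rewrite hn.
rewrite ler_piMr//; last exact: reg_len reg.
have rs : 0 <= r * Num.sqrt r by rewrite mulr_ge0 ?sqrtr_ge0// ltW.
have cs : 0 <= 4 / Num.sqrt c by rewrite divr_ge0 ?sqrtr_ge0.
by apply: addr_ge0; [exact: ltW|exact: mulr_ge0].
Qed.

End return_time.

(** * Occupation measure of small balls *)

Section small_ball.
Context d (T : measurableType d) (R : realType) (P : probability T R).
Local Notation mu := (@lebesgue_measure R).
Variables (X : R -> T -> R) (a b c C : R).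
Hypothesis reg : regular_on P X a b c C.

Let ab := reg_ab reg.

Section radius.
Variables (r : R) (m0 : nat).
Hypothesis r0 : 0 < r.

Local Notation h j := (mesh a b (m0 + j)).

Definition occupation (j : nat) (w : T) (s : R) : R :=
  h j * \sum_(i < (m0 + j).+1) \1_(close_event X r s (grid_pt a (h j) i)) w.

(** On continuous paths this bounds the measure of a ball around (t, X t), which
    itself need not depend measurably on w where the path is discontinuous.
    The offset m0 makes the mesh small against r. *)
Definition occupation_density (w : T) (t : R) : \bar R :=
  limn_einf (fun j => (occupation j w (grid_floor a (h j) t))%:E).

Definition return_energy (w : T) : \bar R :=
  limn_einf (fun j => (close_count X a b r (m0 + j) w)%:E).

Lemma occupation_ge0 j w s : 0 <= occupation j w s.
Proof.
by apply: mulr_ge0; [rewrite ltW// mesh_gt0|apply: sumr_ge0].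
Qed.

Lemma measurable_floor_itv (G : R -> R) j :
  measurable_fun `[a, b[%classic (G \o grid_floor a (h j)).
Proof.
by have := @measurable_grid_floor _ a _ (mesh_gt0 ab (m0 + j)) G (m0 + j).+1; rewrite grid_pt_mesh.
Qed.

Lemma measurable_occupation_density w :
  measurable_fun `[a, b[%classic (occupation_density w).
Proof.
rewrite /occupation_density /limn_einf; apply: measurableT_comp => //.
apply: (@measurable_fun_limn_esup _ _ _ _ (fun j t => - (occupation j w (grid_floor a (h j) t))%:E)%E).
move=> j; apply: measurableT_comp => //; apply/measurable_EFinP.
exact: measurable_floor_itv.
Qed.

Lemma occupation_density_ge0 w t : (0 <= occupation_density w t)%E.
Proof. by apply: limn_einf_ge0 => j; rewrite lee_fin occupation_ge0. Qed.

Lemma measurable_return_energy : measurable_fun setT return_energy.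
Proof.
apply: measurable_limn_einf => j; apply/measurable_EFinP.
exact: (measurable_close_count reg).
Qed.

Lemma return_energy_ge0 w : (0 <= return_energy w)%E.
Proof.
apply: limn_einf_ge0 => j; rewrite lee_fin /close_count.
have h0 := mesh_gt0 ab (m0 + j).
by apply: mulr_ge0; [exact: ltW|apply: sumr_ge0 => i _; apply: mulr_ge0;
  [exact: ltW|apply: sumr_ge0]].
Qed.

Lemma integral_occupation_density w :
  (\int[mu]_(t in `[a, b[) occupation_density w t <= return_energy w)%E.
Proof.
rewrite /return_energy.
have -> : (fun j => (close_count X a b r (m0 + j) w)%:E) =
    (fun j => \int[mu]_(t in `[a, b[) (occupation j w (grid_floor a (h j) t))%:E)%E.
  apply/funext => j; rewrite -[X in `[a, X[](grid_pt_mesh a b (m0 + j)).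
  by rewrite (grid_integral a (mesh_gt0 ab (m0 + j)))// => s; exact: occupation_ge0.
apply: fatou => //.
  by move=> j; apply/measurable_EFinP; exact: measurable_floor_itv.
by move=> j t _; rewrite lee_fin occupation_ge0.
Qed.

Definition graph_ball (w : T) (t : R) : set R :=
  `[a, b[%classic `&` [set u | `|t - u| < r /\ `|X t w - X u w| < r].

Lemma path_floor_cvg w t : path_continuous X a b w -> t \in `[a, b[ ->
  X (grid_floor a (h j) t) w @[j --> \oo] --> X t w.
Proof.
move=> cw; rewrite in_itv/= => /andP[at_ tb].
have tab : a <= t < b by rewrite at_.
have shift : (m0 + j)%N @[j --> \oo] --> \oo.
  by move=> A [N _ NA]; exists N => // j /= Nj; apply: NA => /=; rewrite (leq_trans Nj)// leq_addl.
have cf : grid_floor a (h j) t @[j --> \oo] --> t.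
  exact: (cvg_comp _ _ shift (grid_floor_cvg ab tab)).
have cX := continuous_clamp_comp (ltW ab) (@subset_refl _ _) cw.
have := cvg_comp _ _ cf (cX t); rewrite /= clamp_id ?at_ ?(ltW tb)// => hc.
suff -> : (fun j => X (grid_floor a (h j) t) w) = (fun j => X (clamp a b (grid_floor a (h j) t)) w) by exact: hc.
apply/funext => j; rewrite clamp_id//.
have := @grid_floor_near _ a _ (mesh_gt0 ab (m0 + j)) (m0 + j).+1 t.
rewrite grid_pt_mesh => /(_ tab)[-> h2 _] /=; exact: le_trans (ltW tb).
Qed.

Lemma measurable_graph_ball w t : path_continuous X a b w ->
  measurable (graph_ball w t).
Proof.
move=> cw; have cX := continuous_clamp_comp (ltW ab) (@subset_refl _ _) cw.
have -> : graph_ball w t = `[a, b[%classic `&`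
   (((fun u => t - u) @^-1` `]-r, r[%classic) `&`
   ((fun u => X t w - X (clamp a b u) w) @^-1` `]-r, r[%classic)).
  apply/seteqP; split => u [] uab [] h1 h2; split=> //; split.
  - by rewrite /= in_itv/= -ltr_norml.
  - move: uab; rewrite /= !in_itv/= => /andP[h3 h4].
    by rewrite clamp_id ?h3 ?(ltW h4)// -ltr_norml.
  - by move: h1; rewrite /= in_itv/= -ltr_norml.
  - move: uab h2; rewrite /= !in_itv/= => /andP[h3 h4].
    by rewrite clamp_id ?h3 ?(ltW h4)// -ltr_norml.
apply: measurableI => //; apply: measurableI; rewrite -[X in measurable X]setTI.
  exact: measurable_funB.
by apply: measurable_funB => //; exact: (continuous_measurable_fun cX).
Qed.

(** The strict inequalities that define the ball persist at nearby grid points,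
    so its indicator is at most the lower limit of the discrete ones; Fatou's
    lemma concludes. *)
Lemma graph_ball_le w t : path_continuous X a b w -> t \in `[a, b[ ->
  (mu (graph_ball w t) <= occupation_density w t)%E.
Proof.
move=> cw tab.
pose G j (u : R) : R := \1_(close_event X r (grid_floor a (h j) t) (grid_floor a (h j) u)) w.
have mG j : measurable_fun `[a, b[%classic (fun u => (G j u)%:E).
  apply/measurable_EFinP.
  exact: (measurable_floor_itv (fun s => \1_(close_event X r (grid_floor a (h j) t) s) w)).
have -> : occupation_density w t = limn_einf (fun j => \int[mu]_(u in `[a, b[) (G j u)%:E)%E.
  rewrite /occupation_density; congr limn_einf; apply/funext => j.
  rewrite /occupation -[X in `[a, X[](grid_pt_mesh a b (m0 + j)).
  by rewrite (grid_integral a (mesh_gt0 ab (m0 + j))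
    (G := fun s => \1_(close_event X r (grid_floor a (h j) t) s) w)).
apply: (@le_trans _ _ (\int[mu]_(u in `[a, b[) limn_einf (fun j => (G j u)%:E))%E); last first.
  by apply: fatou => // j u _; rewrite lee_fin.
have mB := measurable_graph_ball t cw.
have -> : mu (graph_ball w t) = (\int[mu]_(u in `[a, b[) (\1_(graph_ball w t) u)%:E)%E.
  by rewrite integral_indic// setIidl// => u [].
apply: ge0_le_integral => //.
- by apply/measurable_EFinP; exact: measurable_indic.
- rewrite /limn_einf; apply: measurableT_comp => //.
  apply: (@measurable_fun_limn_esup _ _ _ _ (fun j u => - (G j u)%:E)%E).
  by move=> j; apply: measurableT_comp => //.
move=> u uab; rewrite indicE; case: (boolP (u \in graph_ball w t)); last first.
  by move=> _; apply: limn_einf_ge0 => j; rewrite lee_fin.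
rewrite inE => -[_ /= [h1 h2]].
have cvg1 : (G j u)%:E @[j --> \oo] --> (1 : R)%:E.
  apply: cvg_near_cst.
  have tab' : a <= t < b by move: tab; rewrite in_itv.
  have uab' : a <= u < b by move: uab; rewrite /= in_itv.
  have shift : (m0 + j)%N @[j --> \oo] --> \oo.
    by move=> A [N _ NA]; exists N => // j /= Nj; apply: NA => /=; rewrite (leq_trans Nj)// leq_addl.
  have ct := cvg_comp _ _ shift (grid_floor_cvg ab tab').
  have cu := cvg_comp _ _ shift (grid_floor_cvg ab uab').
  have d1 := cvg_norm (cvgB ct cu).
  have d2 := cvg_norm (cvgB (path_floor_cvg cw tab) (path_floor_cvg cw uab)).
  have n1 : \forall j \near \oo,
      `|grid_floor a (h j) t - grid_floor a (h j) u| < r.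
    exact: (cvgr_lt _ (d1 _ _) _ h1).
  have n2 : \forall j \near \oo,
      `|X (grid_floor a (h j) t) w - X (grid_floor a (h j) u) w| < r.
    exact: (cvgr_lt _ (d2 _ _) _ h2).
  near=> j; apply/esym; rewrite /G indicE mem_set//; split => /=; by near: j.
by rewrite (cvg_limn_einf_sup cvg1).1.
Unshelve. all: by end_near. Qed.

End radius.
End small_ball.

(** * Times with small occupation *)

Section positive_set.
Context d (T : measurableType d) (R : realType) (P : probability T R).
Local Notation mu := (@lebesgue_measure R).
Variables (X : R -> T -> R) (a b c C : R).
Hypothesis reg : regular_on P X a b c C.

Let ab := reg_ab reg.

Lemma expectation_return_energy (r : R) : 0 < r -> exists m0,
  (\int[P]_w return_energy X a b r m0 w <= ((1 + 4 / Num.sqrt c) * (r * Num.sqrt r))%:E)%E.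
Proof.
move=> r0; have rs0 : 0 < r * Num.sqrt r by rewrite mulr_gt0// sqrtr_gt0.
have [m0 _ hm] := @mesh_small _ a b _ rs0; exists m0.
apply: expectation_limn_einf_le.
- by move=> j; apply/measurable_EFinP; exact: (measurable_close_count reg).
- move=> j w; rewrite lee_fin /close_count; have h0 := mesh_gt0 ab (m0 + j).
  by apply: mulr_ge0; [exact: ltW|apply: sumr_ge0 => i _; apply: mulr_ge0;
    [exact: ltW|apply: sumr_ge0]].
- move=> j; apply: (le_trans (expectation_close_count reg (m0 + j) r0)).
  rewrite lee_fin [leRHS]mulrDl mul1r; apply: lerD => //.
  by apply: ltW; apply: hm => /=; exact: leq_addr.
Qed.

(** A large ratio 4^p between successive radii makes the factors 2^n that the
    almost sure bounds cost negligible: 2^n is a power 1/p of the scale, up to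
    constants. *)
Definition radius (p n : nat) : R := (4 ^+ (p * n))^-1.

Lemma radius_gt0 p n : 0 < radius p n.
Proof. by rewrite invr_gt0 exprn_gt0. Qed.

Lemma radius_mul_sqrt p n : radius p n * Num.sqrt (radius p n) = (8 ^+ (p * n))^-1.
Proof.
have -> : radius p n = ((2 ^+ (p * n))^-1) ^+ 2.
  by rewrite /radius exprVn exprAC; congr ((_ ^+ _)^-1); ring.
rewrite sqrtr_sqr ger0_norm ?invr_ge0 ?exprn_ge0//.
by rewrite -exprSr exprVn exprAC; congr ((_ ^+ _)^-1); ring.
Qed.

Lemma ae_return_energy (p : nat) : exists m : nat -> nat,
  {ae P, forall w, exists2 K : R, 0 <= K &
    forall n, ((8 ^+ (p * n))%:E * return_energy X a b (radius p n) (m n) w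
      <= (K * 2 ^+ n.+1)%:E)%E}.
Proof.
have [m hm] := choice (fun n => expectation_return_energy (radius_gt0 p n)).
exists m; apply: (@ae_bounded_of_expectation _ _ _ P
  (fun n w => (8 ^+ (p * n))%:E * return_energy X a b (radius p n) (m n) w)%E (1 + 4 / Num.sqrt c)).
- by move=> n; apply: emeasurable_funM => //; exact: (measurable_return_energy reg).
- by move=> n w; rewrite mule_ge0 ?lee_fin ?exprn_ge0//; exact: (return_energy_ge0 reg).
- move=> n; rewrite ge0_integralZl_EFin; [|by []|by move=> w _; exact: (return_energy_ge0 reg)
    |exact: (measurable_return_energy reg)|by rewrite exprn_ge0].
  have h8 : 0 < (8 : R) ^+ (p * n) by rewrite exprn_gt0.
  apply: (@le_trans _ _ ((8 ^+ (p * n))%:E * ((1 + 4 / Num.sqrt c) * (8 ^+ (p * n))^-1)%:E)%E).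
    by apply: lee_wpmul2l; [rewrite lee_fin ltW|rewrite -radius_mul_sqrt; exact: hm].
  by rewrite -EFinM lee_fin mulrCA divff ?mulr1// gt_eqF.
Qed.

(** The return energy is the integral over t of the occupation density, so the
    almost sure bound applies a second time, now to the uniform law of t.  If
    each set of times with a fixed constant were null, so would be their
    union, which is almost everything. *)
Lemma positive_occupation_set p (m : nat -> nat) w (K : R) : 0 <= K ->
  (forall n, ((8 ^+ (p * n))%:E * return_energy X a b (radius p n) (m n) w
      <= (K * 2 ^+ n.+1)%:E)%E) ->
  exists A : set R, exists M : R,
    [/\ measurable A, A `<=` `[a, b[%classic, (0 < mu A)%E, 0 <= M &
      forall t n, A t -> (occupation_density X a b (radius p n) (m n) w t
        <= (M * 4 ^+ n / 8 ^+ (p * n))%:E)%E].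
Proof.
move=> K0 hK.
pose D n := occupation_density X a b (radius p n) (m n) w.
pose cf n : R := (2 ^+ n.+1)^-1 * 8 ^+ (p * n).
have cf0 n : 0 < cf n by rewrite mulr_gt0 ?invr_gt0 ?exprn_gt0.
pose g n := (fun t => (cf n)%:E * D n t)%E \_ `[a, b[%classic.
have D0 n t : (0 <= D n t)%E by exact: (occupation_density_ge0 reg).
have mD n : measurable_fun `[a, b[%classic (D n).
  exact: (measurable_occupation_density reg).
have mcD n : measurable_fun `[a, b[%classic (fun t => (cf n)%:E * D n t)%E.
  exact: emeasurable_funM.
have g0 n t : (0 <= g n t)%E.
  by rewrite /g patchE; case: ifP => // _; rewrite mule_ge0// lee_fin ltW.
have mg n : measurable_fun setT (g n).
  by apply/(measurable_restrictT _ _).1 => //.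
have li : 0 < (b - a)^-1 by rewrite invr_gt0 subr_gt0.
have gK n : (\int[uniform_prob ab]_t g n t <= ((b - a)^-1 * K)%:E)%E.
  rewrite (integral_uniform ab (mg n) (g0 n)) EFinM lee_wpmul2l ?lee_fin ?(ltW li)//.
  rewrite -integral_itv_bndo_bndc; last exact: measurable_funTS.
  rewrite /g -integral_mkcondr setIid.
  rewrite ge0_integralZl_EFin; [|by []|by move=> t _; exact: D0|exact: mD|exact: ltW].
  apply: (@le_trans _ _ ((cf n)%:E * return_energy X a b (radius p n) (m n) w)%E).
    by apply: lee_wpmul2l; [rewrite lee_fin ltW|exact: (integral_occupation_density reg)].
  have -> : K%:E = ((2 ^+ n.+1)^-1%:E * (K * 2 ^+ n.+1)%:E)%E.
    by rewrite -EFinM mulrCA mulVf ?mulr1// expf_neq0.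
  by rewrite /cf EFinM -muleA lee_wpmul2l// lee_fin invr_ge0 exprn_ge0.
have aeb := ae_bounded_of_expectation (P := uniform_prob ab) mg g0 gK.
pose A (j : nat) := `[a, b[%classic `&` \bigcap_n [set t | (g n t <= (j%:R * 2 ^+ n.+1)%:E)%E].
have mA j : measurable (A j).
  apply: measurableI => //; apply: bigcapT_measurable => n.
  have -> : [set t | (g n t <= (j%:R * 2 ^+ n.+1)%:E)%E] =
    [set: measurableTypeR R] `&` (g n @^-1` [set y | (y <= (j%:R * 2 ^+ n.+1)%:E)%E]).
    by rewrite setTI.
  exact: emeasurable_fun_infty_c.
have [j Aj] : exists j, (0 < mu (A j))%E.
  apply: contrapT => /forallNP nA.
  have A0 j : uniform_prob ab (A j) = 0%E.
    have : mu (A j) = 0%E.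
      by apply/eqP; rewrite eq_le measure_ge0 andbT leNgt; apply/negP; exact: nA.
    move=> h; exact: ((null_content_dominatesP _ _).1 (dominates_uniform_prob ab) (A j) (mA j) h).
  have negA : (uniform_prob ab).-negligible (\bigcup_j A j).
    apply: negligible_bigcup => j; exists (A j); split; [exact: mA|exact: A0|by []].
  have neg0 : (uniform_prob ab).-negligible (~` `[a, b[%classic).
    exists (~` `[a, b[%classic); split => //; first exact: measurableC.
    rewrite /uniform_prob integral_uniform_pdf.
    have -> : ~` `[a, b[%classic `&` `[a, b]%classic = [set b].
      apply/seteqP; split => t /=; rewrite !in_itv/=.
        by move=> [/negP]; rewrite negb_and -!ltNge -leNgt => /orP[]; move=> h1 /andP[h2 h3];
          [move: h1; rewrite ltNge h2|apply/eqP; rewrite eq_le h3].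
      by move=> ->; rewrite lexx ltxx (ltW ab) andbF; split.
    by rewrite integral_set1.
  have : (uniform_prob ab).-negligible [set: measurableTypeR R].
    have := negligibleU (negligibleU negA neg0) aeb.
    apply: negligibleS => t _.
    have [tab|] := pselect (`[a, b[%classic t); last by left; right.
    have [[K' K'0 hK']|nK] := pselect (exists2 K0 : R, 0 <= K0 &
      forall k, (g k t <= (K0 * 2 ^+ k.+1)%:E)%E); last by right.
    left; left; exists (Num.truncn K').+1 => //; split => // n _ /=.
    apply: (le_trans (hK' n)); rewrite lee_fin ler_wpM2r ?exprn_ge0//.
    exact: ltW (truncnS_gt K').
  move=> [B [mB B0 BT]].
  have BE : B = setT by apply/seteqP; split => // t _; exact: BT.
  have : uniform_prob ab setT = 1%E := probability_setT _.
  by rewrite -BE B0 => /eqP; rewrite eq_sym onee_eq0.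
exists (A j), (4 * j%:R); split => //.
- by move=> t [].
move=> t n [tab /(_ n I)] /=.
rewrite /g patchE mem_set// => h; rewrite -/(D n t).
have -> : D n t = ((cf n)^-1%:E * ((cf n)%:E * D n t))%E.
  by rewrite muleA -EFinM mulVf ?gt_eqF// mul1e.
apply: (@le_trans _ _ ((cf n)^-1%:E * (j%:R * 2 ^+ n.+1)%:E)%E).
  by apply: lee_wpmul2l => //; rewrite lee_fin invr_ge0 ltW.
rewrite -EFinM lee_fin /cf invfM invrK.
have -> : (4 : R) ^+ n = 2 ^+ n * 2 ^+ n by rewrite -exprMn; congr (_ ^+ _); ring.
rewrite exprS le_eqVlt; apply/orP; left; apply/eqP.
generalize ((8 : R) ^+ (p * n))^-1 => z; ring.
Qed.

End positive_set.

(** * Mass distribution principle *)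

Section mass_distribution.
Context (R : realType).
Local Notation mu := (@lebesgue_measure R).

Lemma diam2_ge0 (U : set (R * R)) : (0 <= diam2 U)%E.
Proof. by apply: ereal_sup_ubound; left. Qed.

Lemma diam2_pow_ge0 (s : R) (U : set (R * R)) : (0 <= diam2_pow s U)%E.
Proof. by rewrite /diam2_pow; case: ifP => // _; exact: poweR_ge0. Qed.

Lemma hausdorff_measure_ge0 (s : R) (E : set (R * R)) : (0 <= hausdorff_measure s E)%E.
Proof.
apply: (@le_trans _ _ (hausdorff_premeasure s 1 E)).
  by apply: le_ereal_inf_tmp => _ [U _ <-]; apply: nneseries_ge0 => i _ _; exact: diam2_pow_ge0.
by apply: ereal_sup_ubound; exists 1 => /=.
Qed.

Definition near_graph (f : R -> R) (A : set R) (r t : R) : set R :=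
  A `&` [set u | `|t - u| <= r /\ `|f t - f u| <= r].

(** Each covering set that meets the graph over A is contained in a ball around
    one of its points, of radius its diameter; subadditivity of the measure
    sums up.  Diameter 0 is separate, as 0 `^ 0 = 1: there the set of times is
    a point, of measure 0. *)
Lemma mass_distribution (f : R -> R) (J A : set R) (s K : R) :
  measurable A -> A `<=` J -> 0 < K ->
  (forall t r, A t -> 0 < r -> r < 1 -> exists B : set R,
    [/\ measurable B, near_graph f A r t `<=` B & (mu B <= (K * r `^ s)%:E)%E]) ->
  ((K^-1)%:E * mu A <= hausdorff_measure s (graph f J))%E.
Proof.
move=> mA AJ K0 hB.
apply: (@le_trans _ _ (hausdorff_premeasure s 2^-1 (graph f J))); last first.
  by apply: ereal_sup_ubound; exists 2^-1 => //=; rewrite invr_gt0.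
apply: le_ereal_inf_tmp => _ [U [cov diamU] <-].
have cell i : exists B : set R, [/\ measurable B,
    A `&` [set t | U i (t, f t)] `<=` B & (mu B <= K%:E * diam2_pow s (U i))%E].
  have [[t [tA tU]]|none] := pselect (exists t, A t /\ U i (t, f t)); last first.
    exists set0; split => //; last by rewrite measure0 mule_ge0 ?diam2_pow_ge0// lee_fin ltW.
    by move=> t [tA tU]; apply: none; exists t.
  have dfin : diam2 (U i) \is a fin_num.
    rewrite fin_numE; apply/andP; split; apply/eqP => h.
      by have := diam2_ge0 (U i); rewrite h.
    by have := diamU i; rewrite h.
  pose r := fine (diam2 (U i)); have rE : diam2 (U i) = r%:E by rewrite fineK.
  have r0 : 0 <= r by rewrite fine_ge0// diam2_ge0.
  have r1 : r < 1 by have := diamU i; rewrite rE lee_fin => h; lra.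
  have powE : diam2_pow s (U i) = (r `^ s)%:E.
    rewrite /diam2_pow; case: ifPn => [/eqP U0|_]; first by move: tU; rewrite U0.
    by rewrite rE poweR_EFin.
  have close u : U i (u, f u) -> `|t - u| <= r /\ `|f t - f u| <= r.
    move=> uU; have : ((norm2 ((t, f t) - (u, f u)))%:E <= diam2 (U i))%E.
      by apply: ereal_sup_ubound; right; exists (t, f t), (u, f u); split.
    rewrite rE lee_fin => h; have [h1 h2] := normr_le_norm2 ((t, f t) - (u, f u)).
    by split; [exact: le_trans h1 h|exact: le_trans h2 h].
  have [r00|rn0] := eqVneq r 0.
    exists [set t]; split => //.
      move=> u [uA /= uU]; have [] := close _ uU.
      by rewrite r00 normr_le0 subr_eq0 => /eqP.
    by rewrite lebesgue_measure_set1 mule_ge0 ?diam2_pow_ge0// lee_fin ltW.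
  have rp : 0 < r by rewrite lt_neqAle eq_sym rn0.
  have [B [mB sB leB]] := hB t r tA rp r1; exists B; split => //.
    by move=> u [uA /= uU]; apply: sB; split => //; exact: close.
  by rewrite powE -EFinM.
have [Bs hBs] := choice cell.
have mBs i : measurable (Bs i) by have [] := hBs i.
have AB : A `<=` \bigcup_i Bs i.
  move=> t tA; have [i _ Ui] : (\bigcup_i U i) (t, f t).
    by apply: cov; exists t => //; exact: AJ.
  by exists i => //; have [_ h _] := hBs i; apply: h.
rewrite lee_pdivrMl//.
apply: (@le_trans _ _ (\sum_(0 <= i <oo) mu (Bs i))%E).
  apply: (@le_trans _ _ (mu (\bigcup_i Bs i))).
    by apply: le_measure => //; rewrite inE//; exact: bigcupT_measurable.
  by apply: le_mu_bigcup => //; exact: bigcupT_measurable.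
rewrite -nneseriesZl; last by move=> i _; exact: diam2_pow_ge0.
by apply: lee_nneseries => // i _; have [] := hBs i.
Qed.

Lemma radius_exists (D r : R) : 1 < D -> 0 < r -> r < 1 ->
  exists n, (D ^+ n.+1)^-1 <= r < (D ^+ n)^-1.
Proof.
move=> D1 r0 r1; have D0 : 0 < D by lra.
have ex : exists n, (D ^+ n)^-1 <= r.
  have : (D^-1) ^+ n @[n --> \oo] --> 0.
    apply: cvg_expr; rewrite ger0_norm ?invr_ge0 ?(ltW D0)//.
    by rewrite invf_lt1.
  move=> /cvgr0_norm_lt /(_ r r0) [N _ /(_ N (leqnn N)) /= h]; exists N.
  by rewrite -exprVn; apply: le_trans (ltW h); exact: ler_norm.
case: (ex_minnP ex) => n hn nmin; case: n hn nmin => [|n] hn nmin.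
  by move: hn; rewrite expr0 invr1 leNgt r1.
exists n; rewrite hn/= ltNge; apply/negP => /nmin; by rewrite ltnn.
Qed.

(** With D = 4^p, the bound 4^n / 8^(p n) is D^-n to the power 3/2 - 1/p; passing
    from the radii D^-n to all radii costs a factor D^s. *)
Lemma hausdorff_measure_gt0 (f : R -> R) (J A : set R) (p : nat) (M s : R)
    (G : nat -> R -> set R) :
  (0 < p)%N -> measurable A -> A `<=` J -> (0 < mu A)%E -> 0 <= M ->
  0 <= s -> s <= 3 / 2 - p%:R^-1 ->
  (forall n t, A t -> measurable (G n t)) ->
  (forall n t u, A t -> A u -> `|t - u| < (4 ^+ (p * n))^-1 ->
     `|f t - f u| < (4 ^+ (p * n))^-1 -> G n t u) ->
  (forall n t, A t -> (mu (G n t) <= (M * 4 ^+ n / 8 ^+ (p * n))%:E)%E) ->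
  (0 < hausdorff_measure s (graph f J))%E.
Proof.
move=> p0 mA AJ A0 M0 s0 sp mG subG leG.
pose D : R := 4 `^ p%:R.
have DE n : (4 : R) ^+ (p * n) = D ^+ n by rewrite /D powR_mulrn// exprM.
have D1 : 1 < D.
  rewrite /D powR_mulrn// -(prednK p0) exprS.
  have h : 1 <= (4 : R) ^+ p.-1 by apply: exprn_ege1; lra.
  by lra.
have D0 : 0 < D by lra.
pose K := (M + 1) * D `^ s.
have K0 : 0 < K by rewrite mulr_gt0 ?powR_gt0//; lra.
apply: (@lt_le_trans _ _ ((K^-1)%:E * mu A)%E).
  by rewrite mule_gt0// lte_fin invr_gt0.
apply: mass_distribution => // t r At r0 r1.
have [n /andP[nr rn]] := radius_exists D1 r0 r1.
exists (G n t); split; first exact: mG.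
  move=> u [Au [h1 h2]]; apply: subG => //; rewrite DE; exact: le_lt_trans rn.
apply: (le_trans (leG n t At)); rewrite lee_fin.
have E : M * 4 ^+ n / 8 ^+ (p * n) = M * (D ^+ n)^-1 `^ (3 / 2 - p%:R^-1).
  rewrite -mulrA; congr (M * _).
  have e2 k : (2 : R) `^ k%:R = 2 ^+ k by rewrite powR_mulrn.
  have -> : (4 : R) ^+ n = 2 `^ (2 * n%:R).
    by rewrite -natrM e2 exprM; congr (_ ^+ _); ring.
  have -> : ((8 : R) ^+ (p * n))^-1 = 2 `^ (- (3 * (p%:R * n%:R))).
    by rewrite powRN -!natrM e2 [in RHS]exprM; congr ((_ ^+ _)^-1); ring.
  have -> : (D ^+ n)^-1 = 2 `^ (- (2 * (p%:R * n%:R))).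
    by rewrite powRN -!natrM e2 [in RHS]exprM -DE; congr ((_ ^+ _)^-1); ring.
  rewrite -powRrM -powRD; last by rewrite implybE pnatr_eq0 orbT.
  congr (_ `^ _); field; rewrite pnatr_eq0 -lt0n//.
rewrite E /K -mulrA -powRM ?(ltW D0)//; last exact: ltW.
apply: (@le_trans _ _ (M * (D * r) `^ s)); last first.
  by apply: ler_wpM2r; [exact: powR_ge0|lra].
apply: ler_wpM2l => //.
have x0 : 0 < (D ^+ n)^-1 by rewrite invr_gt0 exprn_gt0.
have x1 : (D ^+ n)^-1 <= 1 by rewrite invf_le1 ?exprn_gt0// exprn_ege1// ltW.
apply: (@le_trans _ _ ((D ^+ n)^-1 `^ s)).
  by apply: ger_powR => //; rewrite x0.
apply: ge0_ler_powR => //; rewrite ?nnegrE ?(ltW x0)// ?mulr_ge0 ?(ltW r0) ?(ltW D0)//.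
have -> : (D ^+ n)^-1 = D * (D ^+ n.+1)^-1.
  by rewrite exprS invfM mulrA divff ?mul1r// gt_eqF.
by apply: ler_wpM2l => //; exact: ltW.
Qed.

Lemma hausdorff_dim_ge (E : set (R * R)) (r : R) :
  (forall s, 0 <= s -> s < r -> (0 < hausdorff_measure s E)%E) ->
  (r%:E <= hausdorff_dim E)%E.
Proof.
move=> h; apply: le_ereal_inf_tmp => _ [s [s0 Hs] <-]; rewrite lee_fin leNgt.
by apply/negP => /(h _ s0); rewrite Hs ltxx.
Qed.

End mass_distribution.

Section dim_lower.
Context d (T : measurableType d) (R : realType) (P : probability T R).
Variables (X : R -> T -> R) (a b c C : R).
Hypothesis reg : regular_on P X a b c C.

Lemma ae_hausdorff_dim_ge (J : set R) : `[a, b]%classic `<=` J ->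
  {ae P, forall w, path_continuous X a b w ->
    ((3 / 2)%:E <= hausdorff_dim (graph (fun t => X t w) J))%E}.
Proof.
move=> abJ.
have [m hm] := choice (ae_return_energy reg).
have : {ae P, forall w, forall p, exists2 K : R, 0 <= K &
    forall n, ((8 ^+ (p * n))%:E * return_energy X a b (radius R p n) (m p n) w
      <= (K * 2 ^+ n.+1)%:E)%E} by apply: ae_foralln.
apply: filterS => w hw cw.
apply: hausdorff_dim_ge => s s0 s32.
have [p p0 sp] : exists2 p, (0 < p)%N & s <= 3 / 2 - p%:R^-1.
  have e0 : 0 < 3 / 2 - s by lra.
  exists (Num.truncn (3 / 2 - s)^-1).+1 => //.
  have h : ((Num.truncn (3 / 2 - s)^-1).+1%:R)^-1 <= 3 / 2 - s.
    by rewrite invf_ple ?posrE ?ltr0n// ltW// truncnS_gt.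
  by rewrite lerBrDr addrC -lerBrDr.
have [K K0 hK] := hw p.
have [A [M [mA Aab A0 M0 hA]]] := positive_occupation_set reg K0 hK.
have itv t : A t -> t \in `[a, b[ by move=> /Aab.
apply: (@hausdorff_measure_gt0 _ _ _ A p M _ (fun n t => graph_ball X a b (radius R p n) w t)) => //.
- move=> t /Aab tab; apply: abJ; move: tab; rewrite /= !in_itv/= => /andP[-> /ltW ->//].
- by move=> n t At; exact: (measurable_graph_ball reg).
- by move=> n t u At Au h1 h2; split; [exact: Aab|].
- move=> n t At; apply: le_trans (hA t n At).
  by apply: (graph_ball_le reg) => //; exact: itv.
Qed.

End dim_lower.

(** * Finite coverings *)

Section coverable.
Context (R : realType).
Implicit Types (E F U : set (R * R)) (r s : R).

(** At most n sets of diameter at most r cover E; sets of equal size keep the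
    Hausdorff sum an explicit product. *)
Definition coverable r (n : nat) E :=
  exists U : nat -> set (R * R),
    E `<=` \bigcup_(i in `I_n) U i /\ forall i, (diam2 (U i) <= r%:E)%E.

Lemma diam2_le r U : 0 <= r -> (forall x y, U x -> U y -> norm2 (x - y) <= r) ->
  (diam2 U <= r%:E)%E.
Proof.
move=> r0 h; apply: ge_ereal_sup => _ [->|[x [y [xU yU ->]]]].
  by rewrite lee_fin.
by rewrite lee_fin; exact: h.
Qed.

Lemma coverable0 r : 0 <= r -> coverable r 0 set0.
Proof.
move=> r0; exists (fun=> set0); split => // _; by apply: diam2_le.
Qed.

Lemma coverableU r n m E F : coverable r n E -> coverable r m F ->
  coverable r (n + m) (E `|` F).
Proof.
move=> [U [EU dU]] [W [FW dW]].
exists (fun i => if (i < n)%N then U i else W (i - n)%N); split; last first.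
  by move=> i; case: ifP.
move=> x [/EU|/FW] [i /= ilt xi].
  by exists i => /=; [exact: ltn_addr|rewrite ilt].
by exists (n + i)%N => /=; [rewrite ltn_add2l|rewrite ltnNge leq_addr addKn].
Qed.

Lemma coverableS r n E F : E `<=` F -> coverable r n F -> coverable r n E.
Proof. by move=> EF [U [FU dU]]; exists U; split => // x /EF /FU. Qed.

Lemma coverable_bigcup r k (n : nat -> nat) (E : nat -> set (R * R)) : 0 <= r ->
  (forall i, (i < k)%N -> coverable r (n i) (E i)) ->
  coverable r (\sum_(i < k) n i) (\bigcup_(i in `I_k) E i).
Proof.
move=> r0; elim: k => [|k IH] h.
  by rewrite big_ord0; apply: coverableS (coverable0 r0); move=> x [].
rewrite big_ord_recr/= bigcup_mkord big_ord_recr/= -bigcup_mkord.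
apply: coverableU; last exact: h.
by apply: IH => i ik; apply: h; rewrite ltnS ltnW.
Qed.

(** Cut the vertical extent into N intervals of length h on each side of y0. *)
Lemma coverable_strip (t0 y0 O h q : R) : 0 < h -> 0 <= O -> 0 <= q ->
  coverable (2 * q + h) (2 * (Num.truncn (O / h)).+1)
    [set z | `|z.1 - t0| <= q /\ `|z.2 - y0| <= O].
Proof.
move=> h0 O0 q0; set N := (Num.truncn (O / h)).+1.
have ON : O < N%:R * h by rewrite -ltr_pdivrMr// truncnS_gt.
exists (fun i => [set z | `|z.1 - t0| <= q /\
  y0 - N%:R * h + i%:R * h <= z.2 <= y0 - N%:R * h + i%:R * h + h]); split; last first.
  move=> i; apply: diam2_le; first by rewrite addr_ge0 ?mulr_ge0// ltW.
  move=> x y /= [x1 /andP[x2 x3]] [y1 /andP[y2 y3]].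
  apply: (le_trans (norm2_le _)); apply: lerD => /=.
    have -> : x.1 - y.1 = (x.1 - t0) - (y.1 - t0) by ring.
    apply: (le_trans (ler_normB _ _)); move: x1 y1; lra.
  by rewrite ler_norml; apply/andP; split; lra.
move=> z /= [z1 z2]; move: z2; rewrite ler_norml => /andP[z2 z3].
pose y := (z.2 - y0 + N%:R * h) / h.
have y0' : 0 <= y by rewrite divr_ge0// ?(ltW h0)//; lra.
have yN : y < (2 * N)%:R by rewrite ltr_pdivrMr// natrM; lra.
have /andP[i1 i2] := truncn_itv y0'.
exists (Num.truncn y) => /=; first by rewrite -(ltr_nat R) (le_lt_trans i1).
split => //; move: i1 i2; rewrite ler_pdivlMr// ltr_pdivrMr// -natr1 => i1 i2.
by apply/andP; split; lra.
Qed.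

Lemma diam2_pow_le s r U : 0 <= s -> (diam2 U <= r%:E)%E -> (diam2_pow s U <= (r `^ s)%:E)%E.
Proof.
move=> s0 dU; rewrite /diam2_pow; case: ifP => _; first by rewrite lee_fin powR_ge0.
have := diam2_ge0 U; case: (diam2 U) dU => [x| |]//; rewrite ?leye_eq// !lee_fin => xr x0.
by rewrite ge0_ler_powR// nnegrE// (le_trans x0).
Qed.

Lemma premeasure_coverable s delta r n E : 0 <= s -> r <= delta -> coverable r n E ->
  (hausdorff_premeasure s delta E <= (n%:R * r `^ s)%:E)%E.
Proof.
move=> s0 rd [U [EU dU]].
pose W i := if (i < n)%N then U i else set0.
have r0 : 0 <= r by rewrite -lee_fin; exact: le_trans (diam2_ge0 _) (dU 0%N).
apply: (@le_trans _ _ (\sum_(0 <= i <oo) diam2_pow s (W i))%E).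
  apply: ereal_inf_lbound; exists W => //; split.
    by move=> x /EU [i /= il xi]; exists i => //; rewrite /W il.
  move=> i; apply: (@le_trans _ _ r%:E); last by rewrite lee_fin.
  by rewrite /W; case: ifP => // _; exact: diam2_le.
rewrite (nneseries_split _ n); last by move=> k _; exact: diam2_pow_ge0.
rewrite add0n [X in (_ + X)%E]eseries0; last first.
  by move=> i ni _; rewrite /W ltnNge ni/= /diam2_pow eqxx.
rewrite adde0 big_mkord; apply: (@le_trans _ _ (\sum_(i < n) (r `^ s)%:E)%E).
  by apply: lee_sum => i _; rewrite /W ltn_ord; exact: diam2_pow_le.
by rewrite sumEFin sumr_const card_ord lee_fin mulr_natl.
Qed.

Lemma hausdorff_measure_eq0 s E (r : R^nat) (n : nat -> nat) :
  0 <= s -> (forall m, coverable (r m) (n m) E) -> r @ \oo --> 0 ->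
  (n m)%:R * (r m) `^ s @[m --> \oo] --> 0 -> hausdorff_measure s E = 0%E.
Proof.
move=> s0 cov r0 n0; apply/eqP; rewrite eq_le hausdorff_measure_ge0 andbT.
apply: ge_ereal_sup => _ [delta /= d0 <-]; apply/lee_addgt0Pr => e e0; rewrite add0e.
have rm : \forall m \near \oo, r m < delta by exact: (cvgr_lt _ r0 _ d0).
have nm : \forall m \near \oo, (n m)%:R * r m `^ s < e by exact: (cvgr_lt _ n0 _ e0).
near \oo => m.
have h1 : r m < delta by near: m.
have h2 : (n m)%:R * r m `^ s < e by near: m.
apply: (le_trans (premeasure_coverable s0 (ltW h1) (cov m))).
by rewrite lee_fin ltW.
Unshelve. all: by end_near. Qed.

End coverable.

(** * Chaining along a D-adic grid *)

Section chaining.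
Context (R : realType).
Variables (D : nat) (Z : R -> R).
Hypothesis D1 : (1 < D)%N.

Let D0 : (0 < D)%N. Proof. exact: ltnW. Qed.
Let DR0 j : 0 < (D%:R : R) ^+ j. Proof. by rewrite exprn_gt0// ltr0n. Qed.

Definition node j (i : nat) : R := i%:R / D%:R ^+ j.
Definition cell j (x : R) : nat := Num.truncn (x * D%:R ^+ j).
Definition incr j i : R := Z (node j i.+1) - Z (node j i).
Definition level_energy j : R := \sum_(i < D ^ j) incr j i ^+ 4.
(** The part of [level_energy j] over the cell k of level m. *)
Definition cell_energy m j k : R :=
  \sum_(i < D ^ j | (i %/ D ^ (j - m) == k)%N) incr j i ^+ 4.

Lemma cell_itv j x : 0 <= x -> (cell j x)%:R <= x * D%:R ^+ j < (cell j x).+1%:R.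
Proof. by move=> x0; apply: truncn_itv; rewrite mulr_ge0// ltW. Qed.

Lemma cell_lt j x : 0 <= x -> x < 1 -> (cell j x < D ^ j)%N.
Proof.
move=> x0 x1; rewrite -(ltr_nat R) natrX; have /andP[h _] := cell_itv j x0.
by apply: (le_lt_trans h); rewrite gtr_pMl.
Qed.

Lemma cell_div m j x : 0 <= x -> (m <= j)%N -> (cell j x %/ D ^ (j - m))%N = cell m x.
Proof.
move=> x0 mj; have q0 : (0 < D ^ (j - m))%N by rewrite expn_gt0 D0.
apply/esym/truncn_def.
have E : x * D%:R ^+ j = x * D%:R ^+ m * (D ^ (j - m))%:R.
  by rewrite -mulrA natrX -exprD subnKC.
have qR : 0 < (D ^ (j - m))%:R :> R by rewrite ltr0n.
have /andP[] := cell_itv j x0; rewrite E => h1 h2.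
rewrite -(ler_pM2r qR) -(ltr_pM2r qR) -!natrM; apply/andP; split.
  by apply: le_trans h1; rewrite ler_nat leq_trunc_div.
by apply: (lt_le_trans h2); rewrite ler_nat ltn_ceil.
Qed.

Lemma incr4_ge0 j i : 0 <= incr j i ^+ 4.
Proof. by rewrite (exprM _ 2 2) sqr_ge0. Qed.

Lemma cell_energy_ge0 m j k : 0 <= cell_energy m j k.
Proof. by apply: sumr_ge0 => i _; exact: incr4_ge0. Qed.

Lemma sum_cell_energy m j : \sum_(k < D ^ m) cell_energy m j k <= level_energy j.
Proof.
rewrite /cell_energy /level_energy.
under eq_bigr do rewrite big_mkcond/=.
rewrite exchange_big/=; apply: ler_sum => i _.
rewrite -big_mkcond/=; under eq_bigl do rewrite eq_sym.
by rewrite (big_ord1_eq _ (fun=> incr j i ^+ 4)); case: ifP => // _; exact: incr4_ge0.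
Qed.

(** Replaces a maximum of increments by a sum of fourth powers, whose expectation
    is under control, without any loss when the increments are below e. *)
Lemma norm_le_quartic (y e : R) : 0 < e -> `|y| <= e + y ^+ 4 / e ^+ 3.
Proof.
move=> e0; have e3 : 0 < e ^+ 3 by rewrite exprn_gt0.
have y4 : y ^+ 4 = `|y| ^+ 4.
  by rewrite (exprM _ 2 2) [in RHS](exprM _ 2 2) real_normK// num_real.
have [h|h] := leP `|y| e.
  by apply: (le_trans h); rewrite lerDl divr_ge0 ?(ltW e3)// y4 exprn_ge0.
apply: (@le_trans _ _ (y ^+ 4 / e ^+ 3)); last by rewrite lerDr ltW.
rewrite ler_pdivlMr// y4 [leRHS]exprS ler_wpM2l//.
by apply: lerXn2r; rewrite ?nnegrE// ltW.
Qed.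

(** Successive approximations of x differ by fewer than D steps of the finer
    grid, all within the cell of x at level m. *)
Lemma chain_step m j x (e : R) : 0 <= x -> x < 1 -> (m <= j)%N -> 0 < e ->
  `|Z (node j.+1 (cell j.+1 x)) - Z (node j (cell j x))|
    <= D%:R * (e + cell_energy m j.+1 (cell m x) / e ^+ 3).
Proof.
move=> x0 x1 mj e0; set b := e + _.
have e3 : 0 < e ^+ 3 by rewrite exprn_gt0.
have b0 : 0 <= b by rewrite addr_ge0 ?divr_ge0 ?cell_energy_ge0// ltW.
set q := cell j x.
have qE : (cell j.+1 x %/ D)%N = q.
  by have := cell_div x0 (leqnSn j); rewrite subSn// subnn expn1.
have qD i : (i < D)%N -> `|incr j.+1 (q * D + i)| <= b.
  move=> iD; apply: (le_trans (norm_le_quartic _ e0)); rewrite lerD2l.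
  rewrite ler_wpM2r ?invr_ge0 ?(ltW e3)//.
  have lt : (q * D + i < D ^ j.+1)%N.
    rewrite expnS mulnC; have : (q < D ^ j)%N by exact: cell_lt.
    by move: iD D0; nia.
  rewrite /cell_energy (bigD1 (Ordinal lt))/=; last first.
    rewrite subSn// expnS divnMA divnMDl// (divn_small iD) addn0.
    by rewrite /q cell_div.
  by rewrite lerDl; apply: sumr_ge0 => l _; exact: incr4_ge0.
have main r : (r <= D)%N ->
    `|Z (node j.+1 (q * D + r)) - Z (node j.+1 (q * D))| <= r%:R * b.
  elim: r => [|r IH] rD; first by rewrite addn0 subrr normr0 mul0r.
  rewrite addnS (_ : _ - _ = incr j.+1 (q * D + r) +
     (Z (node j.+1 (q * D + r)) - Z (node j.+1 (q * D)))); last by rewrite /incr; ring.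
  apply: (le_trans (ler_normD _ _)).
  have := qD r rD; have := IH (ltnW rD); rewrite -natr1; lra.
have -> : node j q = node j.+1 (q * D).
  rewrite /node natrM exprSr; field.
  by rewrite (gt_eqF (DR0 j)) pnatr_eq0 -lt0n D0.
rewrite [cell j.+1 x](divn_eq _ D) qE.
have rD : (cell j.+1 x %% D < D)%N by rewrite ltn_mod.
apply: (le_trans (main _ (ltnW rD))); apply: ler_wpM2r => //.
by rewrite ler_nat ltnW.
Qed.

Lemma chain m n x (e : nat -> R) : 0 <= x -> x < 1 -> (forall l, 0 < e l) ->
  `|Z (node (m + n) (cell (m + n) x)) - Z (node m (cell m x))|
    <= \sum_(l < n) D%:R * (e l + cell_energy m (m + l).+1 (cell m x) / e l ^+ 3).
Proof.
move=> x0 x1 e0; elim: n => [|n IH]; first by rewrite addn0 subrr normr0 big_ord0.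
rewrite big_ord_recr/= addnS.
rewrite (_ : _ - _ = (Z (node (m + n) (cell (m + n) x)) - Z (node m (cell m x)))
  + (Z (node (m + n).+1 (cell (m + n).+1 x)) - Z (node (m + n) (cell (m + n) x)))); last by ring.
apply: (le_trans (ler_normD _ _)); apply: lerD => //.
by apply: chain_step => //; exact: leq_addr.
Qed.

Lemma node_cell_near j x : 0 <= x -> `|x - node j (cell j x)| <= (D%:R ^+ j)^-1.
Proof.
move=> x0; have /andP[h1 h2] := cell_itv j x0.
have E : x - node j (cell j x) = (x * D%:R ^+ j - (cell j x)%:R) / D%:R ^+ j.
  by rewrite /node mulrBl mulfK// gt_eqF.
rewrite E normrM ger0_norm ?subr_ge0// ger0_norm ?invr_ge0 ?(ltW (DR0 _))//.
rewrite ler_piMl// ?invr_ge0 ?(ltW (DR0 _))//.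
by rewrite lerBlDl natr1 ltW.
Qed.

(** Uniform continuity on [0, 1], by compactness. *)
Lemma node_cell_approx (e : R) : continuous Z -> 0 < e ->
  exists N, forall j x, (N <= j)%N -> 0 <= x <= 1 -> `|Z x - Z (node j (cell j x))| <= e.
Proof.
move=> cZ e0.
have cK := @segment_compact R 0 1.
have : \forall j \near \oo, `[0, 1]%classic `<=` [set x | 0 <= x -> `|Z x - Z (node j (cell j x))| <= e].
  apply: (compact_near_coveringP _).1 => // x0 _.
  have e2 : 0 < e / 2 by lra.
  have /cvgrPdist_le/(_ _ e2) := cZ x0.
  move=> /nbhs_ballP[d /= d0 hd].
  have d2 : 0 < d / 2 by lra.
  have dcvg : ((D%:R : R)^-1) ^+ n @[n --> \oo] --> 0.
    apply: cvg_expr; rewrite ger0_norm ?invr_ge0//.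
    by rewrite invf_lt1 ?ltr1n// ltr0n.
  exists (ball x0 (d / 2), [set j | `|(D%:R : R)^-1 ^+ j| < d / 2]) => /=.
    split; first exact: nbhsx_ballx.
    exact: (cvgr0_norm_lt _ dcvg _ d2).
  move=> [x j] /= [bx bj] x0'.
  have h1 : `|Z x0 - Z x| <= e / 2.
    apply: hd; apply: le_ball bx; lra.
  have h2 : `|Z x0 - Z (node j (cell j x))| <= e / 2.
    apply: hd; rewrite /ball/= (_ : x0 - _ = (x0 - x) + (x - node j (cell j x))); last by ring.
    apply: (le_lt_trans (ler_normD _ _)).
    move: bx; rewrite /ball/= => bx; have := node_cell_near j x0'.
    move: bj; rewrite exprVn ger0_norm ?invr_ge0 ?(ltW (DR0 _))//; move: bx; lra.
  rewrite (_ : Z x - _ = (Z x0 - Z (node j (cell j x))) - (Z x0 - Z x)); last by ring.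
  apply: (le_trans (ler_normB _ _)); move: h1 h2; lra.
move=> [N _ hN]; exists N => j x Nj /andP[x0 x1].
by apply: (hN j Nj) => //=; rewrite in_itv/= x0.
Qed.

End chaining.

(** * The Hausdorff measure of a curve of small energy *)

Section curve_cover.
Context (R : realType).
Variables (p : nat) (Z tau : R -> R) (K L : R).
Hypothesis p3 : (2 < p)%N.
Hypothesis K0 : 0 <= K.
Hypothesis L0 : 0 <= L.
Hypothesis cZ : continuous Z.
Hypothesis tau_lip : forall x y, `|tau x - tau y| <= L * `|x - y|.

Let D : nat := (4 ^ p)%N.
Hypothesis energy : forall j,
  level_energy D Z j <= K * 2 ^+ j.+1 / D%:R ^+ j.

Let D1 : (1 < D)%N.
Proof. by rewrite /D -(expn0 4) ltn_exp2l// (ltn_trans _ p3). Qed.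

(** The square root of D^m: the typical increment over a cell of level m is its
    inverse. *)
Definition root_scale m : R := 2 ^+ (p * m).

Lemma root_scale_gt0 m : 0 < root_scale m. Proof. by rewrite exprn_gt0. Qed.

Lemma root_scale_sq m : (D%:R : R) ^+ m = root_scale m ^+ 2.
Proof.
rewrite /D /root_scale natrX -exprM exprAC; congr (_ ^+ _); ring.
Qed.

(** Geometric decay in l keeps the sum of the thresholds bounded; their inverse
    cubes grow like 8^l only, so that their products with the energies, of
    order (2 / D)^l, are summable as D >= 64. *)
Definition threshold m l : R := (root_scale m * 2 ^+ l.+1)^-1.

Lemma threshold_gt0 m l : 0 < threshold m l.
Proof. by rewrite invr_gt0 mulr_gt0 ?root_scale_gt0// exprn_gt0. Qed.

(** The chaining bound for Z in the cell k of level m, down to level m + n. *)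
Definition oscillation m n k : R := \sum_(l < n) D%:R *
  (threshold m l + cell_energy D Z m (m + l).+1 k / threshold m l ^+ 3).

Lemma sum_half n : \sum_(l < n) ((2 : R) ^+ l.+1)^-1 <= 1.
Proof.
suff -> : \sum_(l < n) ((2 : R) ^+ l.+1)^-1 = 1 - (2 ^+ n)^-1.
  by rewrite gerBl invr_ge0 exprn_ge0.
elim: n => [|n IH]; first by rewrite big_ord0 expr0 invr1 subrr.
rewrite big_ord_recr/= IH exprS; field.
by rewrite expf_neq0.
Qed.

Lemma level_energy_threshold m l :
  level_energy D Z (m + l).+1 / threshold m l ^+ 3 <=
  2 * K * 2 ^+ m * root_scale m * (2 ^+ l.+1)^-1.
Proof.
have u0 := root_scale_gt0 m.
have [b bE] : exists b : R, b = 2 ^+ l.+1 by exists (2 ^+ l.+1).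
have b0 : 0 < b by rewrite bE exprn_gt0.
have DE : u0 = u0 by [].
have Db : b ^+ 5 <= (D%:R : R) ^+ l.+1.
  rewrite bE exprAC; apply: lerXn2r; rewrite ?nnegrE ?exprn_ge0//.
  rewrite /D -natrX ler_nat (_ : 4 = 2 ^ 2)%N// -expnM leq_exp2l//.
  by move: p3; lia.
have t3 : (threshold m l ^+ 3)^-1 = root_scale m ^+ 3 * b ^+ 3.
  by rewrite /threshold -bE exprVn invrK exprMn.
have e := energy (m + l).+1.
have E2 : (2 : R) ^+ (m + l).+2 = 2 * 2 ^+ m * b.
  by rewrite bE -addnS exprS exprD; ring.
have ED : (D%:R : R) ^+ (m + l).+1 = root_scale m ^+ 2 * D%:R ^+ l.+1.
  by rewrite -addnS exprD root_scale_sq.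
rewrite t3 -bE; rewrite E2 ED in e.
have m2 : 0 < (2 : R) ^+ m by rewrite exprn_gt0.
have Dl : 0 < (D%:R : R) ^+ l.+1 by rewrite (lt_le_trans _ Db)// exprn_gt0.
have ub : 0 <= root_scale m ^+ 3 * b ^+ 3 by rewrite mulr_ge0 ?exprn_ge0// ltW.
apply: (le_trans (ler_wpM2r ub e)).
apply: (@le_trans _ _ (K * (2 * 2 ^+ m * b) / (root_scale m ^+ 2 * b ^+ 5) * (root_scale m ^+ 3 * b ^+ 3))).
  apply: ler_wpM2r => //; apply: ler_wpM2l.
    by rewrite !mulr_ge0// ltW.
  rewrite lef_pV2 ?posrE ?mulr_gt0 ?exprn_gt0 ?ltr0n ?(ltnW D1)//.
  by apply: ler_wpM2l => //; rewrite exprn_ge0// ltW.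
rewrite le_eqVlt; apply/orP; left; apply/eqP.
have un : root_scale m != 0 by rewrite gt_eqF.
have bn : b != 0 by rewrite gt_eqF.
by generalize (root_scale m) un (2 ^+ m : R) => u uN q; field; rewrite uN bn.
Qed.

(** Only the sum over the cells is bounded, not each term: the covering number
    adds up the oscillations, and the cell energies add up to the energy of the
    level. *)
Lemma sum_oscillation m n :
  \sum_(k < D ^ m) oscillation m n k <=
  D%:R * (root_scale m + 2 * K * 2 ^+ m * root_scale m).
Proof.
rewrite /oscillation exchange_big/=.
under eq_bigr do rewrite -mulr_sumr.
rewrite -mulr_sumr; apply: ler_wpM2l => //.
have u0 := root_scale_gt0 m.
apply: (@le_trans _ _ (\sum_(l < n) (root_scale m + 2 * K * 2 ^+ m * root_scale m) * (2 ^+ l.+1)^-1)).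
  apply: ler_sum => l _; rewrite big_split/= mulrDl; apply: lerD.
    rewrite sumr_const card_ord -[leLHS]mulr_natl natrX root_scale_sq /threshold invfM mulrA.
    by rewrite ler_wpM2r ?invr_ge0 ?exprn_ge0// expr2 mulfK// gt_eqF.
  apply: le_trans (level_energy_threshold m l).
  rewrite -mulr_suml; apply: ler_wpM2r; first by rewrite invr_ge0 exprn_ge0// ltW// threshold_gt0.
  by apply: sum_cell_energy.
rewrite -mulr_sumr ler_piMr ?sum_half//.
by rewrite addr_ge0 ?mulr_ge0 ?exprn_ge0// ltW.
Qed.

Definition curve : set (R * R) := [set (tau x, Z x) | x in [set x | 0 <= x < 1]].

Let Cst : R := 4 + 2 * D%:R * (1 + 2 * K).

(** A cell with oscillation O needs about O D^m squares of side D^-m; with u the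
    square root of D^m, the total is O(u^2 (u 2^m) + D^m) = O(2^m u^3). *)
Lemma curve_coverable m : exists2 n : nat, n%:R <= Cst * 2 ^+ m * root_scale m ^+ 3 &
  coverable ((2 * L + 1) / root_scale m ^+ 2) n curve.
Proof.
have u0 := root_scale_gt0 m; pose h : R := (root_scale m ^+ 2)^-1.
have h0 : 0 < h by rewrite invr_gt0 exprn_gt0.
have [N hN] := node_cell_approx D1 cZ h0.
pose O k := h + oscillation m N k.
have osc0 k : 0 <= oscillation m N k.
  apply: sumr_ge0 => l _; rewrite mulr_ge0// addr_ge0 ?(ltW (threshold_gt0 _ _))//.
  by rewrite divr_ge0 ?cell_energy_ge0// exprn_ge0// ltW// threshold_gt0.
have O0 k : 0 <= O k by rewrite addr_ge0// ltW.
pose nn k := (2 * (Num.truncn (O k / h)).+1)%N.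
exists (\sum_(k < D ^ m) nn k)%N; last first.
  apply: (@coverableS _ _ _ _ (\bigcup_(k in `I_(D ^ m))
     [set z | `|z.1 - tau (node R D m k)| <= L * h /\ `|z.2 - Z (node R D m k)| <= O k])).
    move=> _ [x /= /andP[x0 x1] <-]; exists (cell D m x) => /=; first exact: cell_lt.
    split.
      apply: (le_trans (tau_lip _ _)); apply: ler_wpM2l => //.
      by rewrite /h -root_scale_sq; apply: node_cell_near.
    rewrite (_ : Z x - _ = (Z x - Z (node R D (m + N) (cell D (m + N) x))) +
      (Z (node R D (m + N) (cell D (m + N) x)) - Z (node R D m (cell D m x)))); last by ring.
    apply: (le_trans (ler_normD _ _)); apply: lerD.
      by apply: hN; [exact: leq_addl|rewrite x0 ltW].
    by apply: chain => // l; exact: threshold_gt0.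
  have -> : (2 * L + 1) / root_scale m ^+ 2 = 2 * (L * h) + h by rewrite /h; ring.
  apply: coverable_bigcup; first by rewrite addr_ge0 ?mulr_ge0// ltW.
  by move=> k _; apply: coverable_strip => //; rewrite mulr_ge0// ltW.
have nle k : (nn k)%:R <= 2 * root_scale m ^+ 2 * oscillation m N k + 4.
  rewrite /nn natrM -[(Num.truncn _).+1%:R]natr1.
  have t : (Num.truncn (O k / h))%:R <= O k / h by rewrite truncn_le divr_ge0// ltW.
  have -> : 2 * root_scale m ^+ 2 * oscillation m N k + 4 = 2 * (O k / h + 1).
    rewrite /O /h; field; rewrite gt_eqF//.
  by apply: ler_wpM2l => //; rewrite lerD2r.
rewrite natr_sum; apply: (@le_trans _ _ (\sum_(k < D ^ m) (2 * root_scale m ^+ 2 * oscillation m N k + 4))).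
  by apply: ler_sum => k _.
rewrite big_split/= -mulr_sumr sumr_const card_ord -[4 *+ _]mulr_natl natrX root_scale_sq.
have s := sum_oscillation m N.
apply: (@le_trans _ _ (2 * root_scale m ^+ 2 * (D%:R * (root_scale m + 2 * K * 2 ^+ m * root_scale m)) + root_scale m ^+ 2 * 4)).
  by rewrite lerD2r ler_wpM2l// mulr_ge0// exprn_ge0// ltW.
have m2 : 1 <= (2 : R) ^+ m by rewrite exprn_ege1// ler1n.
have u1 : 1 <= root_scale m by rewrite exprn_ege1// ler1n.
rewrite /Cst; have d0 : 0 <= (D%:R : R) by [].
move: (D%:R : R) d0 => dd d0.
have -> : (4 + 2 * dd * (1 + 2 * K)) * 2 ^+ m * root_scale m ^+ 3 =
  root_scale m ^+ 2 * 4 * (2 ^+ m * root_scale m) + 2 * root_scale m ^+ 3 * dd * 2 ^+ m * (1 + 2 * K) by ring.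
rewrite addrC; apply: lerD.
  rewrite ler_peMr ?mulr_ge0 ?exprn_ge0 ?(ltW u0)//.
  by nra.
rewrite (_ : _ * _ = 2 * root_scale m ^+ 3 * dd * (1 + 2 * K * 2 ^+ m)); last by ring.
rewrite -[leRHS]mulrA; apply: ler_wpM2l.
  by rewrite !mulr_ge0// exprn_ge0// ltW.
by rewrite mulrDr mulr1 (mulrC (2 ^+ m)) lerD2r.
Qed.

(** Up to constants, the Hausdorff sum 2^m u^3 (u^-2)^s with u = 2^(p m) and s = 3/2 + 1/p is 2^-m. *)
Lemma curve_hausdorff_measure0 : hausdorff_measure (3 / 2 + p%:R^-1) curve = 0%E.
Proof.
have /choice[n hn] : forall m, exists n : nat, n%:R <= Cst * 2 ^+ m * root_scale m ^+ 3 /\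
    coverable ((2 * L + 1) / root_scale m ^+ 2) n curve.
  by move=> m; have [n n1 n2] := curve_coverable m; exists n.
have p0 : (0 < p)%N by exact: ltn_trans p3.
have s0 : 0 <= 3 / 2 + (p%:R : R)^-1 by rewrite addr_ge0 ?invr_ge0// divr_ge0.
have L1 : 0 <= 2 * L + 1 by rewrite addr_ge0 ?mulr_ge0.
have half : (2^-1 : R) ^+ m @[m --> \oo] --> 0.
  by apply: cvg_expr; rewrite ger0_norm ?invr_ge0// invf_lt1// ltr1n.
have squeeze (c : R) (f : R^nat) : (forall m, 0 <= f m <= c * 2^-1 ^+ m) -> f @ \oo --> 0.
  move=> hf; apply: (@squeeze_cvgr _ _ _ _ (cst 0) (fun m => c * 2^-1 ^+ m)).
  - by apply: nearW => m; exact: hf.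
  - exact: cvg_cst.
  - by rewrite -[X in _ --> X](mulr0 c); apply: cvgM => //; exact: cvg_cst.
apply: (hausdorff_measure_eq0 (r := fun m => (2 * L + 1) / root_scale m ^+ 2) (n := n)) => //.
- by move=> m; have [] := hn m.
- apply: (squeeze (2 * L + 1)) => m; have u0 := root_scale_gt0 m.
  rewrite divr_ge0 ?exprn_ge0 ?(ltW u0)//=; apply: ler_wpM2l => //.
  rewrite exprVn lef_pV2 ?posrE ?exprn_gt0// /root_scale -exprM ler_eXn2l ?ltr1n//.
  by move: p0; nia.
apply: (squeeze (Cst * (2 * L + 1) `^ (3 / 2 + p%:R^-1))) => m.
have u0 := root_scale_gt0 m.
rewrite mulr_ge0 ?powR_ge0//=; have [hm _] := hn m.
apply: (le_trans (ler_wpM2r (powR_ge0 _ _) hm)).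
rewrite powRM ?invr_ge0 ?exprn_ge0 ?(ltW u0)//.
have -> : (root_scale m ^- 2) `^ (3 / 2 + p%:R^-1) = (root_scale m ^+ 3)^-1 * (2 ^+ m)^-1 * (2 ^+ m)^-1.
  have e2 k : (2 : R) `^ k%:R = 2 ^+ k by rewrite powR_mulrn.
  have -> : root_scale m ^- 2 = 2 `^ (- (2 * (p%:R * m%:R))).
    by rewrite powRN -!natrM e2 /root_scale -exprM; congr ((_ ^+ _)^-1); rewrite mulnC.
  rewrite -powRrM -!invfM /root_scale -exprM -!exprD -e2 -powRN; congr (_ `^ _).
  rewrite !natrD !natrM; field; rewrite pnatr_eq0 -lt0n//.
rewrite exprVn le_eqVlt; apply/orP; left; apply/eqP.
have un : root_scale m != 0 by rewrite gt_eqF.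
have mn : (2 : R) ^+ m != 0 by rewrite expf_neq0.
have key (c u q x : R) : u != 0 -> q != 0 ->
    c * q * u ^+ 3 * (x * (u ^- 3 / q / q)) = c * x / q.
  by move=> u1 q1; field; rewrite u1 q1.
exact: key.
Qed.

End curve_cover.

(** * Countable unions, energies and the change of time *)

Section hausdorff_union.
Context (R : realType).

Lemma nneseries_enum_pairs (f : nat -> nat * nat) (F : nat -> nat -> \bar R) :
  set_bij setT setT f -> (forall i j, (0 <= F i j)%E) ->
  (\sum_(0 <= k <oo) F (f k).1 (f k).2 = \sum_(0 <= i <oo) \sum_(0 <= j <oo) F i j)%E.
Proof.
move=> fb F0; rewrite nneseries_esumT//.
rewrite -(reindex_esum _ _ _ (fun p : nat * nat => F p.1 p.2) fb).
have -> : [set: nat * nat] = [set: nat] `*`` (fun=> [set: nat]).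
  by apply/seteqP; split.
rewrite -esum_esum; last by [].
rewrite nneseries_esumT; last by move=> i; exact: nneseries_ge0.
by apply: eq_esum => i _; rewrite nneseries_esumT.
Qed.

Lemma hausdorff_measure_bigcup0 (s : R) (E : nat -> set (R * R)) :
  (forall N, hausdorff_measure s (E N) = 0%E) ->
  hausdorff_measure s (\bigcup_N E N) = 0%E.
Proof.
move=> h; apply/eqP; rewrite eq_le hausdorff_measure_ge0 andbT.
apply: ge_ereal_sup => _ [delta /= d0 <-]; apply/lee_addgt0Pr => e e0; rewrite add0e.
have cov N : exists U : nat -> set (R * R),
    [/\ E N `<=` \bigcup_i U i, forall i, (diam2 (U i) <= delta%:E)%E &
    (\sum_(0 <= i <oo) diam2_pow s (U i) <= (e / (2 ^ N.+1)%:R)%:E)%E].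
  have p0 : (hausdorff_premeasure s delta (E N) < (e / (2 ^ N.+1)%:R)%:E)%E.
    apply: (@le_lt_trans _ _ 0%E); last by rewrite lte_fin divr_gt0// ltr0n expn_gt0.
    by rewrite -(h N); apply: ereal_sup_ubound; exists delta.
  have [_ [U [EU dU] <-] /ltW hU] := ereal_inf_lt p0.
  by exists U.
have [G hG] := choice cov.
have /card_set_bijP[f fb] : ([set: nat] #= [set: nat * nat])%card by rewrite card_eq_sym card_nat2.
apply: (@le_trans _ _ (\sum_(0 <= k <oo) diam2_pow s (G (f k).1 (f k).2))%E).
  apply: ereal_inf_lbound => /=; exists (fun k => G (f k).1 (f k).2) => //.
  split=> [t [N _ EN]|k]; last by have [] := hG (f k).1.
  have [/(_ _ EN) [j _ Gj] _ _] := hG N.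
  by have [_ _ /(_ (N, j) I) [k _ fk]] := fb; exists k => //; rewrite fk.
rewrite (nneseries_enum_pairs (F := fun i j => diam2_pow s (G i j)) fb); last first.
  by move=> i j; exact: diam2_pow_ge0.
have e1 : (\sum_(i <oo) (e / (2 ^ i.+1)%:R)%:E = e%:E)%E.
  have := cvg_lim _ (@cvg_geometric_eseries_half R e 0).
  rewrite /eseries/= expr0 divr1 => <- //.
  by congr (limn _); apply/funext => n; apply: eq_bigr => k _; rewrite addn1.
rewrite -e1; apply: lee_nneseries => [i _ _|i _].
  by apply: nneseries_ge0 => *; exact: diam2_pow_ge0.
by have [] := hG i.
Qed.

Lemma hausdorff_measureS (s : R) (E F : set (R * R)) : E `<=` F ->
  (hausdorff_measure s E <= hausdorff_measure s F)%E.
Proof.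
move=> EF; apply: ge_ereal_sup => _ [delta d0 <-].
apply: (@le_trans _ _ (hausdorff_premeasure s delta F)).
  by apply: le_ereal_inf => _ [U [FU dU] <-]; exists U => //; split => // x /EF /FU.
by apply: ereal_sup_ubound; exists delta.
Qed.

End hausdorff_union.

Section energy_bound.
Context d (T : measurableType d) (R : realType) (P : probability T R).

Lemma ae_level_energy (D : nat) (Y : R -> T -> R) (K : R) : (1 < D)%N ->
  (forall x, measurable_fun setT (Y x)) ->
  (forall x y, (\int[P]_w ((Y x w - Y y w) ^+ 4)%:E <= (K * (x - y) ^+ 2)%:E)%E) ->
  {ae P, forall w, exists2 K' : R, 0 <= K' &
    forall j, level_energy D (Y^~ w) j <= K' * 2 ^+ j.+1 / D%:R ^+ j}.
Proof.
move=> D1 mY hY.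
have DR0 j : 0 < (D%:R : R) ^+ j by rewrite exprn_gt0// ltr0n ltnW.
have x4 (x : R) : 0 <= x ^+ 4 by rewrite (exprM _ 2 2) sqr_ge0.
pose g j w := (D%:R ^+ j * level_energy D (Y^~ w) j)%:E.
have minc j i : measurable_fun setT (fun w => ((incr D (Y^~ w) j i) ^+ 4)%:E : \bar R).
  by apply/measurable_EFinP; apply: measurable_funX; apply: measurable_funB.
have : {ae P, forall w, exists2 K' : R, 0 <= K' & forall j, (g j w <= (K' * 2 ^+ j.+1)%:E)%E}.
  apply: (@ae_bounded_of_expectation _ _ _ _ _ K).
  - move=> j; rewrite /g; under eq_fun do rewrite EFinM -sumEFin.
    by apply: emeasurable_funM => //; exact: emeasurable_sum.
  - by move=> j w; rewrite lee_fin mulr_ge0 ?(ltW (DR0 j))//; apply: sumr_ge0.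
  move=> j; rewrite /g; under eq_integral do rewrite EFinM -sumEFin.
  rewrite ge0_integralZl_EFin; [|by []|by move=> w _; apply: sume_ge0 => i _; rewrite lee_fin|exact: emeasurable_sum|exact: ltW].
  rewrite ge0_integral_sum//; last by move=> i w _; rewrite lee_fin.
  apply: (@le_trans _ _ ((D%:R ^+ j)%:E * \sum_(i < D ^ j) (K * (D%:R ^- j) ^+ 2)%:E)%E).
    apply: lee_wpmul2l; first by rewrite lee_fin ltW.
    apply: lee_sum => i _; apply: (le_trans (hY _ _)); rewrite lee_fin /node -mulrBl.
    by rewrite -natr1 addrAC subrr add0r mul1r.
  rewrite sumEFin sumr_const card_ord -EFinM lee_fin -[X in _ * X]mulr_natl natrX.
  rewrite le_eqVlt; apply/orP; left; apply/eqP.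
  have key (u : R) : 0 < u -> u * (u * (K * u^-1 ^+ 2)) = K.
    by move=> u0; field; rewrite gt_eqF.
  exact: key.
apply: filterS => w [K' K'0 hK']; exists K' => // j.
by rewrite ler_pdivlMr// mulrC -lee_fin; exact: hK'.
Qed.

End energy_bound.

Section time_change.
Context (R : realType).

Lemma clamp_lip (a b x y : R) : `|clamp a b x - clamp a b y| <= `|x - y|.
Proof.
wlog xy : x y / x <= y => [hw|].
  by have [/hw//|/ltW/hw] := leP x y; rewrite distrC (distrC y).
have m : clamp a b x <= clamp a b y.
  by rewrite /clamp le_max2// le_min2.
rewrite distrC ger0_norm ?subr_ge0// distrC ger0_norm ?subr_ge0//.
rewrite /clamp !maxEle !minEle; case: ifP; case: ifP; case: ifP; case: ifP; lra.
Qed.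

(** tau inverts t |-> t + V t, rescaled by L so that [0, b] goes into [0, 1[ and
    continued by constants.  Both summands are nondecreasing, so each of them
    varies less than the sum, and both tau and V o tau are Lipschitz. *)
Lemma time_change (V : R -> R) (b : R) : 0 < b -> V 0 = 0 ->
  {in `[0, b] &, {homo V : s t / s <= t}} ->
  {within `[0, b], continuous V} ->
  exists (L : R) (tau : R -> R), [/\ 0 <= L, forall x, 0 <= tau x <= b,
    forall x y, `|tau x - tau y| <= L * `|x - y|,
    forall x y, `|V (tau x) - V (tau y)| <= L * `|x - y| &
    forall t, 0 <= t <= b -> exists x, 0 <= x < 1 /\ tau x = t].
Proof.
move=> b0 V0 Vm Vc.
have itv t : 0 <= t <= b -> t \in `[0, b] by rewrite in_itv.
have Vb : 0 <= V b by rewrite -V0; apply: Vm; rewrite ?in_itv/= ?lexx ?(ltW b0).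
pose W t := t + V t; pose M := b + V b.
have M0 : 0 < M by rewrite /M; lra.
have ivt y : exists t, 0 <= t <= b /\ W t = clamp 0 M y.
  have Wc : {within `[0, b], continuous W}.
    have ci : {within `[0, b], continuous (@idfun R)}.
      by apply: continuous_subspaceT => x; exact: cvg_id.
    by move=> x; apply: cvgD; [exact: ci|exact: Vc].
  have [] := IVT (v := clamp 0 M y) (ltW b0) Wc.
    by rewrite /W V0 addr0 min_l ?(ltW M0)// max_r ?(ltW M0)//; exact: clamp_itv (ltW M0) _.
  by move=> t; rewrite in_itv/= => t0 <-; exists t.
have [sig hsig] := choice ivt.
have Wlip s t : 0 <= s <= b -> 0 <= t <= b ->
    `|s - t| <= `|W s - W t| /\ `|V s - V t| <= `|W s - W t|.
  wlog st : s t / s <= t => [hw hs ht|hs ht].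
    have [/hw|/ltW ts] := leP s t; first exact.
    by rewrite distrC (distrC (W s)) (distrC (V s)); exact: hw.
  have := Vm _ _ (itv _ hs) (itv _ ht) st => Vst.
  have Wst : W s <= W t by rewrite lerD.
  rewrite distrC ger0_norm ?subr_ge0// (distrC (W s)) ger0_norm ?subr_ge0//.
  rewrite distrC ger0_norm ?subr_ge0//; rewrite /W; split; lra.
pose L := M + 1; have L0 : 0 < L by rewrite /L; lra.
have lipW x y : `|W (sig (L * x)) - W (sig (L * y))| <= L * `|x - y|.
  have [_ ->] := hsig (L * x); have [_ ->] := hsig (L * y).
  by apply: (le_trans (clamp_lip _ _ _ _)); rewrite -mulrBr normrM gtr0_norm.
exists L, (fun x => sig (L * x)); split.
- exact: ltW.
- by move=> x; have [] := hsig (L * x).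
- move=> x y; apply: le_trans (lipW x y); apply: (Wlip _ _ _ _).1.
    by have [] := hsig (L * x).
  by have [] := hsig (L * y).
- move=> x y; apply: le_trans (lipW x y); apply: (Wlip _ _ _ _).2.
    by have [] := hsig (L * x).
  by have [] := hsig (L * y).
move=> t ht; have /andP[t0 tb] := ht.
have Vt0 : 0 <= V t by rewrite -V0; apply: Vm; rewrite ?in_itv/= ?lexx ?(ltW b0).
have Vtb : V t <= V b by apply: Vm; rewrite ?in_itv/= ?lexx ?(ltW b0).
have Wt : 0 <= W t <= M by rewrite /W /M; apply/andP; split; lra.
have /andP[Wt0 WtM] := Wt.
exists (W t / L); split.
  by rewrite divr_ge0 ?(ltW L0)//= ltr_pdivrMr// mul1r /L; lra.
rewrite mulrC divfK ?gt_eqF//.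
have [h1 h2] := hsig (W t); rewrite (clamp_id Wt) in h2.
have [+ _] := Wlip _ _ h1 ht.
by rewrite h2 subrr normr0 normr_le0 subr_eq0 => /eqP.
Qed.

End time_change.

(** * The graph of a continuous additive process *)

Section process.
Context d (T : measurableType d) (R : realType) (P : probability T R).

Lemma ae_iff_prob (A B : set T) : measurable A -> measurable B ->
  {ae P, forall w, A w <-> B w} -> P A = P B.
Proof.
move=> mA mB AB; rewrite -(setIT A) -(setIT B).
rewrite -(integral_indic P measurableT mA) -(integral_indic P measurableT mB).
apply: ae_eq_integral => //; try by apply/measurable_EFinP; exact: measurable_indic.
apply: filterS AB => w [h1 h2] _; congr (_%:E); rewrite !indicE.
by congr (_%:R); congr nat_of_bool; apply/idP/idP; rewrite !inE.
Qed.

Variables (S : \bar R) (X B : R -> {RV P >-> R}) (V : R -> R).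
Let J : set R := time_interval S.
Hypothesis rep : brownian_representation J X B V.

Lemma variance_homo s t : J s -> J t -> s <= t -> V s <= V t.
Proof.
have [_ [_ Vm _] _ _] := rep.
by move=> Js Jt; apply: Vm; rewrite inE.
Qed.

Lemma increment_law s t : J s -> J t -> V s < V t ->
  gaussian_law P (Num.sqrt (V t - V s)) (fun w => X t w - X s w).
Proof.
move=> Js Jt st A mA; have [_ _ [_ _ law _] XB] := rep.
have VJ u : J u -> (V @` J) (V u) by move=> Ju; exists u.
rewrite -(law _ _ (VJ s Js) (VJ t Jt) st A mA).
have mi (Y : R -> {RV P >-> R}) u v : measurable [set w | A (Y u w - Y v w)].
  rewrite -[X in measurable X]setTI.
  have mD : measurable_fun setT (fun w => Y u w - Y v w) by exact: measurable_funB.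
  exact: mD.
apply: ae_iff_prob; [exact: (mi X)|exact: (mi B)|].
by apply: filterS XB => w h /=; rewrite (h s Js) (h t Jt).
Qed.

(** When V s = V t the increment vanishes almost surely, since X s and X t are the
    same variable of B. *)
Lemma increment_fourth_moment s t : J s -> J t ->
  (\int[P]_w ((X s w - X t w) ^+ 4)%:E <= (128 * (V s - V t) ^+ 2)%:E)%E.
Proof.
have even4 (x y : R) : (x - y) ^+ 4 = (y - x) ^+ 4.
  by rewrite -(opprB y) exprNn -signr_odd mul1r.
wlog st : s t / V s <= V t => [hw Js Jt|Js Jt].
  have [/hw|/ltW ts] := leP (V s) (V t); first exact.
  under eq_integral do rewrite even4.
  by rewrite -(opprB (V t)) sqrrN; exact: hw.
have mX u : measurable_fun setT (X u) by [].
have [VE|VN] := eqVneq (V s) (V t).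
  have [_ _ _ XB] := rep.
  rewrite (@ae_eq_integral _ _ _ P setT (cst 0%E)).
  - by rewrite integral0 lee_fin mulr_ge0// sqr_ge0.
  - by [].
  - by apply/measurable_EFinP; apply: measurable_funX; exact: measurable_funB.
  - exact: measurable_cst.
  - by apply: filterS XB => w h _; rewrite (h s Js) (h t Jt) VE subrr expr0n.
have Vst : V s < V t by rewrite lt_neqAle VN.
have V0 : 0 < V t - V s by rewrite subr_gt0.
have law := increment_law Js Jt Vst.
under eq_integral do rewrite even4.
have mD : measurable_fun setT (fun w => X t w - X s w) by exact: measurable_funB.
have s0 : 0 < Num.sqrt (V t - V s) by rewrite sqrtr_gt0.
apply: (le_trans (gaussian_fourth_moment s0 mD law)).
by rewrite lee_fin (exprM _ 2 2) sqr_sqrtr ?(ltW V0)// -(opprB (V t)) sqrrN.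
Qed.

Lemma initial_interval (b : R) : J b -> `[0, b]%classic `<=` J.
Proof.
move=> [b0 bS] t; rewrite /= in_itv/= => /andP[t0 tb]; split => //.
by apply: le_trans bS; rewrite lee_fin.
Qed.

Lemma ae_hausdorff_measure0 (b : R) (p : nat) : ae_continuous_paths J X ->
  0 < b -> J b -> (2 < p)%N ->
  {ae P, forall w, hausdorff_measure (3 / 2 + p%:R^-1) (graph (fun t => X t w) `[0, b]) = 0%E}.
Proof.
move=> cX b0 Jb p3; have bJ := initial_interval Jb.
have [_ [V0 _ cV] _ _] := rep.
have Jt t : t \in `[0, b] -> J t by move=> h; exact: bJ.
have [||L [tau [L0 tauI tauL VL tauS]]] := @time_change R V b b0 V0.
- by move=> s t /Jt Js /Jt; exact: variance_homo.
- exact: continuous_subspaceW cV.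
have Jtau x : J (tau x) by apply: Jt; rewrite in_itv; exact: tauI.
have D1 : (1 < 4 ^ p)%N by rewrite -(expn0 4) ltn_exp2l// (ltn_trans _ p3).
have fm x y : (\int[P]_w ((X (tau x) w - X (tau y) w) ^+ 4)%:E <= (128 * L ^+ 2 * (x - y) ^+ 2)%:E)%E.
  apply: (le_trans (increment_fourth_moment (Jtau x) (Jtau y))).
  rewrite lee_fin -[leRHS]mulrA; apply: ler_wpM2l => //.
  rewrite -exprMn -[leLHS]real_normK ?num_real// -[leRHS]real_normK ?num_real//.
  by apply: lerXn2r; rewrite ?nnegrE// normrM (ger0_norm L0).
have mY x : measurable_fun setT (X (tau x)) by [].
have en := @ae_level_energy _ _ _ P (4 ^ p)%N (fun x => X (tau x)) (128 * L ^+ 2) D1 mY fm.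
apply: filterS2 en cX => w [K K0 hK] cw.
pose Z x := X (tau x) w.
have ctau : continuous tau.
  move=> x; apply/cvgrPdist_lt => e e0.
  exists (e / (L + 1)) => /=; first by rewrite divr_gt0// ltr_wpDl.
  move=> y /=; rewrite /ball_/= ltr_pdivlMr ?ltr_wpDl// => h.
  apply: (le_lt_trans (tauL _ _)); apply: le_lt_trans h.
  by rewrite mulrC ler_wpM2l// lerDl.
have cZ : continuous Z.
  have -> : Z = ((fun t => X t w) \o clamp 0 b) \o tau.
    by apply/funext => x; rewrite /Z /= clamp_id.
  move=> x; apply: continuous_comp; first exact: ctau.
  exact: (continuous_clamp_comp (ltW b0) bJ cw).
have H := curve_hausdorff_measure0 p3 K0 L0 cZ tauL hK.
apply/eqP; rewrite eq_le hausdorff_measure_ge0 andbT -H.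
apply: hausdorff_measureS => _ [t /= + <-]; rewrite in_itv => /tauS[x [x01 xt]].
by exists x => //; rewrite /Z xt.
Qed.

Lemma time_interval_exhaustion : (0 < S)%E -> exists b : nat -> R,
  (forall N, 0 < b N /\ J (b N)) /\ forall t, J t -> exists N, t <= b N.
Proof.
rewrite /J /time_interval; case: S => [r| |]//; last first.
  move=> _; exists (fun N => N.+1%:R); split.
    by move=> N; split => //; split => //; rewrite leey.
  by move=> t _; exists (Num.truncn t); rewrite ltW// truncnS_gt.
rewrite lte_fin => r0; exists (fun=> r); split.
  by move=> N; split => //; split => //; exact: ltW.
by move=> t [_]; rewrite lee_fin; exists 0%N.
Qed.

Lemma ae_hausdorff_dim_le : (0 < S)%E -> ae_continuous_paths J X ->
  {ae P, forall w, (hausdorff_dim (graph (fun t => X t w) J) <= (3 / 2)%:E)%E}.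
Proof.
move=> S0 cX; have [b [bJ bE]] := time_interval_exhaustion S0.
have : {ae P, forall w, forall N p, hausdorff_measure (3 / 2 + (p.+3)%:R^-1)
    (graph (fun t => X t w) `[0, b N]) = 0%E}.
  apply: ae_foralln => N; apply: ae_foralln => p.
  by have [b0 Jb] := bJ N; exact: ae_hausdorff_measure0.
apply: filterS => w hw; apply/lee_addgt0Pr => e e0.
pose p := Num.truncn e^-1.
have pe : (p.+3%:R)^-1 <= e.
  rewrite invf_ple ?posrE ?ltr0n//; apply: (le_trans (ltW (truncnS_gt _))).
  by rewrite ler_nat ltnS -addn2 leq_addr.
apply: (@le_trans _ _ (3 / 2 + p.+3%:R^-1)%:E); last by rewrite -EFinD lee_fin lerD2l.
apply: ereal_inf_lbound; exists (3 / 2 + p.+3%:R^-1) => //; split.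
  by rewrite addr_ge0 ?divr_ge0 ?invr_ge0.
have -> : graph (fun t => X t w) J = \bigcup_N graph (fun t => X t w) `[0, b N].
  apply/seteqP; split.
    move=> _ [t Jt <-]; have [N tN] := bE t Jt; exists N => //; exists t => //.
    by rewrite /= in_itv/= tN andbT; case: Jt.
  move=> _ [N _ [t tN <-]]; exists t => //.
  by have [_ Jb] := bJ N; exact: initial_interval Jb _ tN.
by apply: hausdorff_measure_bigcup0 => N; exact: hw.
Qed.

(** The finitely many exceptional times do not fill an open interval of J. *)
Lemma bilipschitz_interval : (0 < S)%E ->
  finite_set [set t | J t /\ ~ locally_bilipschitz J V t] ->
  exists a b c C : R, [/\ 0 < a, a < b <= a + 1, `[a, b]%classic `<=` J, 0 < c /\ 0 < C &
    forall u v, u \in `[a, b] -> v \in `[a, b] ->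
      c * `|u - v| <= `|V u - V v| <= C * `|u - v|].
Proof.
move=> S0 fin; have [b0 [/(_ 0%N)[+ +] _]] := time_interval_exhaustion S0.
move: (b0 0%N) => {b0} b b0 Jb.
have [t t0b reg] : exists2 t, t \in `]0, b[ & locally_bilipschitz J V t.
  apply: contrapT => none.
  have sub : `]0, b[%classic `<=` [set t | J t /\ ~ locally_bilipschitz J V t].
    move=> t tb; split; last by move=> lt; apply: none; exists t.
    apply: (initial_interval Jb); move: tb; rewrite /= !in_itv/= => /andP[h1 h2].
    by rewrite (ltW h1) (ltW h2).
  have /finite_set_countable/countable_lebesgue_measure0 := sub_finite_set sub fin.
  rewrite lebesgue_measure_itv/= lte_fin b0 oppr0 adde0 => /eqP.
  by rewrite eqe gt_eqF.
move: t0b; rewrite in_itv/= => /andP[t0 tb].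
have [delta [c [C [d0 c0 C0 lip]]]] := reg.
pose e := Num.min (delta / 4) (Num.min (b - t) 1).
have e0 : 0 < e by rewrite !lt_min divr_gt0//= subr_gt0 tb ltr01.
have [e1 e2 e3] : [/\ e <= delta / 4, e <= b - t & e <= 1].
  by split; rewrite /e !ge_min lexx ?orbT.
have itvJ : `[t, t + e]%classic `<=` J.
  move=> u; rewrite /= in_itv/= => /andP[u1 u2]; apply: (initial_interval Jb).
  by rewrite /= in_itv/=; apply/andP; split; lra.
exists t, (t + e), c, C; split => //.
  by rewrite ltrDl e0 lerD2l.
move=> u v uI vI.
have near x : x \in `[t, t + e] -> `|x - t| < delta / 2.
  rewrite in_itv/= => /andP[x1 x2]; rewrite ger0_norm; lra.
by have [-> ->] := lip u v (itvJ u uI) (itvJ v vI) (near u uI) (near v vI).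
Qed.

Lemma regular_on_bilipschitz (a b c C : R) : independent_increments J X ->
  0 < a -> a < b <= a + 1 -> `[a, b]%classic `<=` J -> 0 < c -> 0 < C ->
  (forall u v, u \in `[a, b] -> v \in `[a, b] ->
      c * `|u - v| <= `|V u - V v| <= C * `|u - v|) ->
  regular_on P X a b c C.
Proof.
move=> indep a0 /andP[ab ba1] abJ c0 C0 lip.
have Jb : J b by apply: abJ; rewrite /= in_itv/= lexx (ltW ab).
split => //.
- by rewrite lerBlDl.
- move=> n t ht inc; apply: indep => // i iN.
  by apply: (initial_interval Jb); rewrite /= in_itv/=; exact: ht.
move=> s t as_ st tb.
have sI : s \in `[a, b] by rewrite in_itv/= as_ (le_trans (ltW st)).
have tI : t \in `[a, b] by rewrite in_itv/= tb (le_trans as_ (ltW st)).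
have Vst : V s <= V t by apply: variance_homo; [exact: abJ|exact: abJ|exact: ltW].
have := lip t s tI sI; rewrite !ger0_norm ?subr_ge0 ?(ltW st)// => /andP[l1 l2].
have V0 : 0 < V t - V s by apply: lt_le_trans l1; rewrite mulr_gt0// subr_gt0.
exists (Num.sqrt (V t - V s)); split; first by rewrite sqrtr_gt0.
  by rewrite sqr_sqrtr ?(ltW V0)// l1 l2.
by apply: increment_law; [exact: abJ|exact: abJ|rewrite -subr_gt0].
Qed.

End process.

Theorem corollary1p4 (R : realType) (d : measure_display)
    (T : measurableType d) (P : probability T R)
    (S : \bar R) (hS : (0 < S)%E)
    (X : R -> {RV P >-> R})
    (hX : continuous_additive_process (time_interval S) X)
    (hX0 : centered (time_interval S) X)
    (B : R -> {RV P >-> R}) (V : R -> R)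
    (hrep : brownian_representation (time_interval S) X B V)
    (hV : finite_set [set t | time_interval S t /\
                              ~ locally_bilipschitz (time_interval S) V t]) :
  {ae P, forall w,
    hausdorff_dim (graph (fun t => X t w) (time_interval S)) = (3 / 2)%:E /\
    ((2 / 3)%:E <= fourier_dim (graph (fun t => X t w) (time_interval S)))%E}.
Proof.
have [[indep _ _] cX] := hX.
have [a [b [c [C [a0 ab abJ [c0 C0] lip]]]]] := bilipschitz_interval hS hV.
have reg := regular_on_bilipschitz hrep indep a0 ab abJ c0 C0 lip.
have dim_ge := ae_hausdorff_dim_ge reg abJ.
have dim_le := ae_hausdorff_dim_le hrep hS cX.
have decay := ae_osc_decay reg.
apply: filterS3 (filterI dim_ge dim_le) decay cX => w [ge le] dec cw.
have pc : path_continuous X a b w by exact: continuous_subspaceW cw.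
split; first by apply/eqP; rewrite eq_le le ge.
have [L L0 hL] := dec pc.
apply/lee_subgt0Pr => e e0; rewrite -EFinB.
have al : 0 <= Num.max 0 (2 / 3 - e) < 2 / 3.
  by rewrite le_max lexx gt_max divr_gt0//= ltrBlDr ltrDl.
apply: le_trans (fourier_dim_graph_ge reg abJ pc L0 hL al).
by rewrite lee_fin le_max lexx orbT.
Qed.
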